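(* Suppose that for some $T>0$ we have $u\in C([0,T];H^1(\mathbb R))\cap L^2([0,T];H^2(\mathbb R))$ and $b\in C([0,T])$, and that $(u,b)$ satisfies, in the weak sense, $$\partial_t u(t,x)=\tfrac12\partial_{xx}u(t,x)-u(t,x)\mathbf 1_{(-\infty,0]}(x-b(t)),\qquad u(0,x)=f(x)>0\ \ (x\in\mathbb R),\qquad \int_{\mathbb R}u(t,x)\,dx=G(t)\ \ (t\in[0,T]).$$ Assume furthermore that $u_0=f\in L^2(\mathbb R)$ with $\int_{\mathbb R}f(y)\,dy=1$. Then for a.e. $x\in\mathbb R$, $$u(t,x)=\mathbb E\left[f(x+B_t)\exp\left(-\int_0^t\mathbf 1_{(-\infty,0]}(x+B_{t-s}-b(s))\,ds\right)\right],\qquad t\in[0,T],$$ and as a result $$G(t)=\int_{\mathbb R}\mathbb E\left[\exp\left(-\int_0^t\mathbf 1_{(-\infty,0]}(x+B_s-b(s))\,ds\right)\right]f(x)\,dx,\qquad t\in[0,T].$$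
   Context: $(B_t)_{t\ge0}$ is a standard one-dimensional Brownian motion with $B_0=0$; $\mathbf 1_A$ is the indicator function of $A$. $G\in C^1$ is a given function (standing assumption). ''In the weak sense'' means: for all $\phi\in C_c^\infty([0,T]\times\mathbb R)$ (smooth, compactly supported in $[0,T]\times\mathbb R$, not required to vanish at $t=0$ or $t=T$) $$\int_0^T\!\!\int_{\mathbb R}u\,\partial_t\phi\,dx\,dt=\int_{\mathbb R}u\phi|_{t=T}\,dx-\int_{\mathbb R}f\phi|_{t=0}\,dx-\frac12\int_0^T\!\!\int_{\mathbb R}u\,\partial_x^2\phi\,dx\,dt+\int_0^T\!\!\int_{\mathbb R}\mathbf 1_{(-\infty,b(t)]}(x)\,u\,\phi\,dx\,dt,$$ and $G(t)=\int_{\mathbb R}u(t,x)\,dx$ for all $t\in[0,T]$. Here $C([0,T];H^1(\mathbb R))$ is the space of continuous functions from $[0,T]$ to $H^1(\mathbb R)$. *)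

(* Defs.v *)
From HB Require Import structures.
From mathcomp Require Import all_boot all_order all_algebra.
From mathcomp Require Import all_classical all_reals all_analysis.

Set Implicit Arguments.
Unset Strict Implicit.
Unset Printing Implicit Defensive.

Import Order.TTheory GRing.Theory Num.Theory.
Import numFieldNormedType.Exports.

Local Open Scope classical_set_scope.
Local Open Scope ring_scope.

Section SmoothFunctions.
Context {R : realType}.

Fixpoint Ck (V : normedModType R) (k : nat) (phi : V -> R) : Prop :=
  continuous phi /\
  if k is k'.+1 then
    forall v : V, (forall p, derivable phi p v) /\ Ck k' ('D_v phi)
  else True.

(* C_c^oo(V).  For V = R * R the restrictions to [0, T] x R of these functions
   are exactly C_c^oo([0, T] x R), with no condition at t = 0 or t = T. *)
Definition test_function (V : normedModType R) (phi : V -> R) : Prop :=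
  (forall k, Ck k phi) /\ compact (closure [set p | phi p != 0]).

(* Differentiability is only asked inside ]a, b[: since the derivative extends
   continuously to [a, b], the one-sided derivatives exist at a and b. *)
Definition C1_on (a b : R) (g : R -> R) : Prop :=
  {within `[a, b], continuous g} /\
  exists dg : R -> R, {within `[a, b], continuous dg} /\
    forall t, t \in `]a, b[ -> is_derive t 1 g (dg t).

End SmoothFunctions.

Section SobolevSpaces.
Context {R : realType}.
Local Notation mu := (@lebesgue_measure R).

Definition is_weak_deriv (v w : R -> R) : Prop :=
  forall phi : R -> R, test_function (phi : R^o -> R) ->
    \int[mu]_x (v x * 'D_1 phi x) = - \int[mu]_x (w x * phi x).

(* Elements of H^k(R) are given by arbitrary (measurable) representatives. *)
Fixpoint in_H (k : nat) (v : R -> R) : Prop :=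
  v \in Lfun mu 2%:E /\
  if k is k'.+1 then exists w, is_weak_deriv v w /\ in_H k' w else True.

(* A chosen L^2 weak derivative; unique up to a.e. equality when it exists. *)
Definition weak_deriv (v : R -> R) : R -> R :=
  get [set w : R -> R | w \in Lfun mu 2%:E /\ is_weak_deriv v w].

Definition H_norm (k : nat) (v : R -> R) : R :=
  Num.sqrt (\sum_(j < k.+1)
    fine 'N[mu]_2%:E[EFin \o iter j weak_deriv v] ^+ 2).

Definition C_H (k : nat) (T : R) (u : R -> R -> R) : Prop :=
  (forall t, t \in `[0, T] -> in_H k (u t)) /\
  forall s, s \in `[0, T] ->
    H_norm k (u t \- u s) @[t --> within `[0, T] (nbhs s)] --> (0 : R).

Definition H_simple (k : nat) (s : R -> R -> R) : Prop :=
  exists (n : nat) (A : 'I_n -> set R) (h : 'I_n -> R -> R),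
    (forall i, measurable (A i) /\ in_H k (h i)) /\
    forall t x, s t x = \sum_(i < n) \1_(A i) t * h i x.

(* Bochner's L^2([0, T]; H^k(R)): H^k-valued for a.e. t, strongly measurable
   (a.e. limit of simple functions), with square integrable norm. *)
Definition L2_H (k : nat) (T : R) (u : R -> R -> R) : Prop :=
  [/\ {ae mu, forall t, t \in `[0, T] -> in_H k (u t)},
      exists s : nat -> R -> R -> R, (forall n, H_simple k (s n)) /\
        {ae mu, forall t, t \in `[0, T] ->
          H_norm k (u t \- s n t) @[n --> \oo] --> (0 : R)} &
      (\int[mu]_(t in `[0%R, T]) (H_norm k (u t) ^+ 2)%:E < +oo)%E].

End SobolevSpaces.

Section WeakSolution.
Context {R : realType}.
Local Notation mu := (@lebesgue_measure R).

Definition weak_pde (T : R) (f b : R -> R) (u : R -> R -> R) : Prop :=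
  forall phi : R^o * R^o -> R, test_function phi ->
    \int[mu]_(t in `[0, T]) \int[mu]_x (u t x * 'D_(1, 0) phi (t, x)) =
      \int[mu]_x (u T x * phi (T, x))
    - \int[mu]_x (f x * phi (0, x))
    - 2^-1 * \int[mu]_(t in `[0, T]) \int[mu]_x
        (u t x * 'D_(0, 1) ('D_(0, 1) phi) (t, x))
    + \int[mu]_(t in `[0, T]) \int[mu]_x
        (\1_(`]-oo, b t]) x * u t x * phi (t, x)).

(* The last equation is between extended reals: as its right-hand side is
   finite, it includes the integrability of u t. *)
Definition weak_solution (T : R) (f G b : R -> R) (u : R -> R -> R) : Prop :=
  [/\ weak_pde T f b u,
      {ae mu, forall x, u 0 x = f x},
      (forall x, 0 < f x) &
      forall t, t \in `[0, T] -> (\int[mu]_x (u t x)%:E = (G t)%:E)%E].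

End WeakSolution.

Section BrownianMotion.
Context {R : realType} {d : measure_display} {Omega : measurableType d}.

(* Only the times t >= 0 matter. *)
Definition standard_brownian_motion (P : probability Omega R)
    (B : R -> {RV P >-> R}) : Prop :=
  [/\ {ae P, forall w, B 0 w = 0},
      {ae P, forall w, {within `[0, +oo[, continuous (fun t => B t w)}},
      (forall s t : R, 0 <= s -> s < t ->
        forall A : set R, measurable A ->
          P [set w | A (B t w - B s w)] = normal_prob 0 (Num.sqrt (t - s)) A) &
      (forall (n : nat) (t : nat -> R) (A : nat -> set R),
        0 <= t 0%N -> (forall i, t i <= t i.+1) ->
        (forall i, measurable (A i)) ->
        P (\bigcap_(i < n) [set w | A i (B (t i.+1) w - B (t i) w)]) =
        (\prod_(i < n) P [set w | A i (B (t i.+1) w - B (t i) w)%R])%E)].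

End BrownianMotion.

(* Main.v *)
(* Only the continuity of t |-> u t in L^2 matters.  Testing the weak equation
   against heat kernels gives the mild (Duhamel) equation, from which one step of
   length h of the solution is, up to o(h) in L^2, damping by exp(-h) on
   ]-oo, b s] followed by the heat semigroup.  As both operators are contractions,
   the errors add up, and u t is the L^2 limit of the N-fold products with
   h = t / N.  Such a product is a Gaussian random walk expectation with the weight
   exp(- Riemann sum of the occupation time).  A Brownian path at a fixed time
   s > 0 has no atom, so almost surely it meets the boundary on a null set of times
   only, and the Riemann sums converge to the occupation time.  The products read
   backwards give the representation of u t; paired with a test function and read
   forwards, by symmetry of the heat kernel, they give that of the total mass.

   The paths of B are continuous only off a null set, and the functionals in the
   theorem need not be measurable there: B is replaced by a version W with all
   paths continuous, and integrals of nonnegative functions are compared off a null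
   set without measurability.  Likewise u and b, continuous on [0, T], are composed
   with the projection of R onto [0, T]. *)
Require Import Defs.
From HB Require Import structures.
From mathcomp Require Import all_boot all_order all_algebra.
From mathcomp Require Import all_classical all_reals all_analysis.
From mathcomp Require Import measurable_realfun ring lra.

Set Implicit Arguments.
Unset Strict Implicit.
Unset Printing Implicit Defensive.

Import Order.TTheory GRing.Theory Num.Theory.
Import numFieldNormedType.Exports.

Local Open Scope classical_set_scope.
Local Open Scope ring_scope.

(** * The space L^2 *)

(** The heat kernel has no compact support and degenerates at its final time, so the weak equation
    cannot be tested against it at once. Products [a t * h x] come first: they turn the weak
    equation into an integral equation in time for each pairing [ip (u t) h]. Cutoffs then admit
    every smooth [h] with [h], [h'] and [h''] in L^2, in particular a Gaussian, and only afterwards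
    does the Gaussian move with time, its final time [c] staying strictly beyond [t].

    Duhamel's formula is obtained as a scalar identity at each point, so no integral of L^2-valued
    functions occurs; its size in L^2 is measured by pairing with an arbitrary [eta] and applying
    Tonelli.

    On the probabilistic side only finite-dimensional laws and path continuity enter, no stochastic
    calculus. The representation is a limit in L^2, whereas the total mass pairs [u t] with the
    constant 1, which is not in L^2; it is reached through the indicators of [[-m, m]] and monotone
    convergence. *)

Lemma ae_sub d (T : measurableType d) (R : realType)
    (mu : {measure set T -> \bar R}) (P Q : T -> Prop) :
  (forall x, P x -> Q x) -> {ae mu, forall x, P x} -> {ae mu, forall x, Q x}.
Proof. by move=> PQ; exact: filterS. Qed.

Lemma Rintegral_dominated_cvg d (T : measurableType d) (R : realType)
    (mu : {measure set T -> \bar R}) (D : set T) (F : nat -> T -> R) (f g : T -> R) :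
  measurable D ->
  (forall n, measurable_fun D (F n)) -> measurable_fun D f ->
  mu.-integrable D (EFin \o g) ->
  (forall n x, D x -> `|F n x| <= g x) ->
  {ae mu, forall x, D x -> F ^~ x @ \oo --> f x} ->
  \int[mu]_(x in D) F n x @[n --> \oo] --> \int[mu]_(x in D) f x.
Proof.
move=> mD mF mf ig Fg Ff.
have [||||fi _ H] := @dominated_convergence _ _ _ mu D mD
  (fun n x => (F n x)%:E) (EFin \o f) (EFin \o g) _ _ _ ig _.
- by move=> n; exact/measurable_EFinP.
- exact/measurable_EFinP.
- apply: ae_sub Ff => x Fx Dx; apply: cvg_EFin; [exact: nearW|exact: Fx].
- by apply: aeW => x n Dx; rewrite lee_fin Fg.
apply: (fine_cvg (a := \int[mu]_(x in D) f x)).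
rewrite /Rintegral fineK//; exact: integrable_fin_num.
Qed.

Section SquareIntegrable.
Context {R : realType}.
Local Notation mu := (@lebesgue_measure R).
Implicit Types f g h : R -> R.

Definition L2 f := measurable_fun setT f /\
  mu.-integrable setT (EFin \o (fun x => f x ^+ 2)).

(** [Rintegral] takes the value 0 when the integral is infinite, so bilinearity and the norm laws
    below are stated under [L2]. Functions are not identified almost everywhere. *)
Definition ip f g := \int[mu]_x (f x * g x).

Definition nrm f := Num.sqrt (ip f f).

Lemma Lfun_L2 f : f \in Lfun mu 2%:E -> L2 f.
Proof.
move=> f2; split; last exact: Lfun2_integrable_sqr.
by move: f2; rewrite inE => /andP[]; rewrite inE.
Qed.

Lemma L2_measurable f : L2 f -> measurable_fun setT f.
Proof. by case. Qed.

Lemma L2_mul f g : L2 f -> L2 g ->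
  mu.-integrable setT (EFin \o (fun x => f x * g x)).
Proof.
move=> [mf f2] [mg g2].
apply: (@le_integrable _ _ _ mu _ _ _
  (fun x => (f x ^+ 2)%:E + (g x ^+ 2)%:E)%E) => //.
- by apply/measurable_EFinP; exact: measurable_funM.
- move=> x _; rewrite /= lee_fin ler_norml; apply/andP; split.
    rewrite ger0_norm ?addr_ge0 ?sqr_ge0//; nra.
  rewrite ger0_norm ?addr_ge0 ?sqr_ge0//; nra.
- exact: (@integrableD _ _ _ mu _ measurableT _ _ f2 g2).
Qed.

Lemma L2_le f g : measurable_fun setT f -> L2 g ->
  (forall x, `|f x| <= `|g x|) -> L2 f.
Proof.
move=> mf [mg g2] fg; split => //.
apply: le_integrable g2 => //.
- by apply/measurable_EFinP; exact: measurable_funX.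
- by move=> x _ /=; rewrite lee_fin !normrX lerXn2r ?nnegrE.
Qed.

Lemma L2D f g : L2 f -> L2 g -> L2 (fun x => f x + g x).
Proof.
move=> Lf Lg; split; first exact: (measurable_funD Lf.1 Lg.1).
have -> : (EFin \o (fun x => (f x + g x) ^+ 2)) =
  (fun x => (f x ^+ 2)%:E + ((f x * g x + f x * g x)%:E + (g x ^+ 2)%:E))%E.
  by apply/funext => x /=; rewrite -!EFinD; congr EFin; ring.
apply: integrableD => //; first exact: Lf.2.
apply: integrableD => //; last exact: Lg.2.
rewrite (_ : (fun x => _) = (fun x => (f x * g x)%:E + (f x * g x)%:E)%E)//.
by apply: integrableD => //; exact: L2_mul.
Qed.

Lemma L2Z a f : L2 f -> L2 (fun x => a * f x).
Proof.
move=> [mf f2]; split; first exact: measurable_funM.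
have -> : (EFin \o (fun x => (a * f x) ^+ 2)) =
    (fun x => (a ^+ 2)%:E * (f x ^+ 2)%:E)%E.
  by apply/funext => x /=; rewrite exprMn EFinM.
exact: integrableZl.
Qed.

Lemma L2N f : L2 f -> L2 (fun x => - f x).
Proof.
by move=> Lf; rewrite (_ : (fun x => _) = (fun x => -1 * f x));
  [exact: L2Z|apply/funext => x; rewrite mulN1r].
Qed.

Lemma L2B f g : L2 f -> L2 g -> L2 (fun x => f x - g x).
Proof. by move=> Lf Lg; apply: L2D => //; exact: L2N. Qed.

Lemma L20 : L2 (fun=> 0).
Proof.
split => //; rewrite (_ : EFin \o _ = cst 0%E); first exact: integrable0.
by apply/funext => x /=; rewrite expr0n.
Qed.

Lemma L2_Mbounded f g M : measurable_fun setT f -> (forall x, `|f x| <= M) ->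
  L2 g -> L2 (fun x => f x * g x).
Proof.
move=> mf fM Lg; apply: (L2_le _ (L2Z `|M| Lg)).
  by apply: measurable_funM => //; exact: L2_measurable.
move=> x; rewrite !normrM normr_id ler_wpM2r//.
by rewrite (le_trans (fM x))// ler_norm.
Qed.

Lemma ipC f g : ip f g = ip g f.
Proof. by apply: eq_Rintegral => x _; rewrite mulrC. Qed.

Lemma ipDl f g h : L2 f -> L2 g -> L2 h ->
  ip (fun x => f x + g x) h = ip f h + ip g h.
Proof.
move=> Lf Lg Lh; rewrite /ip -RintegralD//; try exact: L2_mul.
by apply: eq_Rintegral => x _; rewrite mulrDl.
Qed.

Lemma ipZl a f g : L2 f -> L2 g -> ip (fun x => a * f x) g = a * ip f g.
Proof.
move=> Lf Lg; rewrite /ip -RintegralZl//; last exact: L2_mul.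
by apply: eq_Rintegral => x _; rewrite mulrA.
Qed.

Lemma ipNl f g : L2 f -> L2 g -> ip (fun x => - f x) g = - ip f g.
Proof.
move=> Lf Lg; rewrite -mulN1r -ipZl//.
by apply: eq_Rintegral => x _; rewrite mulN1r.
Qed.

Lemma ipBl f g h : L2 f -> L2 g -> L2 h ->
  ip (fun x => f x - g x) h = ip f h - ip g h.
Proof. by move=> Lf Lg Lh; rewrite ipDl ?ipNl//; exact: L2N. Qed.

Lemma ipDr f g h : L2 f -> L2 g -> L2 h ->
  ip f (fun x => g x + h x) = ip f g + ip f h.
Proof. by move=> *; rewrite ipC ipDl// ipC (ipC h). Qed.

Lemma ipZr a f g : L2 f -> L2 g -> ip f (fun x => a * g x) = a * ip f g.
Proof. by move=> *; rewrite ipC ipZl// ipC. Qed.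

Lemma ipBr f g h : L2 f -> L2 g -> L2 h ->
  ip f (fun x => g x - h x) = ip f g - ip f h.
Proof. by move=> *; rewrite ipC ipBl// ipC (ipC h). Qed.

Lemma ip_ge0 f : 0 <= ip f f.
Proof. by apply: Rintegral_ge0 => x _; rewrite -expr2 sqr_ge0. Qed.

Lemma nrm_ge0 f : 0 <= nrm f.
Proof. exact: sqrtr_ge0. Qed.
Hint Resolve nrm_ge0 : core.

Lemma nrm2 f : nrm f ^+ 2 = ip f f.
Proof. by rewrite sqr_sqrtr// ip_ge0. Qed.

Lemma ipxx f : ip f f = \int[mu]_x (f x ^+ 2).
Proof. by apply: eq_Rintegral => x _; rewrite expr2. Qed.

Lemma EFin_nrm2 f : L2 f -> ((nrm f ^+ 2)%:E = \int[mu]_x (f x ^+ 2)%:E)%E.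
Proof.
by move=> [mf f2]; rewrite nrm2 ipxx /Rintegral fineK//; exact: integrable_fin_num.
Qed.

(** The squared norm of [f - a * g] is a nonnegative quadratic in [a]; its value at the minimizer
    [ip f g / ip g g] is the claim. *)
Lemma cauchy_schwarz f g : L2 f -> L2 g -> `|ip f g| <= nrm f * nrm g.
Proof.
move=> Lf Lg.
have disc a : 0 <= ip f f - a *+ 2 * ip f g + a ^+ 2 * ip g g.
  have := ip_ge0 (fun x => f x - a * g x).
  have Lag := L2Z a Lg.
  rewrite ipBl ?ipBr//; last exact: L2B.
  rewrite ipZr// (ipC (fun x => a * g x) f) ipZr// ipZl// ipZr//.
  by congr (_ <= _); ring.
rewrite -ler_sqr ?nnegrE ?mulr_ge0// real_normK ?num_real//.
rewrite exprMn !nrm2.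
have := disc (ip f g / ip g g).
have [g0|g0] := eqVneq (ip g g) 0.
  (* The quadratic is now affine in [a], and at this [a] it would equal [- ip f f - 2] if [ip f g]
     were nonzero. *)
  rewrite g0 mulr0 => _; have := disc ((ip f f + 1) / ip f g).
  have [->|fg0] := eqVneq (ip f g) 0; first by move=> _; rewrite expr0n/= mulr0.
  rewrite g0 mulr0 addr0 mulrnAl divfK//; have := ip_ge0 f; lra.
have g_gt0 : 0 < ip g g by rewrite lt_def g0 ip_ge0.
rewrite -subr_ge0 (_ : ip f f * _ - _ =
  ip g g * (ip f f - (ip f g / ip g g) *+ 2 * ip f g +
    (ip f g / ip g g) ^+ 2 * ip g g)); last by field.
by move=> h; rewrite mulr_ge0// ltW.
Qed.

Lemma nrmD f g : L2 f -> L2 g -> nrm (fun x => f x + g x) <= nrm f + nrm g.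
Proof.
move=> Lf Lg; rewrite -ler_sqr ?nnegrE ?addr_ge0//.
rewrite nrm2 ipDl ?ipDr//; last exact: L2D.
rewrite (ipC g f) sqrrD !nrm2.
by have := cauchy_schwarz Lf Lg; rewrite ler_norml => /andP[_]; lra.
Qed.

Lemma nrmN f : nrm (fun x => - f x) = nrm f.
Proof. by congr Num.sqrt; apply: eq_Rintegral => x _; rewrite mulrNN. Qed.

Lemma nrmZ a f : L2 f -> nrm (fun x => a * f x) = `|a| * nrm f.
Proof.
move=> Lf; rewrite /nrm ipZl// ?ipZr//; last exact: L2Z.
by rewrite mulrA -expr2 sqrtrM ?sqr_ge0// sqrtr_sqr.
Qed.

Lemma nrmB f g : L2 f -> L2 g -> nrm (fun x => f x - g x) <= nrm f + nrm g.
Proof. by move=> Lf Lg; rewrite -(nrmN g); apply: nrmD => //; exact: L2N. Qed.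

Lemma nrmBC f g : nrm (fun x => f x - g x) = nrm (fun x => g x - f x).
Proof. by rewrite -nrmN; congr nrm; apply/funext => x; rewrite opprB. Qed.

Lemma nrm_triangle f g h : L2 f -> L2 g -> L2 h ->
  nrm (fun x => f x - h x) <= nrm (fun x => f x - g x) + nrm (fun x => g x - h x).
Proof.
move=> Lf Lg Lh.
rewrite (_ : (fun x => f x - h x) =
  (fun x => (f x - g x) + (g x - h x))); last by apply/funext => x; ring.
by apply: nrmD; exact: L2B.
Qed.

Lemma nrm_le f g : measurable_fun setT f -> L2 g ->
  (forall x, `|f x| <= `|g x|) -> nrm f <= nrm g.
Proof.
move=> mf Lg fg; rewrite ler_wsqrtr// !ipxx; apply: le_Rintegral => //.
- by have [] := L2_le mf Lg fg.
- by have [] := Lg.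
- by move=> x _; rewrite -(real_normK (num_real (f x)))
    -(real_normK (num_real (g x))) lerXn2r ?nnegrE.
Qed.

Lemma nrm0 : nrm (fun=> 0) = 0.
Proof.
by rewrite /nrm (_ : ip _ _ = 0) ?sqrtr0//; rewrite /ip; under eq_Rintegral do rewrite mulr0;
  rewrite Rintegral_cst// mul0r.
Qed.

Lemma L2_dominated_cvg (F : nat -> R -> R) f g :
  (forall n, measurable_fun setT (F n)) -> measurable_fun setT f -> L2 g ->
  (forall n x, `|F n x - f x| <= `|g x|) ->
  {ae mu, forall x, F ^~ x @ \oo --> f x} ->
  nrm (fun x => F n x - f x) @[n --> \oo] --> 0.
Proof.
move=> mF mf Lg Fg Ff.
rewrite -[X in _ --> X]sqrtr0.
apply: (@continuous_cvg _ _ _ _ _ _ (@Num.sqrt R)).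
  exact: sqrt_continuous.
have mFf n : measurable_fun setT (fun x => F n x - f x) by exact: measurable_funB.
under eq_fun do rewrite ipxx.
have := @Rintegral_dominated_cvg _ _ _ mu setT (fun n x => (F n x - f x) ^+ 2)
  (cst 0) (fun x => g x ^+ 2) measurableT.
rewrite Rintegral_cst// mul0r; apply => //.
- by move=> n; exact: (measurable_funX 2 (mFf n)).
- exact: Lg.2.
- move=> n x _; rewrite normrX -(real_normK (num_real (g x))).
  by rewrite lerXn2r ?nnegrE.
- apply: ae_sub Ff => x Fx _; rewrite -[X in _ --> X](expr0n R 2).
  apply: (@cvg_comp _ _ _ (fun n => F n x - f x) (fun y : R => y ^+ 2) _
    (nbhs (0 : R)) _ _ (@exprn_continuous R 2 0)).
  rewrite -(subrr (f x)).
  by apply: cvgB; [exact: Fx|exact: cvg_cst].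
Qed.

End SquareIntegrable.
#[global] Hint Resolve nrm_ge0 : core.

(** * The heat semigroup *)

Section Translation.
Context {R : realType}.
Local Notation mu := (@lebesgue_measure R).

Lemma lebesgue_measure_shift (a : R) (A : set R) : measurable A ->
  pushforward mu ((fun x => x + a) : _ -> measurableTypeR R) A = mu A.
Proof.
pose phi : measurableTypeR R -> measurableTypeR R := fun x => x + a.
have mphi : measurable_fun setT phi by exact: measurable_funD.
pose Phi : {mfun measurableTypeR R >-> measurableTypeR R} :=
  HB.pack phi (isMeasurableFun.Build _ _ _ _ phi mphi).
move=> mA; apply/esym.
apply: (@lebesgue_measure_unique R (pushforward mu Phi)) => //= _ [[c d]] _ <-.
rewrite /pushforward (_ : _ @^-1` _ = `]c - a, d - a]%classic); last first.
  by apply/seteqP; split => x /=; rewrite !in_itv/= ltrBlDr lerBrDr.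
rewrite !lebesgue_measure_itv/= !lte_fin ltrD2r.
by case: ifP => //; rewrite -!EFinB => _; congr EFin; ring.
Qed.

Lemma ge0_integral_shift (a : R) (f : R -> \bar R) : measurable_fun setT f ->
  (forall x, 0 <= f x)%E -> (\int[mu]_x f (x + a)%R = \int[mu]_x f x)%E.
Proof.
move=> mf f0.
pose phi : measurableTypeR R -> measurableTypeR R := fun x => x + a.
have mphi : measurable_fun setT phi by exact: measurable_funD.
have := @ge0_integral_pushforward _ _ _ _ R phi mphi mu setT f measurableT mf (fun x _ => f0 x).
rewrite preimage_setT /= => <-.
by apply: eq_measure_integral => //= A mA _; exact: lebesgue_measure_shift.
Qed.

Lemma ge0_integral_opp (f : R -> \bar R) : measurable_fun setT f ->
  (forall x, 0 <= f x)%E -> (\int[mu]_x f (- x)%R = \int[mu]_x f x)%E.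
Proof.
move=> mf f0.
pose phi : measurableTypeR R -> measurableTypeR R := -%R.
have mphi : measurable_fun setT phi by exact: oppr_measurable.
have := @ge0_integral_pushforward _ _ _ _ R phi mphi mu setT f measurableT mf (fun x _ => f0 x).
rewrite preimage_setT /= => <-.
by apply: eq_measure_integral => //= A mA _; exact: lebesgue_measureN.
Qed.

Lemma ge0_integral_sub (a : R) (f : R -> \bar R) : measurable_fun setT f ->
  (forall x, 0 <= f x)%E -> (\int[mu]_x f (a - x)%R = \int[mu]_x f x)%E.
Proof.
move=> mf f0; rewrite -[RHS](ge0_integral_shift a)//.
rewrite -[RHS]ge0_integral_opp//.
- by apply: eq_integral => x _; rewrite addrC.
- by apply: measurableT_comp => //; exact: measurable_funD.
Qed.

(** Positive and negative parts are shifted separately, so the two sides agree even when they take a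
    default value. *)
Lemma Rintegral_shift (a : R) (f : R -> R) : measurable_fun setT f ->
  \int[mu]_x f (x + a) = \int[mu]_x f x.
Proof.
move=> mf; have mfE : measurable_fun [set: measurableTypeR R] (EFin \o f) by exact/measurable_EFinP.
rewrite /Rintegral integralE [in RHS]integralE; congr (fine (_ - _)).
  rewrite -[RHS](ge0_integral_shift a)//.
    by apply: eq_integral => x _; rewrite !funeposE.
  exact: (measurable_funepos mfE).
rewrite -[RHS](ge0_integral_shift a)//.
  by apply: eq_integral => x _; rewrite !funenegE.
exact: (measurable_funeneg mfE).
Qed.

Lemma Rintegral_sub (a : R) (f : R -> R) : measurable_fun setT f ->
  \int[mu]_x f (a - x) = \int[mu]_x f x.
Proof.
move=> mf; have mfE : measurable_fun [set: measurableTypeR R] (EFin \o f) by exact/measurable_EFinP.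
rewrite /Rintegral integralE [in RHS]integralE; congr (fine (_ - _)).
  rewrite -[RHS](ge0_integral_sub a)//.
    by apply: eq_integral => x _; rewrite !funeposE.
  exact: (measurable_funepos mfE).
rewrite -[RHS](ge0_integral_sub a)//.
  by apply: eq_integral => x _; rewrite !funenegE.
exact: (measurable_funeneg mfE).
Qed.

Lemma L2_shift (a : R) (f : R -> R) : L2 f -> L2 (fun x => f (x + a)).
Proof.
move=> [mf f2]; split.
  by apply: measurableT_comp => //; exact: measurable_funD.
apply/integrableP; split.
  apply/measurable_EFinP; apply: measurable_funX.
  by apply: measurableT_comp => //; exact: measurable_funD.
have /integrableP[m2] := f2.
rewrite -(ge0_integral_shift a)//.
by apply: measurableT_comp.
Qed.

Lemma L2_sub (a : R) (f : R -> R) : L2 f -> L2 (fun x => f (a - x)).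
Proof.
move=> [mf f2]; split.
  by apply: measurableT_comp => //; exact: measurable_funB.
apply/integrableP; split.
  apply/measurable_EFinP; apply: measurable_funX.
  by apply: measurableT_comp => //; exact: measurable_funB.
have /integrableP[m2] := f2.
rewrite -(ge0_integral_sub a)//.
by apply: measurableT_comp.
Qed.

Lemma nrm_shift (a : R) (f : R -> R) : L2 f -> nrm (fun x => f (x + a)) = nrm f.
Proof.
move=> [mf f2]; rewrite /nrm !ipxx (Rintegral_shift a (f := fun x => f x ^+ 2))//.
exact: measurable_funX.
Qed.

Lemma nrm_sub (a : R) (f : R -> R) : L2 f -> nrm (fun x => f (a - x)) = nrm f.
Proof.
move=> [mf f2]; rewrite /nrm !ipxx (Rintegral_sub a (f := fun x => f x ^+ 2))//.
exact: measurable_funX.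
Qed.

End Translation.

(** Where a section is not integrable the default value appears, yet measurability survives: the
    function is [fine] of a difference of two Tonelli integrals. *)
Lemma measurable_Rintegral_param d1 d2 (T1 : measurableType d1)
    (T2 : measurableType d2) (R : realType)
    (m : {sigma_finite_measure set T2 -> \bar R}) (k : T1 * T2 -> R) :
  measurable_fun setT k -> measurable_fun setT (fun x => \int[m]_y k (x, y)).
Proof.
move=> mk; have mkE : measurable_fun setT (EFin \o k) by exact/measurable_EFinP.
rewrite /Rintegral.
apply: (measurableT_comp (@fine_measurable R setT measurableT)).
under eq_fun do rewrite integralE.
apply: emeasurable_funB.
  rewrite (_ : (fun x => _) = fubini_F m ((EFin \o k)^\+)%E); last first.
    by apply/funext => x; apply: eq_integral => y _; rewrite !funeposE.
  by apply: measurable_fun_fubini_tonelli_F; [exact: measurable_funepos|].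
rewrite (_ : (fun x => _) = fubini_F m ((EFin \o k)^\-)%E); last first.
  by apply/funext => x; apply: eq_integral => y _; rewrite !funenegE.
by apply: measurable_fun_fubini_tonelli_F; [exact: measurable_funeneg|].
Qed.

(** * The Gaussian kernel and Jensen's inequality *)

Section HeatKernel.
Context {R : realType}.
Local Notation mu := (@lebesgue_measure R).
Implicit Types t x y z : R.

(** The density of the centred normal law of variance [t]. For [t <= 0] the square root is 0, and so
    are its inverse and the kernel. *)
Definition hk t z : R := (Num.sqrt (t * pi *+ 2))^-1 * expR (- z ^+ 2 / (t *+ 2)).

Lemma hk_pdf t : 0 < t -> hk t = normal_pdf 0 (Num.sqrt t).
Proof.
move=> t0; apply/funext => z; rewrite normal_pdfE ?gt_eqF ?sqrtr_gt0//.
by rewrite /normal_peak /normal_fun sqr_sqrtr ?ltW// subr0.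
Qed.

Lemma hk_ge0 t z : 0 <= hk t z.
Proof. by rewrite mulr_ge0 ?invr_ge0 ?sqrtr_ge0 ?expR_ge0. Qed.

Lemma hkN t z : hk t (- z) = hk t z.
Proof. by rewrite /hk sqrrN. Qed.

Lemma hk_subC t x y : hk t (x - y) = hk t (y - x).
Proof. by rewrite -hkN opprB. Qed.

Lemma continuous_hk t : continuous (hk t).
Proof.
move=> z; apply: cvgM; first exact: cvg_cst.
apply: (cvg_comp _ expR); last exact: continuous_expR.
apply: cvgM; last exact: cvg_cst.
by apply: (@cvgN _ R^o); exact: exprn_continuous.
Qed.

Lemma measurable_hk t : measurable_fun setT (hk t).
Proof. by apply: continuous_measurable_fun; exact: continuous_hk. Qed.

Lemma hk_le t z : 0 < t -> hk t z <= (Num.sqrt (t * pi *+ 2))^-1.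
Proof.
move=> t0; rewrite /hk ler_piMr ?invr_ge0 ?sqrtr_ge0//.
rewrite -[leRHS]expR0 ler_expR mulNr oppr_le0 mulr_ge0 ?sqr_ge0//.
by rewrite invr_ge0 mulrn_wge0// ltW.
Qed.

Lemma integral_hk t : 0 < t -> (\int[mu]_z (hk t z)%:E = 1)%E.
Proof. by move=> t0; rewrite hk_pdf// integral_normal_pdf. Qed.

Lemma integrable_hk t : 0 < t -> mu.-integrable setT (EFin \o hk t).
Proof. by move=> t0; rewrite hk_pdf//; exact: integrable_normal_pdf. Qed.

Lemma L2_hk t : 0 < t -> L2 (hk t).
Proof.
move=> t0; split; first exact: measurable_hk.
apply: (@le_integrable _ _ _ mu setT measurableT _
  (fun z => ((Num.sqrt (t * pi *+ 2))^-1)%:E * (hk t z)%:E)%E).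
- by apply/measurable_EFinP; apply: measurable_funX; exact: measurable_hk.
- move=> z _ /=; rewrite lee_fin ger0_norm ?sqr_ge0// ger0_norm ?mulr_ge0 ?hk_ge0 ?invr_ge0 ?sqrtr_ge0//.
  by rewrite expr2 ler_wpM2r ?hk_ge0// hk_le.
- by apply: integrableZl => //; exact: integrable_hk.
Qed.

Lemma L2_hk_sub t x : 0 < t -> L2 (fun y => hk t (x - y)).
Proof. by move=> t0; apply: L2_sub; exact: L2_hk. Qed.

Lemma integral_hk_sub t x : 0 < t -> (\int[mu]_y (hk t (x - y))%:E = 1)%E.
Proof.
move=> t0; rewrite (ge0_integral_sub x (f := EFin \o hk t)) ?integral_hk//.
  by apply/measurable_EFinP; exact: measurable_hk.
by move=> y; rewrite lee_fin hk_ge0.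
Qed.

Lemma integrable_hk_sub t x : 0 < t ->
  mu.-integrable setT (EFin \o (fun y => hk t (x - y))).
Proof.
move=> t0; apply/integrableP; split.
  by apply/measurable_EFinP; exact: (L2_hk_sub x t0).1.
under eq_integral do rewrite /= ger0_norm ?hk_ge0//.
by rewrite integral_hk_sub// ltry.
Qed.

Lemma measurable_hk_diff t : measurable_fun setT (fun p : R * R => hk t (p.1 - p.2)).
Proof.
apply: (measurableT_comp (@measurable_hk t)).
by apply: measurable_funB; [exact: measurable_fst|exact: measurable_snd].
Qed.

Definition heat t (g : R -> R) x : R := ip (fun y => hk t (x - y)) g.

Lemma measurable_heat t g : measurable_fun setT g -> measurable_fun setT (heat t g).
Proof.
move=> mg.
apply: (@measurable_Rintegral_param _ _ (measurableTypeR R) (measurableTypeR R) R mu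
  (fun p => hk t (p.1 - p.2) * g p.2)).
apply: measurable_funM; first exact: measurable_hk_diff.
by apply: measurableT_comp => //; exact: measurable_snd.
Qed.

(** Jensen's inequality for the probability density [hk t (x - y)]: the two sides differ by the
    variance of [g]. Taking [c = 0] gives the contraction property, [c = g x] the convergence as [t]
    tends to 0. *)
Lemma jensen_hk t x (g : R -> R) c : 0 < t -> L2 g ->
  (((heat t g x - c) ^+ 2)%:E <=
   \int[mu]_y (hk t (x - y) * (g y - c) ^+ 2)%:E)%E.
Proof.
move=> t0 Lg; set p := fun y => hk t (x - y).
have p1 : \int[mu]_y p y = 1 by rewrite /Rintegral integral_hk_sub.
have ip1 : mu.-integrable setT (EFin \o p) by exact: integrable_hk_sub.
have Lp : L2 p by exact: L2_hk_sub.
have ipg : mu.-integrable setT (EFin \o (fun y => p y * g y)) by exact: L2_mul.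
have ipg2 : mu.-integrable setT (EFin \o (fun y => p y * g y ^+ 2)).
  apply: (@le_integrable _ _ _ mu setT measurableT _
    (fun z => ((Num.sqrt (t * pi *+ 2))^-1)%:E * (g z ^+ 2)%:E)%E).
  - apply/measurable_EFinP; apply: measurable_funM; first exact: Lp.1.
    by apply: measurable_funX; exact: Lg.1.
  - move=> y _ /=; rewrite lee_fin ger0_norm; last first.
      by apply: mulr_ge0; [exact: hk_ge0|exact: sqr_ge0].
    rewrite ger0_norm; last first.
      by apply: mulr_ge0; [rewrite invr_ge0 sqrtr_ge0|exact: sqr_ge0].
    by rewrite ler_wpM2r ?sqr_ge0// hk_le.
  - by apply: integrableZl => //; exact: Lg.2.
have quad a : mu.-integrable setT (EFin \o (fun y => p y * (g y - a) ^+ 2)) /\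
    \int[mu]_y (p y * (g y - a) ^+ 2) =
    \int[mu]_y (p y * g y ^+ 2) - a *+ 2 * heat t g x + a ^+ 2.
  have -> : (fun y => p y * (g y - a) ^+ 2) = (fun y => p y * g y ^+ 2 +
     ((- (a *+ 2)) * (p y * g y) + a ^+ 2 * p y)).
    by apply/funext => y; ring.
  have i1 : mu.-integrable setT (EFin \o (fun y => - (a *+ 2) * (p y * g y))).
    by rewrite (_ : _ \o _ = (fun y => (- (a *+ 2))%:E * (p y * g y)%:E)%E)//;
      exact: integrableZl.
  have i2 : mu.-integrable setT (EFin \o (fun y => a ^+ 2 * p y)).
    by rewrite (_ : _ \o _ = (fun y => (a ^+ 2)%:E * (p y)%:E)%E)//;
      exact: integrableZl.
  have i3 : mu.-integrable setT (EFin \o (fun y => - (a *+ 2) * (p y * g y) + a ^+ 2 * p y)).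
    by rewrite (_ : _ \o _ = (fun y => (- (a *+ 2) * (p y * g y))%:E + (a ^+ 2 * p y)%:E)%E)//;
      exact: integrableD.
  split.
    by rewrite (_ : _ \o _ = (fun y => (p y * g y ^+ 2)%:E +
       (- (a *+ 2) * (p y * g y) + a ^+ 2 * p y)%:E)%E)//; exact: integrableD.
  by rewrite RintegralD// RintegralD// RintegralZl// RintegralZl// p1 /heat /ip; ring.
have [_ Em] := quad (heat t g x).
have [ic Ec] := quad c.
have ge0 : 0 <= \int[mu]_y (p y * (g y - heat t g x) ^+ 2).
  by apply: Rintegral_ge0 => y _; rewrite mulr_ge0 ?hk_ge0 ?sqr_ge0.
rewrite -[leRHS]fineK; last exact: integrable_fin_num.
rewrite lee_fin -/(Rintegral _ _ _) Ec; rewrite Em in ge0.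
by rewrite -subr_ge0; apply: le_trans ge0 _; rewrite le_eqVlt; apply/orP; left;
  apply/eqP; ring.
Qed.

End HeatKernel.

(** * Contraction and strong continuity of the heat semigroup *)

Section HeatSemigroup.
Context {R : realType}.
Local Notation mu := (@lebesgue_measure R).
Implicit Types t x y z c e M : R.

Lemma L2_of_lty (f : R -> R) : measurable_fun setT f ->
  (\int[mu]_x (f x ^+ 2)%:E < +oo)%E -> L2 f.
Proof.
move=> mf f2; split => //; apply/integrableP; split.
  by apply/measurable_EFinP; exact: measurable_funX.
by under eq_integral do rewrite /= ger0_norm ?sqr_ge0//.
Qed.

Lemma lebesgue_tonelli (k : R * R -> \bar R) :
  measurable_fun [set: measurableTypeR R * measurableTypeR R] k ->
  (forall p, 0 <= k p)%E ->
  (\int[mu]_x \int[mu]_y k (x, y) = \int[mu]_y \int[mu]_x k (x, y))%E.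
Proof.
exact: (@fubini_tonelli _ _ (measurableTypeR R) (measurableTypeR R) R mu mu k).
Qed.

Lemma nrm_le_EFin (f : R -> R) c : 0 <= c -> L2 f ->
  (\int[mu]_x (f x ^+ 2)%:E <= (c ^+ 2)%:E)%E -> nrm f <= c.
Proof.
by move=> c0 Lf; rewrite -EFin_nrm2// lee_fin ler_sqr ?nnegrE ?nrm_ge0.
Qed.

Lemma heat_sqr_le t (g : R -> R) : 0 < t -> L2 g ->
  (\int[mu]_x (heat t g x ^+ 2)%:E <= (nrm g ^+ 2)%:E)%E.
Proof.
move=> t0 Lg; pose k (p : R * R) := (hk t (p.1 - p.2) * g p.2 ^+ 2)%:E.
have mk : measurable_fun [set: measurableTypeR R * measurableTypeR R] k.
  apply/measurable_EFinP; apply: measurable_funM; first exact: measurable_hk_diff.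
  apply: measurable_funX; apply: measurableT_comp; first exact: Lg.1.
  exact: measurable_snd.
have k0 p : (0 <= k p)%E by rewrite lee_fin mulr_ge0 ?hk_ge0 ?sqr_ge0.
apply: (@le_trans _ _ (\int[mu]_x \int[mu]_y k (x, y))%E).
  apply: ge0_le_integral => //.
  - by move=> x _; rewrite lee_fin sqr_ge0.
  - apply/measurable_EFinP; apply: measurable_funX.
    by apply: measurable_heat; exact: Lg.1.
  - exact: (@measurable_fun_fubini_tonelli_F _ _ (measurableTypeR R) (measurableTypeR R) R mu k mk k0).
  - move=> x _; have := jensen_hk x 0 t0 Lg; rewrite subr0.
    by under eq_integral do rewrite subr0.
rewrite (lebesgue_tonelli (k := k))// EFin_nrm2//.
rewrite le_eqVlt; apply/orP; left; apply/eqP; apply: eq_integral => y _.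
rewrite /k /=; under eq_integral do rewrite EFinM muleC hk_subC.
rewrite ge0_integralZl//.
- by rewrite integral_hk_sub// mule1.
- by apply/measurable_EFinP; exact: (L2_hk_sub y t0).1.
- by move=> x _; rewrite lee_fin hk_ge0.
- by rewrite lee_fin sqr_ge0.
Qed.

Lemma L2_heat t (g : R -> R) : 0 < t -> L2 g -> L2 (heat t g).
Proof.
move=> t0 Lg; apply: L2_of_lty; first by apply: measurable_heat; exact: Lg.1.
by rewrite (le_lt_trans (heat_sqr_le t0 Lg))// ltry.
Qed.

Lemma nrm_heat t (g : R -> R) : 0 < t -> L2 g -> nrm (heat t g) <= nrm g.
Proof. by move=> t0 Lg; apply: nrm_le_EFin; [exact: nrm_ge0|exact: L2_heat|exact: heat_sqr_le]. Qed.

Lemma heatB t (f g : R -> R) : 0 < t -> L2 f -> L2 g ->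
  heat t (fun x => f x - g x) = (fun x => heat t f x - heat t g x).
Proof.
by move=> t0 Lf Lg; apply/funext => x; rewrite /heat ipBr//; exact: L2_hk_sub.
Qed.

Lemma approximation_L1_continuous (g : R -> R) M e : 0 < e ->
  mu.-integrable `[- M, M] (EFin \o g) ->
  exists k : R -> R, continuous k /\
   (\int[mu]_(x in `[(- M)%R, M]) `|(g x - k x)%R|%:E < e%:E)%E.
Proof.
move=> e0 ig.
have Mfin : (mu `[(- M)%R, M] < +oo)%E.
  by rewrite lebesgue_measure_itv/=; case: ifP; rewrite ?ltry// -EFinB ltry.
have [k [ck _]] := approximation_continuous_integrable (measurable_itv _) Mfin ig.
move/fine_cvgP => [finN] /cvgrPdist_lt /(_ _ e0) kg.
have [N [/= fN dN]] := filter_ex (filterI finN kg).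
exists (k N); split => //; move: dN; rewrite /= sub0r normrN.
by rewrite ger0_norm ?fine_ge0 ?integral_ge0// -lte_fin fineK.
Qed.

Lemma near_compact_unif (k : R -> R) M e : continuous k -> 0 < e ->
  \forall z \near (0 : R), forall x, x \in `[- M, M] -> `|k (x + z) - k x| < e.
Proof.
move=> ck e0.
have /compact_near_coveringP := @segment_compact R (- M) M.
move=> /(_ R (nbhs (0:R)) (fun z x => `|k (x + z) - k x| < e)).
apply => x _.
have e20 : 0 < e / 2 by rewrite divr_gt0.
have c1 : \forall p \near ((x, 0) : R * R), `|k (p.1 + p.2) - k x| < e / 2.
  have : k (p.1 + p.2) @[p --> ((x, 0) : R * R)] --> k (x + 0).
    apply: (@cvg_comp _ _ _ (fun p : R * R => p.1 + p.2) k _ (nbhs (x + 0))).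
      exact: cvgD cvg_fst cvg_snd.
    exact: ck.
  by rewrite addr0 => /cvgrPdist_lt /(_ _ e20); apply: filterS => p; rewrite distrC.
have c2 : \forall p \near ((x, 0) : R * R), `|k p.1 - k x| < e / 2.
  have : k p.1 @[p --> ((x, 0) : R * R)] --> k x.
    apply: (@cvg_comp _ _ _ (fun p : R * R => p.1) k _ (nbhs x)); first exact: cvg_fst.
    exact: ck.
  by move=> /cvgrPdist_lt /(_ _ e20); apply: filterS => p; rewrite distrC.
near=> p; rewrite (_ : _ - _ = (k (p.1 + p.2) - k x) - (k p.1 - k x)); last by ring.
rewrite (le_lt_trans (ler_normB _ _))// [ltRHS]splitr ltrD//.
  by near: p; exact: c1.
by near: p; exact: c2.
Unshelve. all: by end_near. Qed.

(** Density of continuous functions is used in L^1 only: the difference is bounded by [2 M], so its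
    square is at most [2 M] times its absolute value. The latter is split into [g - k] at [x + z],
    the modulus of continuity of [k], and [g - k] at [x]. *)
Lemma bounded_support_shift (g : R -> R) M : measurable_fun setT g -> 0 < M ->
  (forall x, `|g x| <= M) -> (forall x, M < `|x| -> g x = 0) ->
  forall e, 0 < e -> \forall z \near (0 : R), nrm (fun x => g (x + z) - g x) <= e.
Proof.
move=> mg M0 gM g0 e e0.
(* For [|z| < 1], both [g x] and [g (x + z)] vanish when [x] is off [[-(M + 1), M + 1]]; otherwise
   [x] and [x + z] both lie in [E], where [k] approximates [g]. *)
pose E := `[- (M + 2), M + 2]%classic : set R.
have mE : measurable E by exact: measurable_itv.
have mu_itv (a : R) : 0 < a -> mu `[- a, a]%classic = (a *+ 2)%:E.
  move=> a0; rewrite lebesgue_measure_itv/= lte_fin gt0_cp// opprK -EFinD.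
  by rewrite mulr2n.
have int_itv (a : R) : 0 < a ->
    (\int[mu]_x (\1_(`[(- a)%R, a]%classic : set R) x)%:E = (a *+ 2)%:E)%E.
  move=> a0; rewrite (integral_indic mu measurableT (measurable_itv `[- a, a])) setIT.
  exact: mu_itv.
have igE : mu.-integrable E (EFin \o g).
  apply: measurable_bounded_integrable => //.
  - rewrite [X in (X < _)%E](_ : _ = ((M + 2) *+ 2)%:E) ?ltry//.
    by apply: mu_itv; rewrite addr_gt0.
  - exact: measurable_funTS.
  - by exists M; split; [exact: num_real|move=> a Ma x _; exact: le_trans (gM x) (ltW Ma)].
(* Three terms of integral [e1], multiplied by [M *+ 2], add up to [e ^+ 2]. *)
pose e1 := e ^+ 2 / (M *+ 2) / 3.
have e10 : 0 < e1 by rewrite !divr_gt0 ?exprn_gt0// mulrn_wgt0.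
have [k [ck ke]] := approximation_L1_continuous e10 igE.
pose e2 := e1 / ((M + 1) *+ 2).
have e20 : 0 < e2 by rewrite divr_gt0// mulrn_wgt0// addr_gt0.
have unif := near_compact_unif (M + 1) ck e20.
have mk : measurable_fun setT k by exact: continuous_measurable_fun.
near=> z.
have z1 : `|z| < 1.
  by near: z; apply/nbhs_ballP; exists 1 => //= z; rewrite /ball/= sub0r normrN.
have kz : forall x, x \in `[- (M + 1), M + 1] -> `|k (x + z) - k x| < e2.
  by near: z.
have mgz : measurable_fun setT (fun x => g (x + z)).
  by apply: measurableT_comp => //; exact: measurable_funD.
have mkz : measurable_fun setT (fun x => k (x + z)).
  by apply: measurableT_comp => //; exact: measurable_funD.
have Lg : L2 g.
  apply: L2_of_lty => //.
  apply: (@le_lt_trans _ _ (\int[mu]_x ((M ^+ 2) * \1_E x)%:E)%E).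
    apply: ge0_le_integral => //.
    - by move=> x _; rewrite lee_fin sqr_ge0.
    - by apply/measurable_EFinP; exact: measurable_funX.
    - by apply/measurable_EFinP; apply: measurable_funM => //; exact: measurable_indic.
    - move=> x _; rewrite lee_fin indicE; have [xE|xE] := boolP (x \in E).
        by rewrite mulr1 -(real_normK (num_real (g x))) lerXn2r ?nnegrE// ltW.
      rewrite g0 ?expr0n ?mulr0//; move: xE; apply: contraR.
      rewrite -leNgt ler_norml => /andP[h1 h2]; rewrite inE /E/= in_itv/=.
      by apply/andP; split; lra.
  under eq_integral do rewrite EFinM.
  rewrite ge0_integralZl//; last 2 first.
    by apply/measurable_EFinP; exact: measurable_indic.
    by rewrite lee_fin sqr_ge0.
  by rewrite /E int_itv ?addr_gt0// -EFinM ltry.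
apply: nrm_le_EFin; first exact: ltW.
  by apply: L2B => //; exact: L2_shift.
pose h1 x := `|g (x + z) - k (x + z)| * \1_E (x + z).
pose h2 x := e2 * \1_(`[- (M + 1), M + 1]) x.
pose h3 x := `|g x - k x| * \1_E x.
have mh3 : measurable_fun setT h3.
  apply: measurable_funM; last exact: measurable_indic.
  by apply: measurableT_comp => //; exact: measurable_funB.
have mh1 : measurable_fun setT h1.
  by apply: (measurableT_comp mh3); exact: measurable_funD.
have mh2 : measurable_fun setT h2.
  by apply: measurable_funM => //; exact: measurable_indic.
have h10 x : 0 <= h1 x by rewrite mulr_ge0.
have h20 x : 0 <= h2 x by rewrite mulr_ge0// ltW.
have h30 x : 0 <= h3 x by rewrite mulr_ge0.
have ih3 : (\int[mu]_x (h3 x)%:E <= e1%:E)%E.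
  rewrite (le_trans _ (ltW ke))// [leRHS]integral_mkcond.
  rewrite le_eqVlt; apply/orP; left; apply/eqP; apply: eq_integral => x _.
  by rewrite /h3 patchE indicE; case: ifP => _; rewrite ?mulr1 ?mulr0.
have ih1 : (\int[mu]_x (h1 x)%:E <= e1%:E)%E.
  by rewrite (ge0_integral_shift z (f := EFin \o h3))//; exact/measurable_EFinP.
have ih2 : (\int[mu]_x (h2 x)%:E <= e1%:E)%E.
  rewrite /h2; under eq_integral do rewrite EFinM.
  rewrite ge0_integralZl//; last 2 first.
    by apply/measurable_EFinP; exact: measurable_indic.
    by rewrite lee_fin ltW.
  rewrite int_itv ?addr_gt0// -EFinM lee_fin /e2.
  by rewrite divfK// gt_eqF// mulrn_wgt0// addr_gt0.
have pw x : (g (x + z) - g x) ^+ 2 <= M *+ 2 * (h1 x + (h2 x + h3 x)).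
  have b1 : `|g (x + z) - g x| <= M *+ 2.
    by rewrite (le_trans (ler_normB _ _))// mulr2n lerD.
  have [xF|xF] := boolP (x \in `[- (M + 1), M + 1]); last first.
    have gx0 : g x = 0.
      apply: g0; move: xF; apply: contraR; rewrite -leNgt ler_norml in_itv/= => /andP[u1 u2].
      by apply/andP; split; move: u1 u2; clear; lra.
    have gz0 : g (x + z) = 0.
      apply: g0; move: xF; apply: contraR; rewrite -leNgt ler_norml => /andP[u1 u2].
      move: z1; rewrite ltr_norml in_itv/= => /andP[u3 u4].
      by apply/andP; split; move: u1 u2 u3 u4; clear; lra.
    rewrite gx0 gz0 subrr expr0n/=.
    by apply: mulr_ge0; [rewrite mulrn_wge0// ltW|rewrite !addr_ge0].
  rewrite -(real_normK (num_real (_ - _))) expr2 ler_pM//.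
  have xE : \1_E x = 1 :> R.
    rewrite indicE mem_set//; move: xF; rewrite /E/= !in_itv/= => /andP[u1 u2].
    by apply/andP; split; move: u1 u2; clear; lra.
  have xzE : \1_E (x + z) = 1 :> R.
    rewrite indicE mem_set//; move: xF; rewrite /E/= !in_itv/= => /andP[u1 u2].
    move: z1; rewrite ltr_norml => /andP[u3 u4].
    by apply/andP; split; move: u1 u2 u3 u4; clear; lra.
  have xF1 : \1_(`[- (M + 1), M + 1]) x = 1 :> R by rewrite indicE mem_set.
  rewrite /h1 /h2 /h3 xE xzE xF1 !mulr1.
  have := kz _ xF.
  have := ler_normD (g (x + z) - k (x + z)) ((k (x + z) - k x) - (g x - k x)).
  have := ler_normB (k (x + z) - k x) (g x - k x).
  have -> : g (x + z) - k (x + z) + (k (x + z) - k x - (g x - k x)) = g (x + z) - g x.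
    by ring.
  by lra.
apply: (@le_trans _ _ (\int[mu]_x ((M *+ 2)%:E * ((h1 x)%:E + ((h2 x)%:E + (h3 x)%:E))))%E).
  apply: ge0_le_integral => //.
  - by move=> x _; rewrite lee_fin sqr_ge0.
  - by apply/measurable_EFinP; apply: measurable_funX; exact: measurable_funB.
  - apply: measurable_funeM; apply: emeasurable_funD; first exact/measurable_EFinP.
    by apply: emeasurable_funD; exact/measurable_EFinP.
  - by move=> x _; rewrite -!EFinD -EFinM lee_fin.
have M20 : 0 < M *+ 2 by rewrite mulrn_wgt0.
rewrite ge0_integralZl//; last 3 first.
- apply: emeasurable_funD; first exact/measurable_EFinP.
  by apply: emeasurable_funD; exact/measurable_EFinP.
- by move=> x _; rewrite !adde_ge0 ?lee_fin.
- by rewrite lee_fin ltW.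
rewrite ge0_integralD//; last 4 first.
- by move=> x _; rewrite lee_fin.
- exact/measurable_EFinP.
- by move=> x _; rewrite adde_ge0 ?lee_fin.
- by apply: emeasurable_funD; exact/measurable_EFinP.
rewrite ge0_integralD//; last 4 first.
- by move=> x _; rewrite lee_fin.
- exact/measurable_EFinP.
- by move=> x _; rewrite lee_fin.
- exact/measurable_EFinP.
apply: (@le_trans _ _ ((M *+ 2)%:E * (e1%:E + (e1%:E + e1%:E)))%E).
  by rewrite lee_pmul2l// ?lte_fin// leeD// leeD.
rewrite -!EFinD -EFinM lee_fin le_eqVlt; apply/orP; left; apply/eqP.
by rewrite /e1; field; rewrite gt_eqF.
Unshelve. all: by end_near. Qed.

(** Truncating [g] both in value and in argument reduces to the bounded case. The truncation error
    is the same before and after translation, so three terms [e / 4] are enough. *)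
Lemma translation_cvg (g : R -> R) e : L2 g -> 0 < e ->
  \forall z \near (0 : R), nrm (fun x => g (x + z) - g x) <= e.
Proof.
move=> Lg e0; have mg := Lg.1.
pose A n : set R := [set x | `|x| <= n.+1%:R] `&` [set x | `|g x| <= n.+1%:R].
have mA n : measurable (A n).
  apply: measurableI.
    have := @measurable_fun_le _ (measurableTypeR R) _ setT (fun x => `|x|) (cst n.+1%:R)
      measurableT (@normr_measurable R setT) (measurable_cst _).
    by rewrite setTI.
  have := @measurable_fun_le _ (measurableTypeR R) _ setT (fun x => `|g x|) (cst n.+1%:R)
    measurableT (measurableT_comp (@normr_measurable R setT) mg) (measurable_cst _).
  by rewrite setTI.
pose G n x := g x * \1_(A n) x.
have mG n : measurable_fun setT (G n).
  by apply: measurable_funM => //; exact: measurable_indic.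
have GM n x : `|G n x| <= n.+1%:R.
  rewrite /G indicE; have [/set_mem[_ /= ?]|_] := boolP (x \in A n).
    by rewrite mulr1.
  by rewrite mulr0 normr0.
have G0 n x : n.+1%:R < `|x| -> G n x = 0.
  move=> nx; rewrite /G indicE memNset ?mulr0// => -[/= + _].
  by rewrite leNgt nx.
have Gg x : G ^~ x @ \oo --> g x.
  apply: cvg_near_cst; near=> n.
  have n1 a : a <= n%:R -> a <= n.+1%:R :> R.
    by move=> an; rewrite (le_trans an)// ler_nat.
  rewrite /G indicE mem_set ?mulr1//; split; apply: n1 => /=.
    by near: n; exact: nbhs_infty_ger.
  by near: n; exact: nbhs_infty_ger.
have LG n : L2 (G n).
  apply: (L2_le (mG n) Lg) => x; rewrite /G normrM ler_piMr//.
  by rewrite indicE; case: (_ \in _); rewrite ?normr1 ?normr0.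
have H : nrm (fun x => G n x - g x) @[n --> \oo] --> 0.
  apply: (L2_dominated_cvg mG mg (g := g)) => //; last exact: (aeW mu).
  move=> n x.
  rewrite /G indicE; case: (_ \in _); rewrite ?mulr1 ?mulr0 ?subrr ?normr0//.
  by rewrite sub0r normrN.
have e40 : 0 < e / 4 by rewrite divr_gt0.
move/cvgrPdist_lt : H => /(_ _ e40)[N _ /(_ N (leqnn N))]/=.
rewrite sub0r normrN ger0_norm ?nrm_ge0// => HN.
have M0 : 0 < N.+1%:R :> R by [].
apply: filterS (bounded_support_shift (mG N) M0 (GM N) (G0 N) e40) => z hz.
have LGz := L2_shift z (LG N); have Lgz := L2_shift z Lg.
have := nrm_triangle Lgz LGz Lg.
have := nrm_triangle LGz (LG N) Lg.
have -> : nrm (fun x => g (x + z) - G N (x + z)) = nrm (fun x => G N x - g x).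
  by rewrite nrmBC (nrm_shift z (f := fun x => G N x - g x))//; exact: L2B.
lra.
Unshelve. all: by end_near. Qed.

(** Half of the Gaussian exponent is spent in [exp (-a) <= 1 / a] with [a = z^2 / (4 t)]; the other
    half is the exponent at time [2 t]. The normalizing constants differ by the square root of 2,
    bounded by 2, whence 8 = 2 * 4. *)
Lemma hk_tail t z (d : R) : 0 < t -> 0 < d -> d <= `|z| ->
  hk t z <= 8 * t / d ^+ 2 * hk (t *+ 2) z.
Proof.
move=> t0 d0 dz.
have exp_le (a : R) : 0 < a -> expR (- a) <= a^-1.
  move=> a0; rewrite expRN lef_pV2 ?posrE ?expR_gt0//.
  by rewrite (le_trans _ (expR_ge1Dx a))// lerDr.
have dz2 : d ^+ 2 <= z ^+ 2.
  by rewrite -(real_normK (num_real z)) lerXn2r ?nnegrE// ltW.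
have d20 : 0 < d ^+ 2 by rewrite exprn_gt0.
have t1 : t != 0 by rewrite gt_eqF.
have e1 : expR (- z ^+ 2 / (t *+ 2)) <= 4 * t / d ^+ 2 * expR (- z ^+ 2 / (t *+ 2 *+ 2)).
  rewrite (_ : - z ^+ 2 / (t *+ 2) = - (z ^+ 2 / (4 * t)) + - z ^+ 2 / (t *+ 2 *+ 2)); last first.
    by field.
  rewrite expRD ler_wpM2r ?expR_ge0//.
  rewrite (le_trans (exp_le _ _))//.
    by apply: divr_gt0; [exact: lt_le_trans dz2|rewrite mulr_gt0].
  rewrite invf_div ler_wpM2l//; first by rewrite mulr_ge0// ltW.
  by rewrite lef_pV2 ?posrE//; exact: lt_le_trans dz2.
have tp : 0 < t * pi *+ 2 by rewrite mulrn_wgt0// mulr_gt0// pi_gt0.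
have p1 : (Num.sqrt (t * pi *+ 2))^-1 <= 2 * (Num.sqrt (t *+ 2 * pi *+ 2))^-1.
  rewrite -[X in X <= _]invrK -[X in _ <= _ * X]invrK.
  rewrite invrK invrK ler_pdivlMr ?sqrtr_gt0; last first.
    by rewrite mulrn_wgt0// mulr_gt0 ?pi_gt0// mulrn_wgt0.
  rewrite mulrC ler_pdivrMr ?sqrtr_gt0//.
  rewrite (_ : t *+ 2 * pi *+ 2 = 2 * (t * pi *+ 2)); last by ring.
  rewrite sqrtrM// ler_wpM2r ?sqrtr_ge0//.
  rewrite -[leRHS]ger0_norm// -[leRHS]sqrtr_sqr ler_wsqrtr// expr2.
  by rewrite -natrM ler_nat.
rewrite /hk (_ : 8 * t / d ^+ 2 * _ = (2 * (Num.sqrt (t *+ 2 * pi *+ 2))^-1) *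
    (4 * t / d ^+ 2 * expR (- z ^+ 2 / (t *+ 2 *+ 2)))).
  by rewrite ler_pM ?invr_ge0 ?sqrtr_ge0 ?expR_ge0.
by rewrite (_ : 8 = 2 * 4 :> R) ?mulrA; ring.
Qed.

(** By Jensen with [c = g x] and Tonelli, the squared norm is at most the average under [hk t z] of
    the squared norm of the increment of [g] by [- z]. This increment is small for [|z| < d0];
    elsewhere it is bounded and [hk_tail] gives a mass of order [t]. *)
Lemma heat_cvg (g : R -> R) e : L2 g -> 0 < e ->
  exists2 d, 0 < d & forall t, 0 < t -> t < d ->
    nrm (fun x => heat t g x - g x) <= e.
Proof.
move=> Lg e0; have mg := Lg.1.
have e20 : 0 < e / 2 by rewrite divr_gt0.
have /nbhs_ballP[d0 /= d00 Hd0] := translation_cvg Lg e20.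
set N := nrm g.
(* For [t < d] the tail term [(2 N)^2 * 8 t / d0^2] stays below [(e / 2)^2]; the summand 1 keeps the
   divisor positive. *)
pose d := (e / 2) ^+ 2 / (32 * (N ^+ 2 + 1) / d0 ^+ 2).
have N1 : 0 < N ^+ 2 + 1 by rewrite ltr_wpDl// sqr_ge0.
have dd0 : 0 < 32 * (N ^+ 2 + 1) / d0 ^+ 2 by rewrite divr_gt0 ?mulr_gt0 ?exprn_gt0.
exists d; first by rewrite divr_gt0// exprn_gt0.
move=> t t0 td.
pose k (p : R * R) := (hk t p.2 * (g (p.1 - p.2) - g p.1) ^+ 2)%:E.
have mk : measurable_fun [set: measurableTypeR R * measurableTypeR R] k.
  apply/measurable_EFinP; apply: measurable_funM.
    by apply: (measurableT_comp (@measurable_hk R t)); exact: measurable_snd.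
  apply: measurable_funX; apply: measurable_funB.
    apply: (measurableT_comp mg).
    by apply: measurable_funB; [exact: measurable_fst|exact: measurable_snd].
  by apply: (measurableT_comp mg); exact: measurable_fst.
have k0 p : (0 <= k p)%E by rewrite lee_fin mulr_ge0 ?hk_ge0 ?sqr_ge0.
have Lh : L2 (heat t g) by exact: L2_heat.
apply: nrm_le_EFin; [exact: ltW|exact: L2B|].
apply: (@le_trans _ _ (\int[mu]_x \int[mu]_z k (x, z))%E).
  apply: ge0_le_integral => //.
  - by move=> x _; rewrite lee_fin sqr_ge0.
  - by apply/measurable_EFinP; apply: measurable_funX; exact: (L2B Lh Lg).1.
  - exact: (@measurable_fun_fubini_tonelli_F _ _ (measurableTypeR R) (measurableTypeR R) R mu k mk k0).
  - move=> x _; apply: (le_trans (jensen_hk x (g x) t0 Lg)).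
    rewrite -(ge0_integral_sub x (f := fun y => (hk t (x - y) * (g y - g x) ^+ 2)%:E)).
    + rewrite le_eqVlt; apply/orP; left; apply/eqP; apply: eq_integral => z _.
      by rewrite /k/= opprB addrC subrK.
    + apply/measurable_EFinP; apply: measurable_funM; first exact: (L2_hk_sub x t0).1.
      by apply: measurable_funX; exact: measurable_funB.
    + by move=> y; rewrite lee_fin mulr_ge0 ?hk_ge0 ?sqr_ge0.
rewrite (lebesgue_tonelli mk k0).
have mh s : measurable_fun [set: measurableTypeR R] (EFin \o hk s).
  by apply/measurable_EFinP; exact: measurable_hk.
apply: (@le_trans _ _ (\int[mu]_z (((e / 2) ^+ 2)%:E * (hk t z)%:E +
    ((N + N) ^+ 2 * (8 * t / d0 ^+ 2))%:E * (hk (t *+ 2) z)%:E))%E).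
  apply: ge0_le_integral => //.
  - by move=> z _; exact: integral_ge0.
  - exact: (@measurable_fun_fubini_tonelli_G _ _ (measurableTypeR R) (measurableTypeR R) R mu k mk k0).
  - by apply: emeasurable_funD; apply: measurable_funeM; exact: mh.
  - move=> z _.
    have -> : (\int[mu]_x k (x, z) = (hk t z)%:E * (nrm (fun x => g (x - z) - g x) ^+ 2)%:E)%E.
      rewrite EFin_nrm2; last by apply: L2B => //; exact: L2_shift.
      rewrite -ge0_integralZl//.
      + by apply/measurable_EFinP; apply: measurable_funX;
          exact: (L2B (L2_shift (- z) Lg) Lg).1.
      + by move=> x _; rewrite lee_fin sqr_ge0.
      + by rewrite lee_fin hk_ge0.
    rewrite -!EFinM -EFinD lee_fin.
    have [zd|zd] := ltP `|z| d0.
      have := Hd0 (- z); rewrite /ball/= sub0r opprK => /(_ zd) Hz.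
      rewrite mulrC (@le_trans _ _ ((e / 2) ^+ 2 * hk t z))//.
        by rewrite ler_wpM2r ?hk_ge0// lerXn2r ?nnegrE ?nrm_ge0// ltW.
      rewrite lerDl mulr_ge0 ?hk_ge0// mulr_ge0 ?sqr_ge0// divr_ge0 ?sqr_ge0//.
      by rewrite mulr_ge0// ltW.
    have Nz : nrm (fun x => g (x - z) - g x) <= N + N.
      rewrite (le_trans (nrmB _ Lg))//; first exact: L2_shift.
      by rewrite (nrm_shift (- z) Lg).
    rewrite mulrC (@le_trans _ _ ((N + N) ^+ 2 * hk t z))//.
      by rewrite ler_wpM2r ?hk_ge0// lerXn2r ?nnegrE ?nrm_ge0// addr_ge0 ?nrm_ge0.
    rewrite (@le_trans _ _ ((N + N) ^+ 2 * (8 * t / d0 ^+ 2 * hk (t *+ 2) z)))//.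
      by rewrite ler_wpM2l ?sqr_ge0// hk_tail.
    by rewrite mulrA lerDr mulr_ge0 ?hk_ge0 ?sqr_ge0.
have c20 : 0 <= (N + N) ^+ 2 * (8 * t / d0 ^+ 2).
  by rewrite mulr_ge0 ?sqr_ge0// divr_ge0 ?sqr_ge0// mulr_ge0// ltW.
rewrite ge0_integralD//; last 4 first.
- by move=> z _; rewrite -EFinM lee_fin mulr_ge0 ?hk_ge0 ?sqr_ge0.
- by apply: measurable_funeM; exact: mh.
- by move=> z _; rewrite -EFinM lee_fin mulr_ge0 ?hk_ge0.
- by apply: measurable_funeM; exact: mh.
rewrite ge0_integralZl//; last 3 first.
- exact: mh.
- by move=> z _; rewrite lee_fin hk_ge0.
- by rewrite lee_fin sqr_ge0.
rewrite ge0_integralZl//; last 2 first.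
- exact: mh.
- by move=> z _; rewrite lee_fin hk_ge0.
rewrite !integral_hk ?mulrn_wgt0// !mule1 -EFinD lee_fin.
have h1 : t * (32 * (N ^+ 2 + 1) / d0 ^+ 2) < (e / 2) ^+ 2 by rewrite -ltr_pdivlMr.
have h2 : (N + N) ^+ 2 * (8 * t / d0 ^+ 2) <= t * (32 * (N ^+ 2 + 1) / d0 ^+ 2).
  rewrite -subr_ge0 (_ : _ - _ = 32 * t / d0 ^+ 2); last by ring.
  by rewrite divr_ge0 ?sqr_ge0// mulr_ge0// ltW.
have h3 : (e / 2) ^+ 2 = e ^+ 2 / 4 by field.
have := sqr_ge0 e; lra.
Qed.

End HeatSemigroup.

(** * Smooth functions and test functions *)

Section SmoothReal.
Context {R : realType}.
Implicit Types (f g a b : R -> R).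

(** A one-variable form of [Ck] that carries the derivative as a witness, so that sums, products and
    compositions exhibit theirs. *)
Fixpoint smooth_upto (k : nat) g : Prop :=
  if k is k'.+1 then
    exists2 dg : R -> R, (forall x : R, is_derive x 1 g (dg x)) & smooth_upto k' dg
  else continuous g.

Definition smooth g := forall k, smooth_upto k g.

Lemma is_derive_continuous g (dg : R -> R) :
  (forall x : R, is_derive x 1 g (dg x)) -> continuous g.
Proof.
move=> dgx x; apply: differentiable_continuous; apply/derivable1_diffP.
by have [] := dgx x.
Qed.

Lemma smooth_uptoS k g : smooth_upto k.+1 g -> smooth_upto k g.
Proof.
elim: k g => [|k IH] g [dg dgE Sdg]; first exact: is_derive_continuous dgE.
by exists dg => //; exact: IH.
Qed.

Lemma is_derive_uniq g (x d1 d2 : R) :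
  is_derive x 1 g d1 -> is_derive x 1 g d2 -> d1 = d2.
Proof. by move=> [_ <-] [_ <-]. Qed.

(** The witnesses at the various orders coincide by uniqueness of the derivative. *)
Lemma smooth_derive g : smooth g ->
  exists2 dg : R -> R, (forall x : R, is_derive x 1 g (dg x)) & smooth dg.
Proof.
move=> Sg; have [dg dgE _] := Sg 1%N; exists dg => // k.
have [dg' dgE' S'] := Sg k.+1.
suff -> : dg = dg' by [].
by apply/funext => x; exact: is_derive_uniq (dgE x) (dgE' x).
Qed.

Lemma smooth_upto_cst k (c : R) : smooth_upto k (cst c).
Proof.
elim: k c => [|k IH] c /=; first by move=> x; exact: cvg_cst.
by exists (cst 0) => // x; exact: is_derive_cst.
Qed.

Lemma smooth_upto_id k : smooth_upto k id.
Proof.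
case: k => [x|k]; first exact: cvg_id.
by exists (cst 1); [move=> x; exact: is_derive_id|exact: smooth_upto_cst].
Qed.

Lemma smooth_uptoD k f g : smooth_upto k f -> smooth_upto k g ->
  smooth_upto k (fun x => f x + g x).
Proof.
elim: k f g => [|k IH] f g /=; first by move=> cf cg x; exact: cvgD (cf x) (cg x).
move=> [df dfE Sf] [dg dgE Sg]; exists (fun x => df x + dg x); last exact: IH.
by move=> x; exact: is_deriveD.
Qed.

Lemma smooth_uptoM k f g : smooth_upto k f -> smooth_upto k g ->
  smooth_upto k (fun x => f x * g x).
Proof.
elim: k f g => [|k IH] f g; first by move=> cf cg x; exact: cvgM (cf x) (cg x).
move=> Sf1 Sg1; have Sf := smooth_uptoS Sf1; have Sg := smooth_uptoS Sg1.
move: Sf1 Sg1 => [df dfE Sdf] [dg dgE Sdg].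
exists (fun x => f x * dg x + g x * df x); first by move=> x; exact: is_deriveM.
by apply: smooth_uptoD; exact: IH.
Qed.

Lemma is_derive_comp1 f g (x df dg : R) :
  is_derive (g x) 1 f df -> is_derive x 1 g dg -> is_derive x 1 (f \o g) (df * dg).
Proof.
move=> [f1 fE] [g1 gE]; apply: DeriveDef.
  apply/derivable1_diffP; apply: differentiable_comp; exact/derivable1_diffP.
by rewrite -derive1E (derive1_comp g1 f1) !derive1E fE gE.
Qed.

Lemma smooth_upto_comp k f g : smooth_upto k f -> smooth_upto k g ->
  smooth_upto k (f \o g).
Proof.
elim: k f g => [|k IH] f g.
  by move=> cf cg x; apply: continuous_comp; [exact: cg|exact: cf].
move=> Sf Sg1; have Sg := smooth_uptoS Sg1.
move: Sf Sg1 => [df dfE Sdf] [dg dgE Sdg].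
exists (fun x => df (g x) * dg x); first by move=> x; exact: is_derive_comp1.
by apply: smooth_uptoM => //; exact: (IH df g).
Qed.

Lemma smooth_upto_affine k (c d : R) : smooth_upto k (fun x => c * x + d).
Proof.
apply: smooth_uptoD; last exact: smooth_upto_cst.
by apply: smooth_uptoM; [exact: smooth_upto_cst|exact: smooth_upto_id].
Qed.

Lemma smooth_upto_expR k : smooth_upto k (@expR R).
Proof.
elim: k => [|k IH]; first exact: continuous_expR.
by exists expR => // x; exact: is_derive_expR.
Qed.

Lemma smooth_uptoV k g : (forall x, g x != 0) -> smooth_upto k g ->
  smooth_upto k (fun x => (g x)^-1).
Proof.
move=> g0; elim: k => [|k IH]; first by move=> cg x; exact: cvgV (g0 x) (cg x).
move=> Sg1; have Sg := smooth_uptoS Sg1; move: Sg1 => [dg dgE Sdg].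
exists (fun x => - 1 * (((g x)^-1 * (g x)^-1) * dg x)).
  move=> x; have [d1 dE] := dgE x; apply: DeriveDef.
    exact: derivableV.
  by rewrite deriveV// dE mulN1r scaleNr -exprVn expr2.
apply: smooth_uptoM; first exact: smooth_upto_cst.
apply: smooth_uptoM => //.
by apply: smooth_uptoM; exact: IH.
Qed.

(* [x ^- n * exp (-1/x)] for [0 < x], extended by [0]: differentiating stays in
   the span of this family. *)
Definition flat (n : nat) (x : R) : R :=
  if 0 < x then (x^-1) ^+ n * expR (- x^-1) else 0.

(** With [y = 1 / x], one term of the exponential series bounds [y^(n+1) * exp (-y)] by [(n+1)!];
    the extra power of [y] is the factor [x]. *)
Lemma flat_le n (x : R) : 0 < x -> flat n x <= n.+1`!%:R * x.
Proof.
move=> x0; rewrite /flat x0.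
have y0 : 0 < x^-1 by rewrite invr_gt0.
have := expR_ge1Dxn n (ltW y0) => H.
have f0 : 0 < n.+1`!%:R :> R by rewrite ltr0n fact_gt0.
have : x^-1 ^+ n.+1 <= n.+1`!%:R * expR x^-1.
  rewrite mulrC -ler_pdivrMr// (le_trans _ H)// lerDr//.
rewrite exprS => H2; rewrite expRN ler_pdivrMr ?expR_gt0//.
rewrite (_ : x^-1 ^+ n = x * (x^-1 * x^-1 ^+ n)); last first.
  by rewrite mulrA divff ?mul1r// gt_eqF.
by rewrite [_ * x]mulrC -mulrA ler_pM2l.
Qed.

Lemma is_derive_flat n (x : R) :
  is_derive x 1 (flat n) (- n%:R * flat n.+1 x + flat n.+2 x).
Proof.
have [x0|x0|->] := ltgtP x 0.
- have -> : - n%:R * flat n.+1 x + flat n.+2 x = 0.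
    by rewrite /flat !ifF ?mulr0 ?addr0//; apply/negbTE; rewrite -leNgt ltW.
  have H : is_derive x 1 (cst (0 : R)) (0 : R) by exact: is_derive_cst.
  apply: near_eq_is_derive H.
  near=> z; rewrite /flat ifF//; apply/negbTE; rewrite -leNgt ltW//.
  by near: z; exact: lt_nbhsl.
- have x1 : x != 0 by rewrite gt_eqF.
  have dV : is_derive x 1 (fun y : R => y^-1) (- x ^- 2).
    apply: DeriveDef; first by apply: derivableV => //; exact: derivable_id.
    by rewrite deriveV// derive_id -[RHS]mulr1.
  have d1 := is_deriveX n dV.
  have d2 := is_deriveN dV.
  have d3 : is_derive x 1 (expR \o (fun y : R => - y^-1)) (expR (- x^-1) * (- - x ^- 2)).
    by apply: is_derive_comp1 => //; exact: is_derive_expR.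
  have d4 := is_deriveM d1 d3.
  apply: (near_eq_is_derive (f := (fun y : R => y^-1) ^+ n * (expR \o (fun y : R => - y^-1)))).
    near=> z; rewrite /flat ifT ?exprfctE//.
    by near: z; exact: lt_nbhsr.
  apply: (is_derive_eq d4); rewrite /flat x0 /= /GRing.scale/= opprK !exprfctE.
  case: n d1 d4 => [|n] d1 d4.
    by rewrite !expr0 mul0r oppr0 !mul0r mulr0 mul1r add0r addr0 exprVn mulrC.
  rewrite /= -(exprVn x 2) !exprS; ring.
- rewrite /flat ltxx mulr0 addr0.
  have L : (fun h : R => h^-1 *: (flat n (h *: 1 + 0) - flat n 0)) @ 0^' --> (0 : R).
    apply/cvgrPdist_le => e e0.
    near=> h; rewrite sub0r normrN addr0 [h%:A]mulr1.
    rewrite [flat n 0]/flat ltxx subr0.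
    have [h0|h0] := ltP 0 h; last first.
      by rewrite /flat ifF ?scaler0 ?normr0 ?ltW//; apply/negbTE; rewrite -leNgt.
    (* On the right of 0 the difference quotient is again a member of the family, and [flat_le]
       makes it tend to 0. *)
    rewrite (_ : h^-1 *: flat n h = flat n.+1 h); last first.
      by rewrite /flat h0 /GRing.scale/= mulrA -exprS.
    rewrite ger0_norm; last by rewrite /flat h0 mulr_ge0 ?expR_ge0// exprn_ge0 ?invr_ge0// ltW.
    rewrite (le_trans (flat_le _ h0))// mulrC -ler_pdivlMr ?ltr0n ?fact_gt0//.
    rewrite (le_trans (ler_norm h))//.
    near: h; apply: nbhs_dnbhs; apply/nbhs_ballP.
    exists (e / n.+2`!%:R) => /=; first by rewrite divr_gt0// ltr0n fact_gt0.
    by move=> z; rewrite /ball/= sub0r normrN => /ltW.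
  apply: DeriveDef; first by apply/cvg_ex; exists 0; exact: L.
  by apply: cvg_lim => //; exact: L.
Unshelve. all: by end_near. Qed.

Lemma smooth_flat n : smooth (flat n).
Proof.
move=> k; elim: k n => [|k IH] n /=; first exact: is_derive_continuous (is_derive_flat n).
exists (fun x => - n%:R * flat n.+1 x + flat n.+2 x); first exact: is_derive_flat.
by apply: smooth_uptoD => //; apply: smooth_uptoM => //; exact: smooth_upto_cst.
Qed.

Lemma flat_gt0 n (x : R) : 0 < x -> 0 < flat n x.
Proof. by move=> x0; rewrite /flat x0 mulr_gt0 ?expR_gt0// exprn_gt0 ?invr_gt0. Qed.

Lemma flat_ge0 n (x : R) : 0 <= flat n x.
Proof. by have [x0|x0] := ltP 0 x; [rewrite ltW ?flat_gt0|rewrite /flat ltNge x0]. Qed.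

Lemma flat_eq0 n (x : R) : x <= 0 -> flat n x = 0.
Proof. by move=> x0; rewrite /flat ltNge x0. Qed.

(** A smooth transition from 0 on the left of 0 to 1 on the right of 1. The denominator is positive
    because [x] and [1 - x] are never both nonpositive. *)
Definition step (x : R) : R := flat 0 x / (flat 0 x + flat 0 (1 - x)).

Lemma step_den (x : R) : 0 < flat 0 x + flat 0 (1 - x).
Proof.
have [x0|x0] := ltP 0 x; first by rewrite ltr_pwDl ?flat_gt0 ?flat_ge0.
by rewrite ltr_wpDl ?flat_ge0// flat_gt0// subr_gt0 (le_lt_trans x0).
Qed.

Lemma smooth_step : smooth step.
Proof.
move=> k; apply: smooth_uptoM; first exact: smooth_flat.
apply: smooth_uptoV; first by move=> x; rewrite gt_eqF// step_den.
apply: smooth_uptoD; first exact: smooth_flat.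
rewrite (_ : (fun x => _) = flat 0 \o (fun x => -1 * x + 1)).
  by apply: smooth_upto_comp; [exact: smooth_flat|exact: smooth_upto_affine].
by apply/funext => x /=; rewrite mulN1r addrC.
Qed.

Lemma step_itv (x : R) : 0 <= step x <= 1.
Proof.
rewrite divr_ge0 ?flat_ge0 ?(ltW (step_den x))//= ler_pdivrMr ?step_den//.
by rewrite mul1r lerDl flat_ge0.
Qed.

Lemma step0 (x : R) : x <= 0 -> step x = 0.
Proof. by move=> x0; rewrite /step flat_eq0// mul0r. Qed.

Lemma step1 (x : R) : 1 <= x -> step x = 1.
Proof.
move=> x1; rewrite /step (@flat_eq0 _ (1 - x)) ?subr_le0// addr0 divff//.
by rewrite gt_eqF// flat_gt0// (lt_le_trans ltr01).
Qed.

Definition cutoff (c x : R) : R := step (x + c + 1) * step (c + 1 - x).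

Lemma smooth_cutoff (c : R) : smooth (cutoff c).
Proof.
move=> k; apply: smooth_uptoM.
  rewrite (_ : (fun x => _) = step \o (fun x => 1 * x + (c + 1))).
    by apply: smooth_upto_comp; [exact: smooth_step|exact: smooth_upto_affine].
  by apply/funext => x /=; rewrite mul1r addrA.
rewrite (_ : (fun x => _) = step \o (fun x => -1 * x + (c + 1))).
  by apply: smooth_upto_comp; [exact: smooth_step|exact: smooth_upto_affine].
by apply/funext => x /=; rewrite mulN1r addrC.
Qed.

Lemma cutoff1 (c x : R) : `|x| <= c -> cutoff c x = 1.
Proof.
by rewrite ler_norml => /andP[h1 h2]; rewrite /cutoff !step1 ?mulr1//; lra.
Qed.

Lemma cutoff0 (c x : R) : c + 1 <= `|x| -> cutoff c x = 0.
Proof.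
rewrite /cutoff ler_normr => /orP[|] h.
  by rewrite (@step0 (c + 1 - x)) ?mulr0//; lra.
by rewrite step0 ?mul0r//; lra.
Qed.

Lemma cutoff_itv (c x : R) : 0 <= cutoff c x <= 1.
Proof.
have /andP[a0 a1] := step_itv (x + c + 1).
have /andP[b0 b1] := step_itv (c + 1 - x).
by rewrite mulr_ge0//= mulr_ile1.
Qed.

End SmoothReal.

(** * Products of one-variable functions as test functions of the plane *)

Section TensorTest.
Context {R : realType}.

Lemma CkD (V : normedModType R) k (f g : V -> R) :
  Ck k f -> Ck k g -> Ck k (fun p => f p + g p).
Proof.
elim: k f g => [|k IH] f g /= [cf Hf] [cg Hg].
  by split => // x; exact: cvgD (cf x) (cg x).
split; first by move=> x; exact: cvgD (cf x) (cg x).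
move=> v; have [df Cf] := Hf v; have [dg Cg] := Hg v; split.
  by move=> p; exact: derivableD.
rewrite (_ : derive _ ^~ v = (fun p => 'D_v f p + 'D_v g p)); first exact: IH.
by apply/funext => p; rewrite deriveD.
Qed.

Lemma CkZ (V : normedModType R) k (c : R) (f : V -> R) :
  Ck k f -> Ck k (fun p => c * f p).
Proof.
elim: k f => [|k IH] f /= [cf Hf].
  by split => // x; apply: cvgM; [exact: cvg_cst|exact: cf].
split; first by move=> x; apply: cvgM; [exact: cvg_cst|exact: cf].
move=> v; have [df Cf] := Hf v; split.
  by move=> p; apply: (@derivableZ _ _ R^o).
rewrite (_ : derive _ ^~ v = (fun p => c * 'D_v f p)); first exact: IH.
by apply/funext => p; rewrite (@deriveZ _ _ R^o).
Qed.

Lemma is_derive_line (V : normedModType R) (f : V -> R) (x v : V) (df : R) :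
  is_derive (0 : R) 1 (fun h : R => f (h *: v + x)) df -> is_derive x v f df.
Proof.
move=> [d1 dE]; apply: DeriveDef; first exact/derivable1P.
rewrite -dE /derive; set g1 := fun h => h^-1 *: _; set g2 := fun h => h^-1 *: _.
suff -> : g1 = g2 by [].
by apply/funext => h; rewrite /g1 /g2 /= addr0 scale0r add0r [_%:A]mulr1.
Qed.

(** Stated for any [l] that is affine along the line, to serve for both projections. *)
Lemma is_derive_comp_line (l : R^o * R^o -> R) (a : R -> R) (p v : R^o * R^o) (da : R) :
  (forall h : R, l (h *: v + p) = h * l v + l p) ->
  is_derive (l p) 1 a da -> is_derive p v (a \o l) (l v * da).
Proof.
move=> lE aE; apply: is_derive_line.
rewrite (_ : (fun h : R => _) = a \o (fun h : R => h * l v + l p)); last first.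
  by apply/funext => h /=; rewrite lE.
rewrite mulrC; apply: is_derive_comp1; first by rewrite mul0r add0r.
have H : is_derive (0 : R) 1 (fun h : R => h * l v + l p) (1 *: l v + 0).
  apply: is_deriveD.
  have := is_deriveM (is_derive_id (0 : R) 1) (is_derive_cst (l v) (0:R) 1).
  by rewrite scaler0 add0r => /is_derive_eq; apply; rewrite /GRing.scale/= mulr1 mul1r.
by apply: (is_derive_eq H); rewrite /GRing.scale/= mul1r addr0.
Qed.

Lemma is_derive_tensor (a b da db : R -> R) (p v : R^o * R^o) :
  is_derive p.1 1 a (da p.1) -> is_derive p.2 1 b (db p.2) ->
  is_derive p v (fun p : R^o * R^o => a p.1 * b p.2)
    (v.1 * (da p.1 * b p.2) + v.2 * (a p.1 * db p.2)).
Proof.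
move=> aE bE.
have d1 := @is_derive_comp_line fst a p v _ (fun h => erefl) aE.
have d2 := @is_derive_comp_line snd b p v _ (fun h => erefl) bE.
by apply: (is_derive_eq (is_deriveM d1 d2)); rewrite /GRing.scale/=; ring.
Qed.

Lemma tensor_continuous (a b : R -> R) : continuous a -> continuous b ->
  continuous (fun p : R^o * R^o => a p.1 * b p.2).
Proof.
move=> ca cb p; apply: cvgM.
  apply: (cvg_comp (fun q : R^o * R^o => q.1) a); last exact: ca.
  exact: cvg_fst.
apply: (cvg_comp (fun q : R^o * R^o => q.2) b); last exact: cb.
exact: cvg_snd.
Qed.

(** A derivative of a product in any direction is a linear combination of two such products, so the
    induction on [k] ranges over all pairs. *)
Lemma Ck_tensor k (a b : R -> R) : smooth a -> smooth b ->
  Ck k (fun p : R^o * R^o => a p.1 * b p.2).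
Proof.
elim: k a b => [|k IH] a b Sa Sb.
  by split => //; exact: (tensor_continuous (Sa 0%N) (Sb 0%N)).
have [da daE Sda] := smooth_derive Sa.
have [db dbE Sdb] := smooth_derive Sb.
have D p v := is_derive_tensor (da := da) (db := db) v (daE p.1) (dbE p.2).
split; first exact: (tensor_continuous (Sa 0%N) (Sb 0%N)).
move=> v; split; first by move=> p; have [] := D p v.
rewrite (_ : derive _ ^~ v = (fun p : R^o * R^o =>
    v.1 * (da p.1 * b p.2) + v.2 * (a p.1 * db p.2))).
  by apply: CkD; apply: CkZ; exact: IH.
by apply/funext => p; have [_ ->] := D p v.
Qed.

Lemma test_function_tensor (a b : R -> R) (M : R) : smooth a -> smooth b ->
  (forall x, M <= `|x| -> a x = 0) -> (forall x, M <= `|x| -> b x = 0) ->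
  test_function (fun p : R^o * R^o => a p.1 * b p.2).
Proof.
move=> Sa Sb a0 b0; split; first by move=> k; exact: Ck_tensor.
have cK : compact (`[- M, M]%classic `*` `[- M, M]%classic : set (R^o * R^o)).
  by apply: compact_setX; exact: segment_compact.
apply: (subclosed_compact _ cK); first exact: closed_closure.
rewrite closureE; apply: smallest_sub; first exact: compact_closed.
have out (c : R -> R) (x : R) : (forall x, M <= `|x| -> c x = 0) -> c x != 0 -> x \in `[- M, M].
  move=> c0; apply: contraR => H; apply/eqP/c0.
  rewrite leNgt; apply: contra H => /ltW; rewrite ler_norml in_itv/=.
  by case/andP => -> ->.
move=> [x y] /=; rewrite mulf_eq0 negb_or => /andP[ax by_]; split => /=.
  exact: (out a).
exact: (out b).
Qed.

End TensorTest.

(** * From the weak equation to the mild equation *)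

Section Curves.
Context {R : realType}.
Local Notation mu := (@lebesgue_measure R).
Implicit Types (w u : R -> R -> R) (s t e T : R).

Definition L2_curve w := (forall t, L2 (w t)) /\
  forall s, nrm (fun x => w t x - w s x) @[t --> s] --> (0 : R).

Lemma L2_curve_near w s e : L2_curve w -> 0 < e ->
  \forall t \near s, nrm (fun x => w t x - w s x) < e.
Proof.
move=> [_ cw] e0; have /cvgrPdist_lt /(_ _ e0) := cw s.
by apply: filterS => t; rewrite sub0r normrN ger0_norm// nrm_ge0.
Qed.

Lemma L2_curve_intro w : (forall t, L2 (w t)) ->
  (forall s e, 0 < e -> \forall t \near s, nrm (fun x => w t x - w s x) <= e) ->
  L2_curve w.
Proof.
move=> Lw cw; split => // s; apply/cvgrPdist_le => e e0.
by apply: filterS (cw s e e0) => t; rewrite sub0r normrN ger0_norm// nrm_ge0.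
Qed.

Lemma L2_curve_ip w (h : R -> R) : L2_curve w -> L2 h ->
  continuous (fun t => ip (w t) h).
Proof.
move=> cw Lh s; apply/cvgrPdist_le => e e0.
have e1 : 0 < e / (nrm h + 1) by rewrite divr_gt0// ltr_wpDl ?nrm_ge0.
apply: filterS (L2_curve_near s cw e1) => t ht.
have [Lw _] := cw.
rewrite distrC -ipBl// (le_trans (cauchy_schwarz (L2B (Lw t) (Lw s)) Lh))//.
rewrite (@le_trans _ _ (e / (nrm h + 1) * (nrm h + 1)))//.
  by rewrite ler_pM ?nrm_ge0 ?lerDl// ltW.
by rewrite divfK// gt_eqF// ltr_wpDl ?nrm_ge0.
Qed.

Lemma nrm_dist (f g : R -> R) : L2 f -> L2 g ->
  `|nrm f - nrm g| <= nrm (fun x => f x - g x).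
Proof.
move=> Lf Lg; rewrite ler_norml lerBlDr lerNl opprB lerBlDr; apply/andP; split.
  rewrite nrmBC; have := nrmD (L2B Lg Lf) Lf.
  by under [X in nrm X]eq_fun do rewrite subrK.
have := nrmD (L2B Lf Lg) Lg.
by under [X in nrm X]eq_fun do rewrite subrK.
Qed.

Lemma L2_curve_nrm w : L2_curve w -> continuous (fun t => nrm (w t)).
Proof.
move=> cw s; apply/cvgrPdist_le => e e0.
apply: filterS (L2_curve_near s cw e0) => t ht; rewrite distrC.
by rewrite (le_trans (nrm_dist (cw.1 t) (cw.1 s)))// ltW.
Qed.

(** Dominated convergence: at every point other than [c0] the indicators are eventually constant.
    This is how the moving discontinuity at the boundary becomes continuous in L^2. *)
Lemma cutoff_indic_cvg (h : R -> R) (c0 : R) : L2 h ->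
  nrm (fun x => \1_(`]-oo, c]) x * h x - \1_(`]-oo, c0]) x * h x) @[c --> c0]
    --> (0 : R).
Proof.
move=> Lh; apply/(@cvg_nbhsP _ R^o) => c cc0.
have mind (a : R) : measurable_fun setT (\1_(`]-oo, a]) : R -> R).
  by apply: measurable_indic; exact: measurable_itv.
have mI (a : R) : measurable_fun setT (fun x => \1_(`]-oo, a]) x * h x).
  by apply: measurable_funM => //; exact: Lh.1.
apply: (L2_dominated_cvg (F := fun n x => \1_(`]-oo, c n]) x * h x) (g := h)) => //.
  move=> n x; rewrite -mulrBl normrM ler_piMl// !indicE.
  by do 2!case: (_ \in _); rewrite ?subrr ?subr0 ?sub0r ?normrN ?normr0 ?normr1.
exists [set c0]; split; [exact: measurable_set1|exact: lebesgue_measure_set1|].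
move=> x /=; apply: contra_notP => xc0.
apply: cvgM; last exact: cvg_cst.
apply: cvg_near_cst.
have [xlt|xgt|xE] := ltgtP x c0; last by [].
  near=> n; rewrite !indicE !mem_set//= in_itv/=; first exact: ltW.
  by near: n; apply: (cvgr_ge c0 cc0).
near=> n; rewrite !indicE !memNset//= in_itv/= -?ltNge//.
  by apply/negP; rewrite -ltNge.
by apply/negP; rewrite -ltNge; near: n; apply: (cvgr_lt c0 cc0).
Unshelve. all: by end_near. Qed.

Lemma L2_curve_cut u (b : R -> R) : L2_curve u -> continuous b ->
  L2_curve (fun t x => \1_(`]-oo, b t]) x * u t x).
Proof.
move=> cu cb; have [Lu _] := cu.
have mind (a : R) : measurable_fun setT (\1_(`]-oo, a]) : R -> R).
  by apply: measurable_indic; exact: measurable_itv.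
have ind1 (a x : R) : `|\1_(`]-oo, a]) x : R| <= 1.
  by rewrite indicE; case: (_ \in _); rewrite ?normr0 ?normr1.
have LI a t : L2 (fun x => \1_(`]-oo, a]) x * u t x).
  exact: (L2_Mbounded (mind a) (ind1 a)).
apply: L2_curve_intro => [t|s e e0]; first exact: LI.
have e20 : 0 < e / 2 by rewrite divr_gt0.
have h1 := L2_curve_near s cu e20.
have /cvgrPdist_lt /(_ _ e20) h2 := cvg_comp _ _ (cb s) (cutoff_indic_cvg (b s) (Lu s)).
near=> t.
have LB := L2B (Lu t) (Lu s).
rewrite (le_trans (nrm_triangle (LI (b t) t) (LI (b t) s) (LI (b s) s)))//.
rewrite [leRHS]splitr lerD//.
  rewrite (@le_trans _ _ (nrm (fun x => u t x - u s x)))//; last first.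
    exact: ltW (near h1 t _).
  apply: nrm_le => //; first exact: (L2B (LI (b t) t) (LI (b t) s)).1.
  by move=> x; rewrite -mulrBr normrM ler_piMl.
have : `|0 - nrm (fun x => \1_(`]-oo, b t]) x * u s x - \1_(`]-oo, b s]) x * u s x)| < e / 2.
  by near: t.
by rewrite sub0r normrN ger0_norm ?nrm_ge0// => /ltW.
Unshelve. all: by end_near. Qed.

End Curves.

(** * Primitives and the du Bois-Reymond lemma *)

Section Calculus.
Context {R : realType}.
Local Notation mu := (@lebesgue_measure R).
Implicit Types (F f g k : R -> R) (a b c s t x T : R).

Lemma continuous_integrable_itv f a b : {within `[a, b], continuous f} ->
  mu.-integrable `[a, b] (EFin \o f).
Proof. by apply: continuous_compact_integrable; exact: segment_compact. Qed.

Lemma Rint_FTC F f a b : a < b -> {within `[a, b], continuous f} ->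
  {within `[a, b], continuous F} ->
  (forall x, x \in `]a, b[ -> is_derive x 1 F (f x)) ->
  \int[mu]_(x in `[a, b]) f x = F b - F a.
Proof.
move=> ab cf cF dF; rewrite /Rintegral (@continuous_FTC2 _ f F)//.
- have [_ cr cl] := proj1 (continuous_within_itvP F ab) cF.
  by split => // x /dF [].
- by move=> x /dF [_ <-]; rewrite derive1E.
Qed.

(** The base point is a parameter: with [c = -1] the primitive is differentiable at 0 from both
    sides. *)
Lemma exists_primitive k c : continuous k ->
  exists K : R -> R, forall x, c < x -> is_derive x 1 K (k x).
Proof.
move=> ck; exists (fun x => \int[mu]_(t in `[c, x]) k t) => x cx.
have xx1 : x < x + 1 by rewrite ltrDl.
have ik : mu.-integrable `[c, x + 1] (EFin \o k).
  by apply: continuous_integrable_itv; exact: continuous_subspaceT.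
have [d1 d2] := continuous_FTC1_closed xx1 ik cx (ck x).
by apply: (DeriveDef d1); rewrite -derive1E d2.
Qed.

Lemma Rint_primitive k K c t : continuous k ->
  (forall x, c < x -> is_derive x 1 K (k x)) -> c < 0 -> 0 <= t ->
  \int[mu]_(s in `[0, t]) k s = K t - K 0.
Proof.
move=> ck dK c0; rewrite le_eqVlt => /predU1P[<-|t0].
  by rewrite set_itv1 Rintegral_set1 subrr.
apply: Rint_FTC => //.
- exact: continuous_subspaceT.
- apply: derivable_within_continuous => x; rewrite in_itv/= => /andP[x0 _].
  by have [] := dK x (lt_le_trans c0 x0).
- by move=> x; rewrite in_itv/= => /andP[x0 _]; apply: dK; exact: lt_trans x0.
Qed.

Definition compact_supp (a : R -> R) := exists M : R, forall x, M <= `|x| -> a x = 0.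

Lemma smooth_mul f g : smooth f -> smooth g -> smooth (fun x => f x * g x).
Proof. by move=> Sf Sg k; exact: smooth_uptoM. Qed.

Lemma smooth_affine_comp f a b : smooth f -> smooth (fun x => f (a * x + b)).
Proof. by move=> Sf k; apply: (smooth_upto_comp (Sf k)); exact: smooth_upto_affine. Qed.

Lemma is_derive_affine_comp f (df : R -> R) a b x : (forall y : R, is_derive y 1 f (df y)) ->
  is_derive x 1 (fun y => f (a * y + b)) (a * df (a * x + b)).
Proof.
move=> dfE.
have H : is_derive x 1 (fun y : R => a * y + b) (a *: 1 + x *: 0 + 0) :=
  is_deriveD (is_deriveM (is_derive_cst a x 1) (is_derive_id x 1)) (is_derive_cst b x 1).
have H2 := @is_derive_comp1 _ f (fun y : R => a * y + b) x _ _ (dfE (a * x + b)) H.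
apply: (is_derive_eq H2).
by rewrite /GRing.scale/= mulr0 !addr0 mulr1 mulrC.
Qed.

Lemma step_derive_eq0 (ds : R -> R) : (forall x, is_derive x 1 (@step R) (ds x)) ->
  forall x, x < 0 \/ 1 < x -> ds x = 0.
Proof.
move=> dsE x x01.
have [c Hc] : exists c : R, \forall z \near x, c = step z.
  case: x01 => [x0|x1].
    by exists 0; near=> z; rewrite step0// ltW//; near: z; exact: lt_nbhsl.
  by exists 1; near=> z; rewrite step1// ltW//; near: z; exact: lt_nbhsr.
have H : is_derive x 1 (cst c) (0 : R) by exact: is_derive_cst.
exact: is_derive_uniq (dsE x) (near_eq_is_derive Hc H).
Unshelve. all: by end_near. Qed.

Lemma bounded_of_supp01 f : continuous f -> (forall x, x < 0 \/ 1 < x -> f x = 0) ->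
  exists2 C : R, 0 < C & forall x, `|f x| <= C.
Proof.
move=> cf f0.
have /compact_bounded[M [_ HM]] : compact (f @` `[0, 1]%classic).
  apply: continuous_compact; last exact: segment_compact.
  exact: continuous_subspaceT.
exists (`|M| + 1) => [|x]; first by rewrite ltr_wpDl.
have [x0|x0] := ltP x 0; first by rewrite f0 ?normr0 ?addr_ge0//; left.
have [x1|x1] := ltP 1 x; first by rewrite f0 ?normr0 ?addr_ge0//; right.
apply: (HM (`|M| + 1)); first by rewrite (le_lt_trans (ler_norm M))// ltrDl.
by exists x => //=; rewrite in_itv/= x0 x1.
Qed.

Lemma step_smooth_derivatives : exists ds dds : R -> R, exists2 C : R, 0 < C &
  [/\ forall x, is_derive x 1 (@step R) (ds x),
      forall x, is_derive x 1 ds (dds x),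
      smooth ds,
      forall x, `|ds x| <= C /\ `|dds x| <= C &
      forall x, x < 0 \/ 1 < x -> ds x = 0 /\ dds x = 0].
Proof.
have [ds dsE Sds] := smooth_derive (@smooth_step R).
have [dds ddsE Sdds] := smooth_derive Sds.
have ds0 := step_derive_eq0 dsE.
have dds0 x : x < 0 \/ 1 < x -> dds x = 0.
  move=> x01.
  have Hc : \forall z \near x, (cst 0 : R -> R) z = ds z.
    case: x01 => [x0|x1]; near=> z; rewrite ds0//.
      by left; near: z; exact: lt_nbhsl.
    by right; near: z; exact: lt_nbhsr.
  have H : is_derive x 1 (cst 0) (0 : R) by exact: is_derive_cst.
  exact: is_derive_uniq (ddsE x) (near_eq_is_derive Hc H).
have [C1 C10 HC1] := bounded_of_supp01 (Sds 0%N) ds0.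
have [C2 C20 HC2] := bounded_of_supp01 (Sdds 0%N) dds0.
exists ds, dds; exists (C1 + C2); first by rewrite addr_gt0.
split => // x; last by move=> h; split; [exact: ds0|exact: dds0].
split; first by rewrite (le_trans (HC1 x))// lerDl ltW.
by rewrite (le_trans (HC2 x))// lerDr ltW.
Unshelve. all: by end_near. Qed.

(** Let [D] be the defect, [F - F 0] minus the primitive of [k]. Integration by parts turns the
    hypothesis into: the integral of [da * D] is [a T * D T]. The constant [a = 1] gives [D T = 0],
    and a ramp just after [t] gives [D t = 0]. *)
Lemma du_bois_reymond F k T : 0 < T -> continuous F -> continuous k ->
  (forall a da : R -> R, smooth a -> compact_supp a ->
    (forall x, is_derive x 1 a (da x)) -> continuous da ->
    \int[mu]_(t in `[0, T]) (da t * F t) =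
      a T * F T - a 0 * F 0 - \int[mu]_(t in `[0, T]) (a t * k t)) ->
  forall t, t \in `[0, T] -> F t = F 0 + \int[mu]_(s in `[0, t]) k s.
Proof.
move=> T0 cF ck weak.
have [K dK] := exists_primitive (-1) ck.
have N10 : -1 < 0 :> R by rewrite ltrN10.
suff D0 t : t \in `[0, T] -> F t - F 0 = K t - K 0.
  move=> t tT; rewrite (Rint_primitive ck dK)//; last by move: tT; rewrite in_itv/= => /andP[].
  by rewrite -D0// addrCA subrr addr0.
pose D t := F t - F 0 - (K t - K 0).
have cK x : -1 < x -> {for x, continuous K}.
  by move=> x1; apply/differentiable_continuous/derivable1_diffP; have [] := dK x x1.
have cKw : {within `[0, T], continuous K}.
  apply: derivable_within_continuous => x; rewrite in_itv/= => /andP[x0 _].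
  by have [] := dK x (lt_le_trans N10 x0).
have cDx x : -1 < x -> {for x, continuous D}.
  move=> x1; apply: cvgB; first by apply: cvgB; [exact: cF|exact: cvg_cst].
  by apply: cvgB; [exact: cK|exact: cvg_cst].
have cDw : {within `[0, T], continuous D}.
  apply: continuous_in_subspaceT => x; rewrite inE/= in_itv/= => /andP[x0 _].
  by apply: cDx; exact: lt_le_trans x0.
have weakD (a da : R -> R) : smooth a -> compact_supp a ->
    (forall x, is_derive x 1 a (da x)) -> continuous da ->
    \int[mu]_(t in `[0, T]) (da t * D t) = a T * D T.
  move=> Sa ca daE cda.
  have ca0 := Sa 0%N.
  have i1 : mu.-integrable `[0, T] (EFin \o (fun t => da t * F t)).
    apply: continuous_integrable_itv; apply: continuous_subspaceT => x.
    by apply: cvgM; [exact: cda|exact: cF].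
  pose H t := F 0 + (K t - K 0).
  have cHx x : -1 < x -> {for x, continuous H}.
    move=> x1; apply: cvgD; first exact: cvg_cst.
    by apply: cvgB; [exact: cK|exact: cvg_cst].
  have i2 : mu.-integrable `[0, T] (EFin \o (fun t => da t * H t)).
    apply: continuous_integrable_itv; apply: continuous_in_subspaceT => x.
    rewrite inE/= in_itv/= => /andP[x0 _].
    by apply: cvgM; [exact: cda|apply: cHx; exact: lt_le_trans x0].
  have i3 : mu.-integrable `[0, T] (EFin \o (fun t => a t * k t)).
    apply: continuous_integrable_itv; apply: continuous_subspaceT => x.
    by apply: cvgM; [exact: ca0|exact: ck].
  have ftc : \int[mu]_(t in `[0, T]) (a t * k t + da t * H t) = a T * H T - a 0 * H 0.
    apply: (Rint_FTC (F := fun t => a t * H t)) => //.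
    - apply: continuous_in_subspaceT => x; rewrite inE/= in_itv/= => /andP[x0 _].
      apply: cvgD; first by apply: cvgM; [exact: ca0|exact: ck].
      by apply: cvgM; [exact: cda|apply: cHx; exact: lt_le_trans x0].
    - apply: continuous_in_subspaceT => x; rewrite inE/= in_itv/= => /andP[x0 _].
      by apply: cvgM; [exact: ca0|apply: cHx; exact: lt_le_trans x0].
    - move=> x; rewrite in_itv/= => /andP[x0 _].
      have dH : is_derive x 1 H (0 + (k x - 0)).
        have dKx := dK x (lt_trans N10 x0).
        exact: (is_deriveD (is_derive_cst (F 0) x 1) (is_deriveB dKx (is_derive_cst (K 0) x 1))).
      apply: (is_derive_eq (is_deriveM (daE x) dH)).
      by rewrite /GRing.scale/= add0r subr0 [H x * _]mulrC.
  rewrite (_ : (fun t => da t * D t) = (fun t => da t * F t - da t * H t)); last first.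
    by apply/funext => r; rewrite /D /H; ring.
  rewrite RintegralB// weak//.
  rewrite RintegralD// in ftc.
  have -> : D T = F T - H T by rewrite /D /H; ring.
  have H0 : H 0 = F 0 by rewrite /H subrr addr0.
  rewrite H0 in ftc; lra.
(* Multiplying [a] by a cutoff that is 1 around [[0, T]] lifts the condition on the support. *)
have weakD' (a da : R -> R) : smooth a -> (forall x, is_derive x 1 a (da x)) ->
    continuous da -> \int[mu]_(t in `[0, T]) (da t * D t) = a T * D T.
  move=> Sa daE cda.
  pose c := cutoff (T + 1).
  have [dc dcE Sdc] := smooth_derive (smooth_cutoff (T + 1)).
  have c1 x : 0 <= x -> x <= T -> c x = 1.
    by move=> x0 xT; rewrite /c cutoff1// ger0_norm// (le_trans xT)// lerDl.
  have dc0 x : 0 <= x -> x <= T -> dc x = 0.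
    move=> x0 xT.
    have Hc : \forall z \near x, (cst 1 : R -> R) z = c z.
      near=> z; rewrite /c cutoff1// ler_norml; apply/andP; split; apply: ltW.
        by near: z; apply: lt_nbhsr; lra.
      by near: z; apply: lt_nbhsl; lra.
    have H : is_derive x 1 (cst (1 : R)) (0 : R) by exact: is_derive_cst.
    exact: is_derive_uniq (dcE x) (near_eq_is_derive Hc H).
  have := weakD (fun x => a x * c x) (fun x => a x * dc x + c x * da x).
  have cT : c T = 1 by rewrite c1// ltW.
  rewrite cT mulr1 => <-.
  - apply: eq_Rintegral => r; rewrite inE/= in_itv/= => /andP[r0 rT].
    by rewrite dc0// c1// mulr0 add0r mul1r.
  - by apply: smooth_mul => //; exact: smooth_cutoff.
  - exists (T + 1 + 1) => x Hx; rewrite /c cutoff0 ?mulr0//.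
  - move=> x; apply: cvgD; first by apply: cvgM; [exact: (Sa 0%N)|exact: (Sdc 0%N)].
    by apply: cvgM; [exact: (smooth_cutoff _ 0%N)|exact: cda].
have DT : D T = 0.
  have := weakD' (cst 1) (cst 0) (fun n : nat => smooth_upto_cst n 1)
    (fun x => is_derive_cst _ _ _) (fun x => cvg_cst _).
  by rewrite mul1r => <-; under eq_Rintegral do rewrite mul0r; rewrite Rintegral_cst// mul0r.
move=> tT; apply/eqP; rewrite -subr_eq0 -/(D t); apply/eqP.
move: tT; rewrite in_itv/= => /andP[t0]; rewrite le_eqVlt => /predU1P[->//|tT].
have [ds [dds [C C0 [dsE _ Sds dsC ds0]]]] := step_smooth_derivatives.
apply/eqP; rewrite -normr_eq0 eq_le normr_ge0 andbT; apply/ler_addgt0Pl => e e0.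
rewrite addr0.
(* The derivative of the ramp is at most [C / r] on an interval of length [r], so a variation
   [e / C] of [D] contributes at most [e]. *)
have eC : 0 < e / C by rewrite divr_gt0.
have /cvgrPdist_lt /(_ _ eC) /nbhs_ballP [d /= d0 Hd] : {for t, continuous D}.
  by apply: cDx; exact: lt_le_trans t0.
pose r := Num.min (d / 2) (T - t).
have r0 : 0 < r by rewrite lt_min divr_gt0//= subr_gt0.
have rT : t + r <= T by rewrite -lerBrDl ge_min lexx orbT.
have rd : r < d by rewrite (@le_lt_trans _ _ (d / 2))// ?ge_min ?lexx//; lra.
(* A ramp from 0 to 1 over [[t, t + r]], inside [[0, T]]: its derivative has integral 1 and
   concentrates at [t]. *)
pose a x : R := step (r^-1 * x + - (t / r)).
pose da x : R := r^-1 * ds (r^-1 * x + - (t / r)).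
have aE x : r^-1 * x + - (t / r) = (x - t) / r by rewrite mulrC -mulrBl.
have Sa : smooth a by apply: smooth_affine_comp; exact: smooth_step.
have daE x : is_derive x 1 a (da x) by exact: is_derive_affine_comp.
have cda : continuous da.
  have S1 := smooth_affine_comp r^-1 (- (t / r)) Sds.
  by move=> x; apply: cvgM; [exact: cvg_cst|exact: (S1 0%N)].
have := weakD' a da Sa daE cda; rewrite DT mulr0 => wD.
have i1 : mu.-integrable `[0, T] (EFin \o (fun s => da s * D s)).
  apply: continuous_integrable_itv; apply: continuous_in_subspaceT => x.
  rewrite inE/= in_itv/= => /andP[x0 _].
  by apply: cvgM; [exact: cda|apply: cDx; exact: lt_le_trans x0].
have i2 : mu.-integrable `[0, T] (EFin \o (fun s => da s * D t)).
  apply: continuous_integrable_itv; apply: continuous_subspaceT => x.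
  by apply: cvgM; [exact: cda|exact: cvg_cst].
have int_da : \int[mu]_(s in `[0, T]) da s = 1.
  rewrite (Rint_FTC (F := a))//.
  - rewrite /a !aE step1; last by rewrite ler_pdivlMr// mul1r lerBrDl.
    by rewrite step0 ?subr0// pmulr_lle0 ?invr_gt0// subr_le0.
  - exact: continuous_subspaceT.
  - by apply: continuous_subspaceT; exact: (Sa 0%N).
have key : D t = - \int[mu]_(s in `[0, T]) (da s * (D s - D t)).
  under eq_Rintegral do rewrite mulrBr.
  rewrite RintegralB// wD sub0r opprK RintegralZr//; last first.
    by apply: continuous_integrable_itv; exact: continuous_subspaceT.
  by rewrite int_da mul1r.
rewrite key normrN.
have i3 : mu.-integrable `[0, T] (EFin \o (fun s => da s * (D s - D t))).
  rewrite (_ : _ \o _ = (fun s => (da s * D s)%:E - (da s * D t)%:E)%E).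
    exact: integrableB.
  by apply/funext => s /=; rewrite mulrBr EFinB.
rewrite (le_trans (le_normr_Rintegral _ i3))//.
have mI : measurable (`[t, t + r]%classic : set R) by exact: measurable_itv.
have iI : mu.-integrable `[0, T] (EFin \o (fun s => (e / r) * \1_(`[t, t + r]) s)).
  rewrite (_ : _ \o _ = (fun s => (e / r)%:E * (\1_(`[t, t + r]%classic) s)%:E)%E)//.
  apply: integrableZl => //; apply: (integrableS measurableT) => //.
  exact: integrable_indic_itv.
apply: (@le_trans _ _ (\int[mu]_(s in `[0, T]) ((e / r) * \1_(`[t, t + r]) s))).
  apply: le_Rintegral => //.
    by rewrite (_ : _ \o _ = (fun s => `|(da s * (D s - D t))%:E|%E))//; exact: integrable_abse.
  move=> s _; rewrite normrM indicE.
  have [st|st] := boolP (s \in `[t, t + r]%classic); last first.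
    rewrite /da aE (proj1 (ds0 _ _)) ?mulr0 ?normr0 ?mul0r//.
    move: st; rewrite notin_setE /= in_itv/= => /negP; rewrite negb_and -!ltNge => /orP[h|h].
      by left; rewrite pmulr_llt0 ?invr_gt0// subr_lt0.
    by right; rewrite ltr_pdivlMr// mul1r ltrBrDl.
  have : `|D s - D t| < e / C.
    rewrite distrC; apply: Hd; move: st; rewrite inE/= in_itv/= => /andP[s1 s2].
    rewrite /ball/= distrC ger0_norm ?subr_ge0//.
    by rewrite ltrBlDl (le_lt_trans s2)// ltrD2l.
  move=> /ltW h; rewrite mulr1 /da normrM gtr0_norm ?invr_gt0//.
  rewrite (@le_trans _ _ (r^-1 * C * (e / C)))//.
    by rewrite ler_pM// ?mulr_ge0 ?invr_ge0 ?(ltW r0)// ler_wpM2l ?invr_ge0 ?(ltW r0)//; exact: (dsC _).1.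
  by rewrite le_eqVlt; apply/orP; left; apply/eqP; field; rewrite !gt_eqF.
rewrite RintegralZl//; last first.
  by apply: (integrableS measurableT) => //; exact: integrable_indic_itv.
rewrite /Rintegral integral_indic// (_ : _ `&` _ = `[t, t + r]%classic); last first.
  apply/setIidl => s /=; rewrite !in_itv/= => /andP[s1 s2].
  by rewrite (le_trans t0 s1) (le_trans s2 rT).
have muI : mu `[t, t + r]%classic = r%:E.
  by rewrite lebesgue_measure_itv/= lte_fin ltrDl r0 -EFinB addrC addKr.
rewrite [X in fine X](_ : _ = r%:E); last exact: muI.
by rewrite /= divfK// gt_eqF.
Unshelve. all: by end_near. Qed.

End Calculus.

(** * The weak equation tested against a function of space *)

Section WeakToMild.
Context {R : realType}.
Local Notation mu := (@lebesgue_measure R).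
Implicit Types (h : R -> R) (s t x c : R).

Lemma L2_abs h : L2 h -> L2 (fun x => `|h x|).
Proof.
move=> Lh; apply: (L2_le _ Lh); last by move=> x; rewrite normr_id.
exact: (measurableT_comp (@normr_measurable R setT) Lh.1).
Qed.

Lemma L2_compact_supp h : continuous h -> compact_supp h -> L2 h.
Proof.
move=> ch [M hM]; split; first exact: continuous_measurable_fun.
have -> : EFin \o (fun x => h x ^+ 2) = (EFin \o (fun x => h x ^+ 2)) \_ `[- M, M]%classic.
  apply/funext => x; rewrite patchE; case: ifPn => //.
  rewrite notin_setE /= in_itv/= => /negP H; rewrite hM ?expr0n//.
  by rewrite leNgt; apply: contra H => /ltW; rewrite ler_norml.
have mI : measurable (`[- M, M]%classic : set (measurableTypeR R)) by exact: measurable_itv.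
apply: (iffLR (@integrable_mkcond _ (measurableTypeR R) R mu _ (EFin \o (fun x => h x ^+ 2)) mI)).
apply: continuous_integrable_itv; apply: continuous_subspaceT => x.
by apply: (cvg_comp h (fun y : R => y ^+ 2)); [exact: ch|exact: exprn_continuous].
Qed.

Lemma ip_cvg (w : R -> R) (h_ : nat -> R -> R) h : L2 w -> (forall n, L2 (h_ n)) -> L2 h ->
  nrm (fun x => h_ n x - h x) @[n --> \oo] --> (0 : R) ->
  ip w (h_ n) @[n --> \oo] --> ip w h.
Proof.
move=> Lw Lh_ Lh H; apply/cvgrPdist_le => e e0.
have e1 : 0 < e / (nrm w + 1) by rewrite divr_gt0// ltr_wpDl ?nrm_ge0.
move/cvgrPdist_lt : H => /(_ _ e1); apply: filterS => n.
rewrite sub0r normrN ger0_norm ?nrm_ge0// => hn.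
rewrite distrC -ipBr// (le_trans (cauchy_schwarz Lw (L2B (Lh_ n) Lh)))//.
rewrite (@le_trans _ _ ((nrm w + 1) * (e / (nrm w + 1))))//.
  by rewrite ler_pM ?nrm_ge0 ?lerDl// ltW.
by rewrite mulrCA divff ?mulr1// gt_eqF// ltr_wpDl ?nrm_ge0.
Qed.

(** The two ramps of [cutoff n] are a translate and a reflected translate of [step]: the bounds do
    not depend on [n], and the ramps eventually leave every given point. *)
Lemma cutoff_derivatives : exists dX ddX : nat -> R -> R, exists2 C : R, 0 < C &
  [/\ forall n (x : R), is_derive x 1 (cutoff n%:R) (dX n x),
      forall n (x : R), is_derive x 1 (dX n) (ddX n x),
      forall n x, `|dX n x| <= C /\ `|ddX n x| <= C &
      forall x, \forall n \near \oo, dX n x = 0 /\ ddX n x = 0].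
Proof.
have [ds [dds [C C0 [dsE ddsE Sds bd z0]]]] := @step_smooth_derivatives R.
pose l n x : R := 1 * x + (n%:R + 1).
pose r n x : R := -1 * x + (n%:R + 1).
pose dX n x : R := step (l n x) * (-1 * ds (r n x)) + step (r n x) * (1 * ds (l n x)).
pose ddX n x : R := (step (l n x) * (-1 * (-1 * dds (r n x))) +
    (-1 * ds (r n x)) * (1 * ds (l n x))) +
  (step (r n x) * (1 * (1 * dds (l n x))) + (1 * ds (l n x)) * (-1 * ds (r n x))).
have d1 n x : is_derive x 1 (fun y => step (l n y)) (1 * ds (l n x)).
  exact: is_derive_affine_comp.
have d2 n x : is_derive x 1 (fun y => step (r n y)) (-1 * ds (r n x)).
  exact: is_derive_affine_comp.
have d3 n x : is_derive x 1 (fun y => ds (l n y)) (1 * dds (l n x)).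
  exact: is_derive_affine_comp.
have d4 n x : is_derive x 1 (fun y => ds (r n y)) (-1 * dds (r n x)).
  exact: is_derive_affine_comp.
exists dX, ddX; exists (2 * C + 2 * C ^+ 2).
  by rewrite addr_gt0// mulr_gt0// exprn_gt0.
have b1 (y z : R) : `|step y * z| <= `|z|.
  rewrite normrM ler_piMl//; have /andP[h0 h1] := step_itv y.
  by rewrite ger0_norm.
have b2 (y z : R) : `|ds y * ds z| <= C ^+ 2.
  by rewrite normrM expr2 ler_pM//; [exact: (bd y).1|exact: (bd z).1].
split.
- move=> n x; rewrite (_ : cutoff n%:R = (fun y => step (l n y) * step (r n y))).
    exact: (is_deriveM (d1 n x) (d2 n x)).
  by apply/funext => y; rewrite /cutoff /l /r; congr (step _ * step _); ring.
- move=> n x.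
  have e1 := is_deriveM (d1 n x) (is_deriveM (is_derive_cst (-1 : R) x 1) (d4 n x)).
  have e2 := is_deriveM (d2 n x) (is_deriveM (is_derive_cst (1 : R) x 1) (d3 n x)).
  by apply: (is_derive_eq (is_deriveD e1 e2)); rewrite /ddX /GRing.scale/= !fctE; ring.
- move=> n x; split; rewrite /dX /ddX !mul1r !mulN1r ?opprK.
    rewrite (le_trans (ler_normD _ _))// (@le_trans _ _ (C + C))//.
      rewrite lerD// (le_trans (b1 _ _))// ?normrN; [exact: (bd _).1|exact: (bd _).1].
    by rewrite mulr_natl mulr2n lerDl mulr_ge0// sqr_ge0.
  rewrite (le_trans (ler_normD _ _))// (@le_trans _ _ ((C + C ^+ 2) + (C + C ^+ 2)))//.
    rewrite lerD// (le_trans (ler_normD _ _))// lerD//.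
    + by rewrite (le_trans (b1 _ _))//; exact: (bd _).2.
    + by rewrite mulNr normrN.
    + by rewrite (le_trans (b1 _ _))//; exact: (bd _).2.
    + by rewrite mulrN normrN.
  by rewrite le_eqVlt; apply/orP; left; apply/eqP; ring.
- move=> x; near=> n.
  have nx : `|x| < n%:R by near: n; exact: nbhs_infty_gtr.
  move: nx; rewrite ltr_norml => /andP[x1 x2].
  have [zl zzl] : ds (l n x) = 0 /\ dds (l n x) = 0.
    by apply: z0; right; rewrite /l; lra.
  have [zr zzr] : ds (r n x) = 0 /\ dds (r n x) = 0.
    by apply: z0; right; rewrite /r; lra.
  by rewrite /dX /ddX zl zzl zr zzr !(mulr0, mul0r, addr0).
Unshelve. all: by end_near. Qed.

Variables (T : R) (f b : R -> R) (u : R -> R -> R).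
Hypotheses (T0 : 0 < T) (cu : L2_curve u) (cb : continuous b) (Lf : L2 f).
Hypothesis fu0 : {ae mu, forall x, u 0 x = f x}.
Hypothesis weak : weak_pde T f b u.

Definition killed t x : R := \1_(`]-oo, b t]) x * u t x.

Lemma L2_curve_killed : L2_curve killed.
Proof. exact: L2_curve_cut. Qed.

Lemma weak_tensor (a da h dh ddh : R -> R) : smooth a -> compact_supp a ->
  (forall x : R, is_derive x 1 a (da x)) -> smooth h -> compact_supp h ->
  (forall x : R, is_derive x 1 h (dh x)) -> (forall x : R, is_derive x 1 dh (ddh x)) ->
  L2 ddh ->
  \int[mu]_(t in `[0, T]) (da t * ip (u t) h) =
  a T * ip (u T) h - a 0 * ip (u 0) h -
  \int[mu]_(t in `[0, T]) (a t * (2^-1 * ip (u t) ddh - ip (killed t) h)).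
Proof.
move=> Sa [Ma Ha] daE Sh ch dhE ddhE Lddh; have [Mh Hh] := ch.
have Lh : L2 h by apply: L2_compact_supp => //; exact: (Sh 0%N).
have cg := L2_curve_killed.
pose phi (p : R^o * R^o) : R := a p.1 * h p.2.
have tphi : test_function phi.
  apply: (@test_function_tensor _ a h (Num.max Ma Mh)) => // x; rewrite ge_max => /andP[h1 h2].
    exact: Ha.
  exact: Hh.
have D1 t x : 'D_(1, 0) phi (t, x) = da t * h x.
  have [_ ->] := @is_derive_tensor _ a h da dh (t, x) (1, 0) (daE t) (dhE x).
  by rewrite /= mul1r mul0r addr0.
have D2 : derive phi ^~ (0, 1) = (fun p : R^o * R^o => a p.1 * dh p.2).
  apply/funext => p.
  have [_ ->] := @is_derive_tensor _ a h da dh p (0, 1) (daE p.1) (dhE p.2).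
  by rewrite /= mul1r mul0r add0r.
have D3 t x : 'D_(0, 1) ('D_(0, 1) phi) (t, x) = a t * ddh x.
  rewrite D2.
  have [_ ->] := @is_derive_tensor _ a dh da ddh (t, x) (0, 1) (daE t) (ddhE x).
  by rewrite /= mul1r mul0r add0r.
have pull (w k : R -> R) (c : R) : L2 w -> L2 k ->
    \int[mu]_x (w x * (c * k x)) = c * ip w k.
  by move=> Lw Lk; rewrite -ipZr.
have ED1 : \int[mu]_(t in `[0, T]) (\int[mu]_x (u t x * 'D_(1, 0) phi (t, x))) =
          \int[mu]_(t in `[0, T]) (da t * ip (u t) h).
  apply: eq_Rintegral => t _; rewrite -pull//; last exact: cu.1.
  by apply: eq_Rintegral => x _; rewrite D1.
have ED3 : \int[mu]_(t in `[0, T]) (\int[mu]_x (u t x * 'D_(0, 1) ('D_(0, 1) phi) (t, x))) =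
          \int[mu]_(t in `[0, T]) (a t * ip (u t) ddh).
  apply: eq_Rintegral => t _; rewrite -pull//; last exact: cu.1.
  by apply: eq_Rintegral => x _; rewrite D3.
have Ek : \int[mu]_(t in `[0, T]) (\int[mu]_x (\1_(`]-oo, b t]) x * u t x * phi (t, x))) =
          \int[mu]_(t in `[0, T]) (a t * ip (killed t) h).
  by apply: eq_Rintegral => t _; rewrite -pull//; exact: cg.1.
have ET : \int[mu]_x (u T x * phi (T, x)) = a T * ip (u T) h.
  by rewrite -pull//; exact: cu.1.
have E0 : \int[mu]_x (f x * phi (0, x)) = a 0 * ip (u 0) h.
  rewrite -pull//; last exact: cu.1.
  rewrite /Rintegral; congr fine; apply: ae_eq_integral => //.
  - apply/measurable_EFinP; apply: measurable_funM; first exact: Lf.1.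
    exact: (measurable_funM (measurable_cst (a 0)) Lh.1).
  - apply/measurable_EFinP; apply: measurable_funM; first exact: (cu.1 0).1.
    exact: (measurable_funM (measurable_cst (a 0)) Lh.1).
  - by apply: ae_sub fu0 => x xE _; rewrite /= xE.
have ca := Sa 0%N.
have i1 : mu.-integrable `[0, T] (EFin \o (fun t => a t * ip (u t) ddh)).
  apply: continuous_integrable_itv; apply: continuous_subspaceT => t.
  by apply: cvgM; [exact: ca|exact: (L2_curve_ip cu Lddh)].
have i2 : mu.-integrable `[0, T] (EFin \o (fun t => a t * ip (killed t) h)).
  apply: continuous_integrable_itv; apply: continuous_subspaceT => t.
  by apply: cvgM; [exact: ca|exact: (L2_curve_ip cg Lh)].
have -> : \int[mu]_(t in `[0, T]) (da t * ip (u t) h) = a T * ip (u T) h - a 0 * ip (u 0) h -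
    2^-1 * \int[mu]_(t in `[0, T]) (a t * ip (u t) ddh) +
    \int[mu]_(t in `[0, T]) (a t * ip (killed t) h).
  apply: etrans (esym ED1) _; apply: (etrans (weak tphi)).
  by congr (_ - _ - _ * _ + _).
have -> : (fun t => a t * (2^-1 * ip (u t) ddh - ip (killed t) h)) =
    (fun t => 2^-1 * (a t * ip (u t) ddh) - a t * ip (killed t) h).
  by apply/funext => t; ring.
rewrite RintegralB//.
  rewrite RintegralZl//; move: (Rintegral _ _ _) (Rintegral _ _ _) (ip _ _) (ip _ _).
  by move=> I1 I2 j1 j2; ring.
by rewrite (_ : _ \o _ = (fun t => (2^-1)%:E * (a t * ip (u t) ddh)%:E)%E)//; exact: integrableZl.
Qed.

Lemma weak_time_compact (h dh ddh : R -> R) : smooth h -> compact_supp h ->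
  (forall x : R, is_derive x 1 h (dh x)) -> (forall x : R, is_derive x 1 dh (ddh x)) ->
  L2 ddh -> forall t, t \in `[0, T] ->
  ip (u t) h = ip (u 0) h +
    \int[mu]_(s in `[0, t]) (2^-1 * ip (u s) ddh - ip (killed s) h).
Proof.
move=> Sh ch dhE ddhE Lddh.
have Lh : L2 h by apply: L2_compact_supp => //; exact: (Sh 0%N).
apply: (du_bois_reymond (F := fun t => ip (u t) h)
  (k := fun s => 2^-1 * ip (u s) ddh - ip (killed s) h) T0).
- exact: L2_curve_ip.
- move=> s; apply: cvgB; last exact: (L2_curve_ip L2_curve_killed Lh).
  by apply: cvgM; [exact: cvg_cst|exact: (L2_curve_ip cu Lddh)].
- by move=> a da Sa ca daE _; exact: (weak_tensor Sa ca daE Sh ch dhE ddhE Lddh).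
Qed.

(** The compact support of [h] is removed by cutoffs, whose first two derivatives are uniformly
    bounded and vanish in the limit. Both [hn n] and [ddhn n] then converge in L^2, and the time
    integrals converge by domination. *)
Lemma weak_time (h dh ddh : R -> R) : smooth h ->
  (forall x : R, is_derive x 1 h (dh x)) -> (forall x : R, is_derive x 1 dh (ddh x)) ->
  L2 h -> L2 dh -> L2 ddh -> forall t, t \in `[0, T] ->
  ip (u t) h = ip (u 0) h +
    \int[mu]_(s in `[0, t]) (2^-1 * ip (u s) ddh - ip (killed s) h).
Proof.
move=> Sh dhE ddhE Lh Ldh Lddh t tT.
have [dX [ddX [C C0 [dXE ddXE bd X0]]]] := cutoff_derivatives.
have cg := L2_curve_killed.
pose X n := cutoff n%:R : R -> R.
have mX n : measurable_fun setT (X n).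
  by apply: continuous_measurable_fun; exact: (smooth_cutoff _ 0%N).
have mdX n : measurable_fun setT (dX n).
  exact: continuous_measurable_fun (is_derive_continuous (ddXE n)).
(* The next derivative of the cutoff makes [ddX n] continuous, hence measurable. *)
have [SX dXsm] : True /\ forall n, exists2 d3 : R -> R, forall x : R, is_derive x 1 (ddX n) (d3 x) & True.
  split => // n.
  have [d1 d1E Sd1] := smooth_derive (smooth_cutoff (n%:R : R)).
  have [d2 d2E Sd2] := smooth_derive Sd1.
  have [d3 d3E _] := smooth_derive Sd2.
  have E1 : dX n = d1 by apply/funext => x; exact: is_derive_uniq (dXE n x) (d1E x).
  have E2 : ddX n = d2.
    apply/funext => x; have H := ddXE n x; rewrite E1 in H.
    exact: is_derive_uniq H (d2E x).
  by exists d3 => // x; rewrite E2.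
have mddX n : measurable_fun setT (ddX n).
  have [d3 d3E _] := dXsm n.
  exact: continuous_measurable_fun (is_derive_continuous d3E).
have X1 n x : `|X n x| <= 1.
  by have /andP[h0 h1] := cutoff_itv (n%:R : R) x; rewrite /X ger0_norm.
pose hn n x := X n x * h x.
pose dhn n x := X n x * dh x + h x * dX n x.
pose ddhn n x := (X n x * ddh x + dh x * dX n x) + (h x * ddX n x + dX n x * dh x).
have hnE n x : is_derive x 1 (hn n) (dhn n x) by exact: (is_deriveM (dXE n x) (dhE x)).
have dhnE n x : is_derive x 1 (dhn n) (ddhn n x).
  exact: (is_deriveD (is_deriveM (dXE n x) (ddhE x)) (is_deriveM (dhE x) (ddXE n x))).
have Shn n : smooth (hn n) by apply: smooth_mul => //; exact: smooth_cutoff.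
have chn n : compact_supp (hn n).
  by exists (n%:R + 1) => x Hx; rewrite /hn /X cutoff0 ?mul0r.
have Lhn n : L2 (hn n) by exact: (L2_Mbounded (mX n) (X1 n)).
(* A square-integrable bound for all [ddhn n] and for their distance to [ddh]; the factor 2 counts
   the two cross terms of the Leibniz rule. *)
pose G x := `|ddh x| + (2 * C * `|dh x| + C * `|h x|).
have LG : L2 G.
  by apply: L2D; [exact: L2_abs|apply: L2D; apply: L2Z; exact: L2_abs].
have mddhn n : measurable_fun setT (ddhn n).
  apply: measurable_funD.
    by apply: measurable_funD; apply: measurable_funM => //; [exact: Lddh.1|exact: Ldh.1].
  by apply: measurable_funD; apply: measurable_funM => //; [exact: Lh.1|exact: Ldh.1].
have G0 x : 0 <= G x by rewrite !addr_ge0// !mulr_ge0// ltW.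
have bdd n x (c : R) : `|c| <= 1 ->
    `|c * ddh x + (dh x * dX n x + (h x * ddX n x + dX n x * dh x))| <= `|G x|.
  move=> c1; rewrite [leRHS]ger0_norm// (le_trans (ler_normD _ _))// lerD//.
    by rewrite normrM ler_piMl.
  rewrite (@le_trans _ _ (C * `|dh x| + (C * `|h x| + C * `|dh x|)))//.
    rewrite (le_trans (ler_normD _ _))// lerD//.
      by rewrite normrM mulrC ler_wpM2r//; exact: (bd n x).1.
    rewrite (le_trans (ler_normD _ _))// lerD//.
      by rewrite normrM mulrC ler_wpM2r//; exact: (bd n x).2.
    by rewrite normrM ler_wpM2r//; exact: (bd n x).1.
  by rewrite le_eqVlt; apply/orP; left; apply/eqP; ring.
have ddhn_le n x : `|ddhn n x| <= `|G x|.
  by rewrite /ddhn -addrA; exact: bdd.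
have Lddhn n : L2 (ddhn n) by exact: (L2_le (mddhn n) LG).
have Xnear x : \forall n \near \oo, X n x = 1.
  near=> n; rewrite /X cutoff1//; near: n; exact: nbhs_infty_ger.
have cvh : nrm (fun x => hn n x - h x) @[n --> \oo] --> (0 : R).
  apply: (L2_dominated_cvg (g := h)) => //.
  - by move=> n; exact: (Lhn n).1.
  - exact: Lh.1.
  - move=> n x; rewrite /hn -[X in _ - X]mul1r -mulrBl normrM ler_piMl//.
    have /andP[h0 h1] := cutoff_itv (n%:R : R) x; rewrite /X.
    by rewrite ler_norml; apply/andP; split; lra.
  - apply: (aeW mu) => x; apply: cvg_near_cst.
    by apply: filterS (Xnear x) => n Xn; rewrite /hn Xn mul1r.
have cvddh : nrm (fun x => ddhn n x - ddh x) @[n --> \oo] --> (0 : R).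
  apply: (L2_dominated_cvg (g := G)) => //.
  - exact: Lddh.1.
  - move=> n x; rewrite (_ : _ - _ = (X n x - 1) * ddh x +
      (dh x * dX n x + (h x * ddX n x + dX n x * dh x))); last by rewrite /ddhn; ring.
    apply: bdd; have /andP[h0 h1] := cutoff_itv (n%:R : R) x; rewrite /X.
    by rewrite ler_norml; apply/andP; split; lra.
  - apply: (aeW mu) => x; apply: cvg_near_cst; near=> n.
    have Xn : X n x = 1 by near: n; exact: Xnear.
    have [z1 z2] : dX n x = 0 /\ ddX n x = 0 by near: n; exact: X0.
    by rewrite /ddhn Xn z1 z2 !(mul1r, mulr0, mul0r, addr0).
have Lu s : L2 (u s) := cu.1 s.
have Lg s : L2 (killed s) := cg.1 s.
pose kn n s := 2^-1 * ip (u s) (ddhn n) - ip (killed s) (hn n).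
pose k s := 2^-1 * ip (u s) ddh - ip (killed s) h.
have ckn n : continuous (kn n).
  move=> s; apply: cvgB; last exact: (L2_curve_ip cg (Lhn n)).
  by apply: cvgM; [exact: cvg_cst|exact: (L2_curve_ip cu (Lddhn n))].
have ck : continuous k.
  move=> s; apply: cvgB; last exact: (L2_curve_ip cg Lh).
  by apply: cvgM; [exact: cvg_cst|exact: (L2_curve_ip cu Lddh)].
have lim1 : ip (u t) (hn n) @[n --> \oo] --> ip (u t) h by exact: ip_cvg.
have lim0 : ip (u 0) (hn n) @[n --> \oo] --> ip (u 0) h by exact: ip_cvg.
have limk : \int[mu]_(s in `[0, t]) kn n s @[n --> \oo] --> \int[mu]_(s in `[0, t]) k s.
  apply: (@Rintegral_dominated_cvg _ (measurableTypeR R) R mu `[0, t]%classic kn k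
    (fun s => 2^-1 * (nrm (u s) * nrm G) + nrm (killed s) * nrm h)).
  - exact: measurable_itv.
  - by move=> n; apply: measurable_funTS; exact: continuous_measurable_fun.
  - by apply: measurable_funTS; exact: continuous_measurable_fun.
  - apply: continuous_integrable_itv; apply: continuous_subspaceT => s.
    apply: cvgD; apply: cvgM; try exact: cvg_cst.
      by apply: cvgM; [exact: L2_curve_nrm|exact: cvg_cst].
    exact: L2_curve_nrm.
  - move=> n s _; rewrite (le_trans (ler_normB _ _))// lerD//.
      rewrite normrM ger0_norm ?invr_ge0// ler_wpM2l ?invr_ge0//.
      rewrite (le_trans (cauchy_schwarz (Lu s) (Lddhn n)))// ler_wpM2l ?nrm_ge0//.
      by apply: nrm_le => //.
    rewrite (le_trans (cauchy_schwarz (Lg s) (Lhn n)))// ler_wpM2l ?nrm_ge0//.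
    apply: nrm_le => //; first exact: (Lhn n).1.
    by move=> x; rewrite /hn normrM ler_piMl.
  - apply: (aeW mu) => s _; apply: cvgB; last exact: ip_cvg.
    by apply: cvgM; [exact: cvg_cst|exact: ip_cvg].
have E n : ip (u t) (hn n) = ip (u 0) (hn n) + \int[mu]_(s in `[0, t]) kn n s.
  exact: (weak_time_compact (Shn n) (chn n) (hnE n) (dhnE n) (Lddhn n) tT).
have lim2 : ip (u t) (hn n) @[n --> \oo] --> ip (u 0) h + \int[mu]_(s in `[0, t]) k s.
  by under eq_fun do rewrite E; exact: cvgD lim0 limk.
exact: (cvg_unique _ lim1 lim2).
Unshelve. all: by end_near. Qed.

End WeakToMild.

(** * Derivatives of the heat kernel and their bounds *)

Section HeatKernelDerivatives.
Context {R : realType}.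
Local Notation mu := (@lebesgue_measure R).
Implicit Types (s t x y z c : R).

(** The derivative in [x] of [hk t (y - x)] at [z = y - x], whence the positive sign. *)
Definition dhk t z : R := z / t * hk t z.

Definition ddhk t z : R := (z ^+ 2 / t ^+ 2 - t^-1) * hk t z.

Lemma hk_exp t z : hk t z = (Num.sqrt (t * pi *+ 2))^-1 * expR (- z ^+ 2 / (t *+ 2)).
Proof. by []. Qed.

Lemma is_derive_reflect y x : is_derive x 1 (fun x => y - x) (-1 : R).
Proof.
have H := is_deriveB (is_derive_cst y x 1) (is_derive_id x 1).
by apply: (is_derive_eq H); rewrite sub0r.
Qed.

Lemma is_derive_hk_space t y x : t != 0 ->
  is_derive x 1 (fun x => hk t (y - x)) (dhk t (y - x)).
Proof.
move=> t0.
have d1 := is_derive_reflect y x.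
have d2 := is_deriveM d1 d1.
have d3 := is_deriveM (is_derive_cst (- (t *+ 2)^-1 : R) x 1) d2.
have d4 := @is_derive_comp1 _ expR
  (cst (- (t *+ 2)^-1) * ((fun x => y - x) * (fun x => y - x))) x _ _ (is_derive_expR _) d3.
have d5 := is_deriveM (is_derive_cst ((Num.sqrt (t * pi *+ 2))^-1 : R) x 1) d4.
rewrite (_ : (fun x => hk t (y - x)) =
  (cst ((Num.sqrt (t * pi *+ 2))^-1) * (expR \o
     (cst (- (t *+ 2)^-1) * ((fun x => y - x) * (fun x => y - x)))))); last first.
  apply/funext => z; rewrite !fctE /= hk_exp; congr (_ * expR _).
  by rewrite expr2 mulNr mulrC mulNr.
apply: (is_derive_eq d5).
rewrite /GRing.scale/= !fctE !mulr0 !addr0 /dhk hk_exp.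
have -> : - (t *+ 2)^-1 * ((y - x) * (y - x)) = - (y - x) ^+ 2 / (t *+ 2).
  by rewrite expr2 mulNr mulrC mulNr.
by move: (Num.sqrt _)^-1 => C; set E := expR _; field.
Qed.

Lemma is_derive_dhk_space t y x : t != 0 ->
  is_derive x 1 (fun x => dhk t (y - x)) (ddhk t (y - x)).
Proof.
move=> t0.
have d1 := is_deriveM (is_derive_cst (t^-1 : R) x 1) (is_derive_reflect y x).
have d2 := is_deriveM d1 (is_derive_hk_space y x t0).
rewrite (_ : (fun x => dhk t (y - x)) =
   (cst t^-1 * (fun x => y - x)) * (fun x => hk t (y - x))); last first.
  by apply/funext => z; rewrite !fctE /dhk /=; rewrite [t^-1 * _]mulrC.
apply: (is_derive_eq d2); rewrite /GRing.scale/= !fctE /ddhk /dhk.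
by field.
Qed.

Lemma smooth_hk t y : smooth (fun x => hk t (y - x)).
Proof.
move=> k; rewrite (_ : (fun x => _) = (fun x => (Num.sqrt (t * pi *+ 2))^-1 *
    (expR \o (fun x => (- (t *+ 2)^-1) * ((-1 * x + y) * (-1 * x + y)))) x)).
  apply: smooth_uptoM; first exact: smooth_upto_cst.
  apply: smooth_upto_comp; first exact: smooth_upto_expR.
  apply: smooth_uptoM; first exact: smooth_upto_cst.
  by apply: smooth_uptoM; exact: smooth_upto_affine.
apply/funext => x /=; rewrite hk_exp mulN1r [- x + y]addrC; congr (_ * expR _).
by rewrite expr2 mulNr mulrC mulNr.
Qed.

(** The heat equation for the kernel, which cancels the second-order term when the weak equation is
    tested against it. *)
Lemma is_derive_hk_time t z : 0 < t ->
  is_derive t 1 (fun t => hk t z) (2^-1 * ddhk t z).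
Proof.
move=> t0; have t1 : t != 0 by rewrite gt_eqF.
have d1 := is_deriveM (is_derive_id t 1) (is_derive_cst (pi *+ 2 : R) t 1).
have c0 : 0 < t * (pi *+ 2) by rewrite mulr_gt0// mulrn_wgt0// pi_gt0.
have d2 := @is_derive_comp1 _ Num.sqrt (id * cst (pi *+ 2)) t _ _ (is_derive1_sqrt c0) d1.
set S := Num.sqrt (t * (pi *+ 2)).
have S0 : S != 0 by rewrite gt_eqF// sqrtr_gt0.
have dV (g : R -> R) (dg : R) : g t != 0 -> is_derive t 1 g dg ->
    is_derive t 1 (fun y => (g y)^-1) (- (g t) ^- 2 * dg).
  move=> g0 [g1 gE]; apply: DeriveDef; first exact: derivableV.
  by rewrite deriveV// gE.
have d3 := dV (Num.sqrt \o (id * cst (pi *+ 2))) _ S0 d2.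
have d4 := dV id _ t1 (is_derive_id t 1).
have d5 := is_deriveM (is_derive_cst (- z ^+ 2 / 2 : R) t 1) d4.
have d6 := @is_derive_comp1 _ expR (cst (- z ^+ 2 / 2) * (fun y => y^-1)) t _ _ (is_derive_expR _) d5.
have d7 := is_deriveM d3 d6.
rewrite (_ : (fun t => hk t z) = (fun y => (Num.sqrt (y * (pi *+ 2)))^-1) *
    (expR \o (cst (- z ^+ 2 / 2) * (fun y => y^-1)))); last first.
  apply/funext => r; rewrite !fctE /= hk_exp -mulrnAr; congr (_ * expR _).
  by rewrite -[r *+ 2]mulr_natl invfM mulrA.
apply: (is_derive_eq d7); rewrite /GRing.scale/= !fctE !mulr0 !addr0 /ddhk hk_exp -mulrnAr.
rewrite -/S.
have -> : - z ^+ 2 / 2 / t = - z ^+ 2 / (t *+ 2) by rewrite -[t *+ 2]mulr_natl invfM mulrA.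
have SE : S ^- 2 * (pi *+ 2) = t^-1.
  rewrite /S sqr_sqrtr ?(ltW c0)// invfM -mulrA mulVf ?mulr1//.
  by rewrite gt_eqF// mulrn_wgt0// pi_gt0.
set E := expR _.
rewrite (_ : - S ^- 2 * ((2 * S)^-1 * _) = - (2 * S)^-1 * (S ^- 2 * (pi *+ 2))); last by ring.
by rewrite SE; field; rewrite ?t1 ?S0.
Qed.

(** This is [hk_tail] with [d] equal to the absolute value of [z]. *)
Lemma sqr_hk_le t z : 0 < t -> z ^+ 2 * hk t z <= 8 * t * hk (t *+ 2) z.
Proof.
move=> t0; have [->|z0] := eqVneq z 0.
  by rewrite expr0n mul0r !mulr_ge0 ?hk_ge0// ltW.
have nz : 0 < `|z| by rewrite normr_gt0.
have := hk_tail t0 nz (lexx _).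
rewrite (real_normK (num_real z)) => h.
have z2 : 0 < z ^+ 2 by rewrite exprn_even_gt0.
rewrite mulrC -ler_pdivlMr// (le_trans h)// le_eqVlt; apply/orP; left; apply/eqP.
by field; rewrite z0.
Qed.

(** The exponential increases with time, and the normalizing constants at [s] and [2 t] differ by a
    factor at most the square root of 4. *)
Lemma hk_monotone s t z : 0 < t -> t / 2 <= s -> s <= t *+ 2 ->
  hk s z <= 2 * hk (t *+ 2) z.
Proof.
move=> t0 ts st.
have s0 : 0 < s by rewrite (lt_le_trans _ ts)// divr_gt0.
rewrite !hk_exp mulrA ler_pM ?invr_ge0 ?sqrtr_ge0 ?expR_ge0//.
  have p0 : 0 < t * pi by rewrite mulr_gt0 ?pi_gt0.
  have q0 : 0 < s * pi by rewrite mulr_gt0 ?pi_gt0.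
  have e1 : Num.sqrt (t * pi *+ 2 *+ 2) <= 2 * Num.sqrt (s * pi *+ 2).
    rewrite (_ : 2 * _ = Num.sqrt (4 * (s * pi *+ 2))); last first.
      by rewrite sqrtrM// (_ : 4 = 2 ^+ 2) ?sqrtr_sqr ?ger0_norm//; ring.
    apply: ler_wsqrtr; rewrite -mulrnA -[_ *+ (2 * 2)]mulr_natl ler_wpM2l// .
    rewrite -mulrnAl ler_wpM2r ?pi_ge0//; lra.
  have e2 : t *+ 2 * pi *+ 2 = t * pi *+ 2 *+ 2 by rewrite mulrnAl.
  rewrite e2.
  have p1 : 0 < Num.sqrt (s * pi *+ 2) by rewrite sqrtr_gt0 mulrn_wgt0.
  have p2 : 0 < Num.sqrt (t * pi *+ 2 *+ 2) by rewrite sqrtr_gt0 !mulrn_wgt0.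
  by rewrite ler_pdivlMr// mulrC ler_pdivrMr.
rewrite ler_expR !mulNr lerN2 ler_wpM2l ?sqr_ge0// lef_pV2 ?posrE ?mulrn_wgt0//.
by rewrite lerMn2r.
Qed.

(** A bound for [ddhk s] that is uniform for [s] between [t / 2] and [2 t] and lies in L^2, as
    domination of difference quotients in time requires. The constants are not sharp: the proof
    reaches [32 / t] in the first term. *)
Definition ddhk_bound t z : R :=
  8 * t^-1 * 32 * hk (t *+ 2 *+ 2) z + 4 / t * hk (t *+ 2) z.

Lemma ddhk_le s t z : 0 < t -> t / 2 <= s -> s <= t *+ 2 ->
  `|ddhk s z| <= ddhk_bound t z.
Proof.
move=> t0 ts st.
have s0 : 0 < s by rewrite (lt_le_trans _ ts)// divr_gt0.
have s1 : s != 0 by rewrite gt_eqF.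
have t1 : t != 0 by rewrite gt_eqF.
have sV : s^-1 <= 2 / t.
  by rewrite -[2 / t]invf_div lef_pV2 ?posrE// divr_gt0.
have sV0 : 0 <= s^-1 by rewrite invr_ge0 ltW.
have h1 : z ^+ 2 * hk s z <= 8 * s * (2 * hk (t *+ 2 *+ 2) z).
  rewrite (le_trans (sqr_hk_le z s0))// ler_wpM2l ?mulr_ge0 ?(ltW s0)//.
  apply: hk_monotone; first by rewrite mulrn_wgt0.
    by rewrite -[t *+ 2]mulr_natr -[s *+ 2]mulr_natr; move: ts t0; clear; lra.
  by rewrite lerMn2r.
have h2 : hk s z <= 2 * hk (t *+ 2) z by exact: hk_monotone.
rewrite /ddhk mulrBl (le_trans (ler_normB _ _))// lerD//.
  rewrite ger0_norm; last by rewrite mulr_ge0 ?hk_ge0// divr_ge0 ?sqr_ge0.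
  rewrite mulrAC (@le_trans _ _ (8 * s * (2 * hk (t *+ 2 *+ 2) z) / s ^+ 2))//.
    by rewrite ler_wpM2r// invr_ge0 sqr_ge0.
  rewrite (_ : _ / s ^+ 2 = s^-1 * (16 * hk (t *+ 2 *+ 2) z)); last by field.
  rewrite (@le_trans _ _ (2 / t * (16 * hk (t *+ 2 *+ 2) z)))//.
    by rewrite ler_wpM2r// mulr_ge0// hk_ge0.
  rewrite -subr_ge0 (_ : _ - _ = 224 / t * hk (t *+ 2 *+ 2) z); last by field.
  by apply: mulr_ge0 (hk_ge0 _ _); exact: divr_ge0 (ler0n _ _) (ltW t0).
rewrite ger0_norm ?mulr_ge0 ?hk_ge0//.
rewrite (@le_trans _ _ (2 / t * (2 * hk (t *+ 2) z)))//.
  by rewrite ler_pM ?hk_ge0.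
by rewrite le_eqVlt; apply/orP; left; apply/eqP; ring.
Qed.

Lemma measurable_dhk t : measurable_fun setT (dhk t).
Proof.
by apply: measurable_funM; [exact: measurable_funM|exact: measurable_hk].
Qed.

Lemma measurable_ddhk t : measurable_fun setT (ddhk t).
Proof.
apply: measurable_funM; last exact: measurable_hk.
by apply: measurable_funB => //; apply: measurable_funM => //; exact: measurable_funX.
Qed.

Lemma L2_ddhk_bound t : 0 < t -> L2 (ddhk_bound t).
Proof. by move=> t0; apply: L2D; apply: L2Z; apply: L2_hk; rewrite !mulrn_wgt0. Qed.

Lemma L2_ddhk t : 0 < t -> L2 (ddhk t).
Proof.
move=> t0; apply: (L2_le (measurable_ddhk t) (L2_ddhk_bound t0)) => z.
rewrite (le_trans _ (ler_norm _))//; apply: ddhk_le => //.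
  by rewrite ler_pdivrMr// mulr2n mulrDr mulr1 lerDl ltW.
by rewrite mulr2n lerDl ltW.
Qed.

(** The factor [z] is handled by [|z| <= 1 + z^2], which leaves two Gaussians. *)
Lemma L2_dhk t : 0 < t -> L2 (dhk t).
Proof.
move=> t0.
have LG : L2 (fun z => t^-1 * (hk t z + 8 * t * hk (t *+ 2) z)).
  by apply: L2Z; apply: L2D; [exact: L2_hk|apply: L2Z; apply: L2_hk; rewrite mulrn_wgt0].
apply: (L2_le (measurable_dhk t) LG) => z.
rewrite (le_trans _ (ler_norm _))// /dhk (_ : z / t * hk t z = t^-1 * (z * hk t z)); last by ring.
rewrite normrM [`|t^-1|]ger0_norm ?invr_ge0 ?(ltW t0)// ler_wpM2l ?invr_ge0 ?(ltW t0)//.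
rewrite (@le_trans _ _ (hk t z + z ^+ 2 * hk t z))//; last by rewrite lerD2l sqr_hk_le.
rewrite normrM [`|hk t z|]ger0_norm ?hk_ge0// -[X in X + _]mul1r -mulrDl ler_wpM2r ?hk_ge0//.
have := sqr_ge0 (`|z| - 1); rewrite -(real_normK (num_real z)).
have := normr_ge0 z; set w := `|z|; nra.
Qed.

End HeatKernelDerivatives.

(** * Difference quotients in L^2 *)

Section DifferenceQuotients.
Context {R : realType}.
Local Notation mu := (@lebesgue_measure R).
Implicit Types (s t x y z c : R).

(* The difference quotients of [v] converge in L^2: the mean value theorem
   dominates them by [Q]. *)
Lemma L2_quotient (v dv : R -> R -> R) (Q : R -> R) (s d : R) : 0 < d -> L2 Q ->
  (forall r, measurable_fun setT (v r)) -> measurable_fun setT (dv s) ->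
  (forall r x, `|r - s| < d -> is_derive r 1 (v^~ x) (dv r x)) ->
  (forall r x, `|r - s| < d -> `|dv r x| <= Q x) ->
  nrm (fun x => k^-1 * (v (s + k) x - v s x) - dv s x) @[k --> 0^'] --> (0 : R).
Proof.
move=> d0 LQ mv mdv vE vQ; apply/cvgr_dnbhsP => k [k0 kc].
have knear : \forall n \near \oo, `|k n| < d.
  by move/cvgr0_norm_lt : kc; exact.
have ss x : is_derive s 1 (v^~ x) (dv s x) by apply: vE; rewrite subrr normr0.
(* The mean value bound is available only for [|k n| < d]. Putting the limit itself elsewhere, for
   finitely many [n], makes the domination hold for all [n]. *)
pose F n x : R := if `|k n| < d then (k n)^-1 * (v (s + k n) x - v s x) else dv s x.
have FE : nrm (fun x => F n x - dv s x) @[n --> \oo] --> (0 : R).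
  apply: (L2_dominated_cvg (g := fun x => 2 * Q x)) => //.
  - move=> n; rewrite /F; case: (`|k n| < d) => //.
    by apply: measurable_funM => //; exact: measurable_funB.
  - exact: L2Z.
  - move=> n x.
    have Q0 : 0 <= Q x by rewrite (le_trans (normr_ge0 (dv s x)))// vQ// subrr normr0.
    rewrite [leRHS]ger0_norm ?mulr_ge0// mulr_natl mulr2n.
    rewrite (le_trans (ler_normB _ _))// lerD//; last by rewrite vQ// subrr normr0.
    rewrite /F; have [kd|_] := ltP `|k n| d; last by rewrite vQ// subrr normr0.
    have bd a b : a < b -> (forall r, a <= r <= b -> `|r - s| < d) ->
        `|v b x - v a x| <= Q x * (b - a).
      move=> ab near_s.
      have [||r rab ->] := @MVT _ (v^~ x) (dv^~ x) a b ab.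
      - move=> r; rewrite in_itv/= => /andP[h1 h2]; apply: vE; apply: near_s.
        by rewrite !ltW.
      - apply: derivable_within_continuous => r; rewrite in_itv/= => rab.
        by have [] := vE r x (near_s r rab).
      - rewrite normrM [`|b - a|]gtr0_norm ?subr_gt0// ler_wpM2r ?subr_ge0 ?(ltW ab)//.
        apply: vQ; apply: near_s; move: rab; rewrite in_itv/= => /andP[h1 h2].
        by rewrite !ltW.
    rewrite normrM normfV ler_pdivrMl ?normr_gt0// mulrC.
    have [kn|kn|kn] := ltgtP (k n) 0; last by move: (k0 n); rewrite kn eqxx.
      rewrite distrC [`|k n|]ltr0_norm// (le_trans (bd (s + k n) s _ _))//.
      + by rewrite -[ltRHS]addr0 ltrD2l.
      + move=> r /andP[h1 h2]; move: kd; rewrite ltr0_norm// => kd.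
        by rewrite ler0_norm ?subr_le0//; lra.
      + by rewrite opprD addrA subrr sub0r.
    rewrite [`|k n|]gtr0_norm// (le_trans (bd s (s + k n) _ _))//.
    + by rewrite ltrDl.
    + move=> r /andP[h1 h2]; move: kd; rewrite gtr0_norm// => kd.
      by rewrite ger0_norm ?subr_ge0//; lra.
    + by rewrite addrC addKr.
  - apply: (aeW mu) => x.
    have [dx <-] := ss x.
    have lim0 : (k n)^-1 * (v (s + k n) x - v s x) @[n --> \oo] --> 'D_1 (v^~ x) s.
      have /cvgr_dnbhsP/(_ k) := dx.
      move=> /(_ (conj k0 kc)); rewrite /derive => lim1.
      apply: cvg_trans lim1; apply: near_eq_cvg; near=> n.
      by rewrite /= /GRing.scale/= mulr1 [_ + s]addrC.
    apply: cvg_trans lim0; apply: near_eq_cvg; near=> n.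
    by rewrite /F ifT//; near: n.
apply: cvg_trans FE; apply: near_eq_cvg; near=> n.
by congr nrm; apply/funext => x; rewrite /F ifT//; near: n.
Unshelve. all: by end_near. Qed.

End DifferenceQuotients.

(** * The mild equation *)

Section MildSolution.
Context {R : realType}.
Local Notation mu := (@lebesgue_measure R).
Implicit Types (s t r x y z c : R).

Lemma hk0 t z : t <= 0 -> hk t z = 0.
Proof.
move=> t0; rewrite /hk ler0_sqrtr ?invr0 ?mul0r//.
by rewrite -mulrnAr mulr_le0_ge0// mulrn_wge0// pi_ge0.
Qed.

Lemma L2_hk_sub_all t y : L2 (fun x => hk t (y - x)).
Proof.
have [t0|t0] := ltP 0 t; first exact: L2_hk_sub.
by rewrite (_ : (fun x => _) = fun=> 0); [exact: L20|apply/funext => x; rewrite hk0].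
Qed.

Lemma ip_cvg2 (T : Type) (F : set_system T) (FF : Filter F)
    (w_ h_ : T -> R -> R) (w h : R -> R) :
  (forall k, L2 (w_ k)) -> (forall k, L2 (h_ k)) -> L2 w -> L2 h ->
  nrm (fun x => w_ k x - w x) @[k --> F] --> (0 : R) ->
  nrm (fun x => h_ k x - h x) @[k --> F] --> (0 : R) ->
  ip (w_ k) (h_ k) @[k --> F] --> ip w h.
Proof.
move=> Lw_ Lh_ Lw Lh cw ch.
pose bd k := nrm (fun x => w_ k x - w x) * nrm (fun x => h_ k x - h x) +
  nrm (fun x => w_ k x - w x) * nrm h + nrm w * nrm (fun x => h_ k x - h x).
have bd0 : bd k @[k --> F] --> (0 : R).
  have -> : (0 : R) = 0 * 0 + 0 * nrm h + nrm w * 0 by rewrite !mul0r mulr0 !addr0.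
  by apply: cvgD; [apply: cvgD; apply: cvgM => //; exact: cvg_cst|apply: cvgM => //; exact: cvg_cst].
apply/cvgrPdist_le => e e0.
apply: filterS (cvgr_le 0 bd0 e e0) => k bk.
have Lwk := L2B (Lw_ k) Lw; have Lhk := L2B (Lh_ k) Lh.
have -> : ip w h - ip (w_ k) (h_ k) =
  - (ip (fun x => w_ k x - w x) (fun x => h_ k x - h x) +
     ip (fun x => w_ k x - w x) h + ip w (fun x => h_ k x - h x)).
  by rewrite !(ipBl (Lw_ k) Lw)// !(ipBr _ (Lh_ k) Lh)//; ring.
rewrite normrN (le_trans _ bk)// (le_trans (ler_normD _ _))// lerD ?cauchy_schwarz//.
by rewrite (le_trans (ler_normD _ _))// lerD ?cauchy_schwarz.
Qed.

Lemma is_derive_cvg (f : R -> R) s (d : R) : is_derive s 1 f d ->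
  k^-1 * (f (s + k) - f s) @[k --> 0^'] --> d.
Proof.
move=> [df <-]; apply: cvg_trans df; apply: near_eq_cvg; near=> k.
by rewrite /GRing.scale/= mulr1 [_ + s]addrC.
Unshelve. all: by end_near. Qed.

Lemma cvg_is_derive (f : R -> R) s (d : R) :
  k^-1 * (f (s + k) - f s) @[k --> 0^'] --> d -> is_derive s 1 f d.
Proof.
move=> H.
have K : h^-1 *: (f (h *: 1 + s) - f s) @[h --> 0^'] --> d.
  apply: cvg_trans H; apply: near_eq_cvg; near=> k.
  by rewrite /GRing.scale/= mulr1 [_ + s]addrC.
by apply: DeriveDef; [apply/cvg_ex; exists d|exact: (cvg_lim (@Rhausdorff R) K)].
Unshelve. all: by end_near. Qed.

Lemma near_sub (Q : R -> Prop) s :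
  (\forall k \near (0 : R), Q k) -> \forall r \near s, Q (r - s).
Proof.
move=> HQ.
have H0 : (r - s) @[r --> s] --> (0 : R).
  by rewrite -[X in _ --> X](subrr s); apply: cvgB; [exact: cvg_id|exact: cvg_cst].
exact: (H0 Q HQ).
Qed.

Section KernelCurve.
Variables (c y : R).

Let v r x : R := hk (c - r) (y - x).
Let dv r x : R := - 2^-1 * ddhk (c - r) (y - x).

Let is_derive_v r x : r < c -> is_derive r 1 (v^~ x) (dv r x).
Proof.
move=> rc; have cr : 0 < c - r by rewrite subr_gt0.
have := @is_derive_comp1 _ (fun t => hk t (y - x)) (fun r => c - r) r _ _
  (is_derive_hk_time _ cr) (is_derive_reflect c r).
move=> H; apply: (is_derive_eq H); rewrite /dv; ring.
Qed.

Lemma L2_dv r : r < c -> L2 (dv r).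
Proof.
by move=> rc; apply: L2Z; apply: (L2_sub y); apply: L2_ddhk; rewrite subr_gt0.
Qed.

Lemma kernel_quotient s : s < c ->
  nrm (fun x => k^-1 * (v (s + k) x - v s x) - dv s x) @[k --> 0^'] --> (0 : R).
Proof.
move=> sc; have cs : 0 < c - s by rewrite subr_gt0.
(* Within this radius the time [c - r] stays between half and twice [c - s], the range of
   [ddhk_le]. *)
apply: (@L2_quotient _ v dv (fun x => ddhk_bound (c - s) (y - x)) s ((c - s) / 2)).
- by rewrite divr_gt0.
- by apply: (L2_sub y); exact: L2_ddhk_bound.
- by move=> r; have [] := L2_hk_sub_all (c - r) y.
- by have [] := L2_dv sc.
- move=> r x rs; apply: is_derive_v; move: rs; rewrite ltr_norml => /andP[_]; lra.
- move=> r x; rewrite ltr_norml => /andP[r1 r2].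
  rewrite /dv normrM normrN [`|2^-1|]ger0_norm//.
  have := @ddhk_le R (c - r) (c - s) (y - x) cs.
  move=> H; apply: (le_trans _ (H _ _)).
  - by rewrite ler_piMl// invf_le1// ler1n.
  - lra.
  - rewrite -[(c - s) *+ 2]mulr_natl; lra.
Qed.

(** The difference quotients have norm at most [1 + nrm (dv s)] near [s], so the increments are of
    the order of the time increment. *)
Lemma kernel_continuous s : s < c ->
  nrm (fun x => v r x - v s x) @[r --> s] --> (0 : R).
Proof.
move=> sc.
have Lv r : L2 (v r) by exact: L2_hk_sub_all.
have Lq k : L2 (fun x => k^-1 * (v (s + k) x - v s x)) by apply: L2Z; exact: L2B.
apply/cvgrPdist_le => e e0.
have e1 : 0 < e / (1 + nrm (dv s)) by rewrite divr_gt0// ltr_pwDl// nrm_ge0.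
have q1 := cvgr_le 0 (kernel_quotient sc) 1 ltr01.
suff H : \forall k \near (0 : R), nrm (fun x => v (s + k) x - v s x) <= e.
  apply: filterS (near_sub s H) => r; rewrite addrC subrK => h.
  by rewrite sub0r normrN ger0_norm ?nrm_ge0.
have k1 : \forall k \near (0 : R), `|k| < e / (1 + nrm (dv s)).
  exact: nbhs0_lt.
have q2 : \forall k \near (0 : R), k != 0 ->
    nrm (fun x => k^-1 * (v (s + k) x - v s x) - dv s x) <= 1 by exact: q1.
near=> k.
have kq0 : k != 0 -> nrm (fun x => k^-1 * (v (s + k) x - v s x) - dv s x) <= 1.
  by near: k; exact: q2.
have [->|k0] := eqVneq k 0.
  rewrite addr0 (_ : (fun x => _) = fun=> 0) ?nrm0 ?(ltW e0)//.
  by apply/funext => x; rewrite subrr.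
have kq := kq0 k0.
have kk : `|k| < e / (1 + nrm (dv s)) by near: k.
rewrite (_ : (fun x => _) = fun x => k * (k^-1 * (v (s + k) x - v s x))); last first.
  by apply/funext => x; rewrite mulrA mulfV// mul1r.
rewrite nrmZ// (@le_trans _ _ (e / (1 + nrm (dv s)) * (1 + nrm (dv s))))//.
  apply: (ler_pM (normr_ge0 _) (nrm_ge0 _) (ltW kk)).
  have := nrmD (L2B (Lq k) (L2_dv sc)) (L2_dv sc).
  under [X in nrm X <= _]eq_fun do rewrite subrK.
  by move=> /le_trans; apply; rewrite lerD2r.
by rewrite divfK// gt_eqF// ltr_pwDl// nrm_ge0.
Unshelve. all: by end_near. Qed.

End KernelCurve.

Variables (T : R) (f b : R -> R) (u : R -> R -> R).
Hypotheses (T0 : 0 < T) (cu : L2_curve u) (cb : continuous b) (Lf : L2 f).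
Hypothesis fu0 : {ae mu, forall x, u 0 x = f x}.
Hypothesis weak : weak_pde T f b u.
Local Notation killed := (killed b u).

Lemma weak_time_derive (h dh ddh : R -> R) : smooth h ->
  (forall x : R, is_derive x 1 h (dh x)) -> (forall x : R, is_derive x 1 dh (ddh x)) ->
  L2 h -> L2 dh -> L2 ddh -> forall t, t \in `]0, T[ ->
  is_derive t 1 (fun t => ip (u t) h) (2^-1 * ip (u t) ddh - ip (killed t) h).
Proof.
move=> Sh dhE ddhE Lh Ldh Lddh t; rewrite in_itv/= => /andP[t0 tT].
have wt := weak_time T0 cu cb Lf fu0 weak Sh dhE ddhE Lh Ldh Lddh.
pose k s := 2^-1 * ip (u s) ddh - ip (killed s) h.
have ck : continuous k.
  move=> s; apply: cvgB.
    by apply: cvgM; [exact: cvg_cst|exact: L2_curve_ip].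
  by apply: L2_curve_ip => //; exact: L2_curve_killed.
have [K KE] := exists_primitive (-1) ck.
have K1 : is_derive t 1 (fun t => ip (u 0) h - K 0 + K t) (k t).
  have := is_deriveD (is_derive_cst (ip (u 0) h - K 0) t 1) (KE t _).
  rewrite add0r; apply; lra.
have oo_cc (r : R) : 0 < r -> r < T -> r \in `[0, T].
  by move=> r0 rT; rewrite in_itv/= !ltW.
apply: near_eq_is_derive K1 => //.
near=> r.
have r0 : 0 < r by near: r; exact: lt_nbhsr.
have rT : r < T by near: r; exact: lt_nbhsl.
rewrite [RHS]wt; last exact: oo_cc.
rewrite (Rint_primitive ck KE) ?ltrN10 ?ltW//; ring.
Unshelve. all: by end_near. Qed.

(* The weak equation is tested against the kernel [hk (c - t) (y - x)], which
   solves the backward heat equation, so only the killing term survives. *)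
Lemma mild_point c y s t : 0 <= s -> s <= t -> t <= T -> t < c ->
  heat (c - t) (u t) y = heat (c - s) (u s) y -
    \int[mu]_(r in `[s, t]) heat (c - r) (killed r) y.
Proof.
move=> s0; rewrite le_eqVlt => /predU1P[<- _ _|st tT tc].
  by rewrite set_itv1 Rintegral_set1 subr0.
pose v r x : R := hk (c - r) (y - x).
have Lv r : L2 (v r) by exact: L2_hk_sub_all.
have Lu r : L2 (u r) by have [] := cu.
have ck := L2_curve_killed cu cb.
have Lk r : L2 (killed r) by have [] := ck.
have cont (w : R -> R -> R) : L2_curve w -> {within `[s, t], continuous (fun r => ip (w r) (v r))}.
  move=> cw; apply: continuous_in_subspaceT => r.
  rewrite inE/= in_itv/= => /andP[_ rt].
  apply: ip_cvg2 => //; try by move=> k; have [] := cw.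
  - by have [] := cw.
  - by have [] := cw.
  - by apply: kernel_continuous; exact: le_lt_trans tc.
have hE r (w : R -> R) : heat (c - r) w y = ip w (v r) by rewrite /heat ipC.
rewrite !hE; under eq_Rintegral do rewrite hE.
suff -> : \int[mu]_(x in `[s, t]) ip (killed x) (v x) = - ip (u t) (v t) - - ip (u s) (v s).
  by move: (ip _ _) (ip _ _) => i1 i2; ring.
apply: (Rint_FTC (F := fun r => - ip (u r) (v r))) => //.
- exact: cont.
- by move=> r; apply: cvgN; exact: (cont u cu).
move=> r; rewrite in_itv/= => /andP[sr rt].
have rc : r < c by exact: lt_trans tc.
have rT : r \in `]0, T[ by rewrite in_itv/= (le_lt_trans s0 sr) (lt_le_trans rt tT).
have cr : c - r != 0 by rewrite gt_eqF// subr_gt0.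
have Ldh : L2 (fun x => dhk (c - r) (y - x)) by apply: L2_sub; apply: L2_dhk; rewrite subr_gt0.
have Lddh : L2 (fun x => ddhk (c - r) (y - x)) by apply: L2_sub; apply: L2_ddhk; rewrite subr_gt0.
have D2 := is_derive_cvg (weak_time_derive (smooth_hk (c - r) y)
  (fun x => is_derive_hk_space y x cr) (fun x => is_derive_dhk_space y x cr)
  (Lv r) Ldh Lddh rT).
have D1 : ip (u (r + k)) (fun x => k^-1 * (v (r + k) x - v r x)) @[k --> 0^'] -->
    ip (u r) (fun x => - 2^-1 * ddhk (c - r) (y - x)).
  apply: ip_cvg2 => //.
  - by move=> k; apply: L2Z; exact: L2B.
  - exact: L2Z.
  - apply: (@cvg_comp _ _ _ (fun k => r + k) (fun t => nrm (fun x => u t x - u r x))); last exact: (cu.2 r).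
    apply: cvg_within_filter.
    have : r + k @[k --> (0 : R)] --> r + 0 by apply: cvgD; [exact: cvg_cst|exact: cvg_id].
    by rewrite addr0.
  - exact: kernel_quotient.
apply: cvg_is_derive.
rewrite (ipZr (- 2^-1) (Lu r) Lddh) in D1.
have := cvgN (cvgD D1 D2).
(* The two terms in [ddhk] cancel by the heat equation. *)
rewrite (_ : - (_ + _) = ip (killed r) (v r)); last by rewrite /v; ring.
move=> /(_ _ _) D; apply: cvg_trans D; apply: near_eq_cvg; near=> k.
rewrite !fctE (ipZr _ (Lu _) (L2B (Lv _) (Lv _))).
rewrite ipBr//.
move: (ip _ _) (ip _ _) (ip _ _) => i1 i2 i3; ring.
Unshelve. all: by end_near. Qed.
End MildSolution.

(** * Splitting of the mild solution *)

Section Caratheodory.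
Context d (T : measurableType d) (R : realType).

Lemma measurable_choice (q : R -> nat) (g : nat -> T -> R) :
  (forall m, measurable (q @^-1` [set m])) ->
  (forall m, measurable_fun setT (g m)) ->
  measurable_fun [set: measurableTypeR R * T] (fun p => g (q p.1) p.2).
Proof.
move=> mq mg _ A mA; rewrite setTI.
have -> : (fun p : R * T => g (q p.1) p.2) @^-1` A =
    \bigcup_m ((q @^-1` [set m]) `*` (g m @^-1` A)).
  apply/seteqP; split => [[r y]/= Ary|[r y] [m _ [/= <-]]//].
  by exists (q r) => //; split.
apply: bigcup_measurable => m _; apply: measurableX; first exact: mq.
by rewrite -[X in measurable X]setTI; exact: mg.
Qed.

(** Joint measurability of a function continuous in [r] and measurable in [y]: rounding [r] down to
    a grid of mesh [1 / (n+1)] gives a countable choice of measurable functions, and continuity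
    gives the limit. The maximum with [a] confines [r] to the half-line where [k r] is known to be
    measurable. *)
Lemma caratheodory (a : R) (k : R -> T -> R) :
  (forall y, continuous (fun r => k (Num.max r a) y)) ->
  (forall r, a <= r -> measurable_fun setT (k r)) ->
  measurable_fun [set: measurableTypeR R * T] (fun p => k (Num.max p.1 a) p.2).
Proof.
move=> ck mk.
pose q n r := Num.truncn (n.+1%:R * (Num.max r a - a)).
pose g n m y := k (a + m%:R / n.+1%:R) y.
apply: (@measurable_fun_cvg _ (measurableTypeR R * T)%type R setT (fun n p => g n (q n p.1) p.2)).
  move=> n; apply: measurable_choice => [m|m]; last first.
    by apply: mk; rewrite lerDl divr_ge0.
  rewrite (_ : _ @^-1` _ = (fun r => n.+1%:R * (Num.max r a - a)) @^-1` `[m%:R, m.+1%:R[%classic).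
    rewrite -[X in measurable X]setTI.
    have : measurable_fun [set: measurableTypeR R] (fun r : R => n.+1%:R * (Num.max r a - a)).
      apply: measurable_funM => //; apply: measurable_funB => //.
      by apply: (@measurable_maxr _ (measurableTypeR R) R setT id (cst a)) => //; exact: measurable_id.
    by apply => //; exact: measurable_itv.
  apply/funext => r /=; apply/propext; rewrite in_itv/= -truncn_eq.
    by split => [h|/eqP]//; apply/eqP.
  by rewrite mulr_ge0// subr_ge0 le_max lexx orbT.
move=> [r y] _ /=.
pose rn n := a + (q n r)%:R / n.+1%:R.
have rn_ge n : a <= rn n by rewrite lerDl divr_ge0.
have rnr n : `|Num.max r a - rn n| <= n.+1%:R^-1.
  have n0 : 0 < n.+1%:R :> R by [].
  have x0 : 0 <= n.+1%:R * (Num.max r a - a) by rewrite mulr_ge0// subr_ge0 le_max lexx orbT.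
  have /andP[q1 q2] := truncn_itv x0.
  have -> : Num.max r a - rn n = (n.+1%:R * (Num.max r a - a) - (q n r)%:R) / n.+1%:R.
    by rewrite /rn mulrBl [n.+1%:R * _]mulrC mulfK ?gt_eqF// opprD addrA.
  rewrite normrM [`|_^-1|]ger0_norm ?invr_ge0// ler_piMl ?invr_ge0// ger0_norm ?subr_ge0//.
  by rewrite lerBlDl natr1; exact: ltW.
have rc : rn n @[n --> \oo] --> Num.max r a.
  apply/cvgrPdist_le => e e0.
  have /cvgrPdist_le/(_ e e0) := @cvg_harmonic R.
  apply: filterS => n; rewrite sub0r normrN ger0_norm ?invr_ge0// => h.
  exact: le_trans (rnr n) h.
have := cvg_comp _ _ rc (ck y (Num.max r a)).
rewrite -Order.TotalTheory.maxA maxxx.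
apply: cvg_trans; apply: near_eq_cvg; near=> n.
by rewrite /= max_l.
Unshelve. all: by end_near. Qed.

End Caratheodory.

(** * The error of one splitting step *)

Section StepEstimate.
Context {R : realType}.
Local Notation mu := (@lebesgue_measure R).
Implicit Types (s t r x y z c h e : R).

Lemma heat_curve_cvg (w : R -> R -> R) c y r : L2_curve w -> r < c ->
  heat (c - r') (w r') y @[r' --> r] --> heat (c - r) (w r) y.
Proof.
move=> cw rc; rewrite /heat ipC.
under eq_fun do rewrite ipC.
apply: ip_cvg2; try by move=> k; have [] := cw.
- by move=> k; exact: L2_hk_sub_all.
- by have [] := cw.
- exact: L2_hk_sub_all.
- by have [] := cw.
- exact: kernel_continuous.
Qed.

(** From [1 - h <= exp (-h) <= 1 / (1 + h) <= 1 - h + h^2]. *)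
Lemma expRN_bound h : 0 <= h -> `|h - (1 - expR (- h))| <= h ^+ 2.
Proof.
move=> h0; have h1 : 0 < 1 + h by rewrite ltr_pwDl.
have lo := expR_ge1Dx (- h).
have hi : expR (- h) <= 1 - h + h ^+ 2.
  rewrite expRN -[leRHS]mul1r -[X in X * _](mulVf (lt0r_neq0 h1)) -mulrA.
  apply: (@le_trans _ _ (1 + h)^-1); first by rewrite lef_pV2 ?posrE ?expR_gt0// expR_ge1Dx.
  rewrite ler_peMr ?invr_ge0 ?(ltW h1)//.
  rewrite (_ : (1 + h) * _ = 1 + h ^+ 3); last by ring.
  by rewrite lerDl exprn_ge0.
by rewrite ger0_norm; lra.
Qed.

Lemma EFin_Rintegral (D : set (measurableTypeR R)) (g : R -> R) : measurable D ->
  mu.-integrable D (EFin \o g) ->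
  (\int[mu]_(x in D) g x)%:E = (\int[mu]_(x in D) (g x)%:E)%E.
Proof. by move=> mD ig; rewrite /Rintegral fineK//; exact: integrable_fin_num. Qed.

(* Tonelli in [(r, y)], the measurability of [k] in both variables coming from
   its continuity in [r] *)
Lemma ip_average (k : R -> R -> R) (D g eta : R -> R) s t w :
  s <= t -> 0 <= w ->
  (forall y, continuous (fun r => k (Num.max r s) y)) -> (forall r, L2 (k r)) ->
  L2 D -> L2 g -> L2 eta ->
  (forall y, D y = \int[mu]_(r in `[s, t]) k r y) ->
  (forall r, s <= r <= t -> nrm (fun y => k r y - g y) <= w) ->
  `|ip D eta - (t - s) * ip g eta| <= (t - s) * w * nrm eta.
Proof.
move=> st w0 ck Lk LD Lg Le DE kg.
have ts0 : 0 <= t - s by rewrite subr_ge0.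
have mST : measurable (`[s, t]%classic : set (measurableTypeR R)) by exact: measurable_itv.
have muST : mu `[s, t]%classic = (t - s)%:E.
  by rewrite lebesgue_measure_itv/= lte_fin; case: ltgtP st => // ->; rewrite subrr.
pose K (p : R * R) := k (Num.max p.1 s) p.2.
have mK : measurable_fun [set: measurableTypeR R * measurableTypeR R] K.
  by apply: caratheodory => // r _; have [] := Lk r.
have mg : measurable_fun [set: measurableTypeR R * measurableTypeR R] (fun p => g p.2).
  by apply: (measurableT_comp Lg.1); exact: measurable_snd.
have me : measurable_fun [set: measurableTypeR R * measurableTypeR R] (fun p => eta p.2).
  by apply: (measurableT_comp Le.1); exact: measurable_snd.
have m1 : measurable_fun [set: measurableTypeR R * measurableTypeR R]
    (fun p => \1_(`[s, t]%classic : set R) p.1 : R).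
  apply: measurableT_comp; first exact: measurable_indic.
  exact: measurable_fst.
(* Integrated in [y] first, [F] is bounded by Cauchy-Schwarz for each [r]; integrated in [r] first,
   it dominates the pairing for each [y]. *)
pose F (p : R * R) := \1_(`[s, t]%classic : set R) p.1 * `|K p - g p.2| * `|eta p.2|.
have mF : measurable_fun [set: measurableTypeR R * measurableTypeR R] F.
  apply: measurable_funM.
    apply: measurable_funM => //.
    by apply: (measurableT_comp (@normr_measurable R setT)); exact: measurable_funB.
  exact: (measurableT_comp (@normr_measurable R setT)).
have F0 p : (0 <= (F p)%:E)%E by rewrite lee_fin /F !mulr_ge0.
have Lkg r : L2 (fun y => `|k r y - g y|) by apply: L2_abs; exact: L2B.
have inner r : (\int[mu]_y (F (r, y))%:E <= (\1_(`[s, t]%classic : set R) r * (w * nrm eta))%:E)%E.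
  rewrite /F/= indicE; have [|_] := boolP (_ \in _); last first.
    by rewrite mul0r; under eq_integral do rewrite !mul0r; rewrite integral0.
  rewrite inE/= in_itv/= mul1r => /andP[sr rt].
  under eq_integral do rewrite mul1r /K/= max_l//.
  rewrite (_ : integral _ _ _ = (ip (fun y => `|k r y - g y|) (fun y => `|eta y|))%:E).
    rewrite lee_fin (le_trans (ler_norm _))// (le_trans (cauchy_schwarz (Lkg r) (L2_abs Le)))//.
    have nabs (v : R -> R) : nrm (fun x => `|v x|) = nrm v.
      by rewrite /nrm !ipxx; congr Num.sqrt; apply: eq_Rintegral => x _; rewrite real_normK// num_real.
    by rewrite !nabs ler_wpM2r ?nrm_ge0// kg// sr.
  rewrite /ip /Rintegral fineK//.
  by apply: integrable_fin_num => //; exact: (L2_mul (Lkg r) (L2_abs Le)).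
have total : (\int[mu]_y \int[mu]_r (F (r, y))%:E <= ((t - s) * w * nrm eta)%:E)%E.
  rewrite -(@lebesgue_tonelli R (EFin \o F))//; last exact/measurable_EFinP.
  apply: (@le_trans _ _ (\int[mu]_r (\1_(`[s, t]%classic : set R) r * (w * nrm eta))%:E)%E).
    apply: ge0_le_integral => //.
    - by move=> r _; apply: integral_ge0 => y _; exact: F0.
    - apply: (@measurable_fun_fubini_tonelli_F _ _ (measurableTypeR R) (measurableTypeR R) R mu (EFin \o F)) => //.
      exact/measurable_EFinP.
    - apply/measurable_EFinP; apply: measurable_funM => //; exact: measurable_indic.
    - by move=> r _; exact: inner.
  rewrite (_ : (fun r => _) = (fun r => (w * nrm eta)%:E * (\1_(`[s, t]%classic : set R) r)%:E)%E); last first.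
    by apply/funext => r; rewrite -EFinM mulrC.
  rewrite ge0_integralZl_EFin ?mulr_ge0 ?nrm_ge0//; last first.
    by apply/measurable_EFinP; exact: measurable_indic.
  rewrite integral_indic// setIT.
  rewrite [X in (_ * X <= _)%E](_ : _ = (t - s)%:E); last exact: muST.
  by rewrite -EFinM lee_fin; nra.
have pt y : (`|(D y - (t - s) * g y) * eta y|%:E <= \int[mu]_r (F (r, y))%:E)%E.
  pose kk r := k (Num.max r s) y.
  have ikk : mu.-integrable `[s, t] (EFin \o kk).
    by apply: continuous_integrable_itv; apply: continuous_subspaceT; exact: ck.
  have ig : mu.-integrable `[s, t] (EFin \o cst (g y)).
    by apply: continuous_integrable_itv; apply: continuous_subspaceT; exact: cst_continuous.
  have ikg : mu.-integrable `[s, t] (EFin \o (fun r => kk r - g y)).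
    exact: (integrableB mST ikk ig).
  have Dkg : D y - (t - s) * g y = \int[mu]_(r in `[s, t]) (kk r - g y).
    rewrite RintegralB// DE Rintegral_cst//.
    rewrite [X in fine X](_ : _ = (t - s)%:E) /= 1?mulrC; last exact: muST.
    by congr (_ - _); apply: eq_Rintegral => r; rewrite inE/= in_itv/= => /andP[sr _]; rewrite /kk max_l.
  rewrite (_ : (fun r => (F (r, y))%:E) = (fun r => `|eta y|%:E * `|kk r - g y|%:E)%E \_ `[s, t]%classic); last first.
    apply/funext => r; rewrite patchE /F/= indicE /kk /K/=; case: ifPn => _.
      by rewrite mul1r -EFinM mulrC.
    by rewrite !mul0r.
  rewrite -integral_mkcond ge0_integralZl_EFin//; last first.
    by have [] := integrableP _ _ _ (integrable_norm ikg).
  rewrite -EFin_Rintegral//; last exact: integrable_norm.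
  rewrite -EFinM lee_fin normrM mulrC ler_wpM2l// Dkg.
  exact: le_normr_Rintegral.
have LDg : L2 (fun y => D y - (t - s) * g y) by apply: L2B => //; exact: L2Z.
rewrite -ipZl// -ipBl//; last exact: L2Z.
rewrite -lee_fin (le_trans _ total)//.
have iDg := L2_mul LDg Le.
rewrite (@le_trans _ _ (\int[mu]_y (`|(D y - (t - s) * g y) * eta y|)%:E)%E)//.
  rewrite -EFin_Rintegral//; last exact: integrable_norm.
  by rewrite lee_fin; exact: le_normr_Rintegral.
apply: ge0_le_integral => //.
- by apply/measurable_EFinP; apply: (measurableT_comp (@normr_measurable R setT)); exact: measurable_funM LDg.1 Le.1.
- apply: (@measurable_fun_fubini_tonelli_G _ _ (measurableTypeR R) (measurableTypeR R) R mu (EFin \o F)) => //.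
  exact/measurable_EFinP.
Qed.

Lemma nrm_dual (g : R -> R) (M : R) : L2 g -> 0 <= M ->
  (forall eta, L2 eta -> `|ip g eta| <= M * nrm eta) -> nrm g <= M.
Proof.
move=> Lg M0 /(_ g Lg); rewrite ger0_norm ?ip_ge0// -nrm2 expr2 => H.
have [g0|g0] := ltP 0 (nrm g); last exact: le_trans M0.
by rewrite ler_pM2r in H.
Qed.

Variables (T : R) (f b : R -> R) (u : R -> R -> R).
Hypotheses (T0 : 0 < T) (cu : L2_curve u) (cb : continuous b) (Lf : L2 f).
Hypothesis fu0 : {ae mu, forall x, u 0 x = f x}.
Hypothesis weak : weak_pde T f b u.
Local Notation killed := (killed b u).

Let Lu r : L2 (u r). Proof. by have [] := cu. Qed.
Let ck : L2_curve killed. Proof. exact: L2_curve_killed. Qed.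
Let Lk r : L2 (killed r). Proof. by have [] := ck. Qed.

(** The mild equation with final time [s + h], stopped [e] earlier since the kernel degenerates
    there. Replacing [heat (s + h - r) (killed r)] by [killed s] costs [w] for the change of time
    and [w] for the heat flow. *)
Lemma duhamel_estimate s h e w (eta : R -> R) : 0 <= s -> 0 < e -> e < h -> s + h <= T -> 0 <= w ->
  L2 eta ->
  (forall r, s <= r <= s + h -> nrm (fun x => killed r x - killed s x) <= w) ->
  (forall tau, 0 < tau <= h -> nrm (fun x => heat tau (killed s) x - killed s x) <= w) ->
  `|ip (heat e (u (s + h - e))) eta - ip (heat h (u s)) eta + (h - e) * ip (killed s) eta|
    <= h * (2 * w) * nrm eta.
Proof.
move=> s0 e0 eh shT w0 Le kw hw.
have h0 : 0 < h by exact: lt_trans eh.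
set t := s + h - e.
have st : s <= t by rewrite /t; lra.
have tT : t <= T by rewrite /t; lra.
have tc : t < s + h by rewrite /t; lra.
(* Stopping [r] at [t] keeps the heat time at least [e], so [k r] is in L^2 and continuous in [r] on
   the whole line. *)
pose k r := heat (s + h - Num.min r t) (killed (Num.min r t)).
have m0 r : 0 < s + h - Num.min r t.
  by rewrite subr_gt0 (le_lt_trans _ tc)// ge_min lexx orbT.
pose D y := heat h (u s) y - heat e (u t) y.
have DE y : D y = \int[mu]_(r in `[s, t]) k r y.
  have := mild_point T0 cu cb Lf fu0 weak y s0 st tT tc.
  rewrite (_ : s + h - t = e); last by rewrite /t; ring.
  rewrite (_ : s + h - s = h); last by ring.
  rewrite /D => ->; rewrite opprB addrC subrK.
  by apply: eq_Rintegral => r; rewrite inE/= in_itv/= => /andP[_ rt]; rewrite /k min_l.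
have Lke r : L2 (k r) by apply: L2_heat.
have LD : L2 D by apply: L2B; apply: L2_heat.
have key : `|ip D eta - (t - s) * ip (killed s) eta| <= (t - s) * (2 * w) * nrm eta.
  apply: (@ip_average k D (killed s) eta s t (2 * w)) => //.
  - by rewrite mulr_ge0.
  - move=> y r; rewrite /k.
    have cm : {for r, continuous ((id \max cst s) \min cst t : R -> R^o)}.
      apply: continuous_min; last exact: cst_continuous.
      by apply: continuous_max; [exact: cvg_id|exact: cst_continuous].
    apply: (@continuous_comp _ R^o _ _ (fun m => heat (s + h - m) (killed m) y) r cm) => /=.
    have mt : Num.min (Num.max r s) t < s + h by rewrite (le_lt_trans _ tc)// ge_min lexx orbT.
    have H := @heat_curve_cvg killed (s + h) y (Num.min (Num.max r s) t) ck mt.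
    exact: H.
  - move=> r /andP[sr rt]; rewrite /k min_l//.
    have sr0 : 0 < s + h - r by rewrite subr_gt0 (le_lt_trans rt).
    apply: (le_trans (nrm_triangle (L2_heat sr0 (Lk r)) (L2_heat sr0 (Lk s)) (Lk s))).
    rewrite [leRHS]mulr_natl mulr2n lerD//; last by apply: hw; lra.
    rewrite -heatB// (le_trans (nrm_heat sr0 (L2B (Lk r) (Lk s))))// kw// sr/=.
    by rewrite (le_trans rt)// ltW.
rewrite -normrN [X in `|X|](_ : _ = ip D eta - (t - s) * ip (killed s) eta); last first.
  rewrite /D ipBl//; [|exact: L2_heat|exact: L2_heat].
  rewrite (_ : t - s = h - e); last by rewrite /t addrAC; ring.
  move: (ip _ _) (ip _ _) (ip _ _) => i1 i2 i3; ring.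
rewrite (le_trans key)// ler_wpM2r ?nrm_ge0// ler_wpM2r ?mulr_ge0//.
by rewrite /t; lra.
Qed.

(** The case [e = 0] of [duhamel_estimate], up to an arbitrary [a]: for small [e],
    [heat e (u (s + h - e))] is close to [u (s + h)] by strong continuity, continuity in time and
    contraction. *)
Lemma step_estimate s h w (eta : R -> R) : 0 <= s -> 0 < h -> s + h <= T -> 0 <= w ->
  L2 eta ->
  (forall r, s <= r <= s + h -> nrm (fun x => killed r x - killed s x) <= w) ->
  (forall tau, 0 < tau <= h -> nrm (fun x => heat tau (killed s) x - killed s x) <= w) ->
  `|ip (u (s + h)) eta - ip (heat h (u s)) eta + h * ip (killed s) eta|
    <= h * (2 * w) * nrm eta.
Proof.
move=> s0 h0 shT w0 Le kw hw; apply/ler_addgt0Pr => a a0.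
(* The total error is [a1 * (N - 1)]: two approximations of [u (s + h)], and the term
   [e * ip (killed s) eta] with [e <= a1]. *)
pose N := (2 + nrm (killed s)) * nrm eta + 1.
have N0 : 0 < N by rewrite ltr_wpDl// mulr_ge0 ?nrm_ge0// addr_ge0 ?nrm_ge0.
pose a1 := a / N.
have a10 : 0 < a1 by rewrite divr_gt0.
have [d d0 hd] := heat_cvg (Lu (s + h)) a10.
have /nbhs_ballP[d' /= d'0 ud] := L2_curve_near (s + h) cu a10.
pose e := Num.min (Num.min (d / 2) (d' / 2)) (Num.min (h / 2) a1).
have e0 : 0 < e by rewrite !lt_min a10 !divr_gt0.
have ed : e < d by rewrite !gt_min; apply/orP; left; apply/orP; left; lra.
have ed' : e < d' by rewrite !gt_min; apply/orP; left; apply/orP; right; lra.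
have eh : e < h by rewrite !gt_min; apply/orP; right; apply/orP; left; lra.
have ea : e <= a1 by rewrite !ge_min lexx !orbT.
have H := duhamel_estimate s0 e0 eh shT w0 Le kw hw.
have Lhe := L2_heat e0 (Lu (s + h - e)).
have close : nrm (fun x => u (s + h) x - heat e (u (s + h - e)) x) <= a1 + a1.
  apply: (le_trans (nrm_triangle (Lu _) (L2_heat e0 (Lu (s + h))) Lhe)).
  rewrite lerD//; first by rewrite nrmBC; exact: hd.
  rewrite -heatB// (le_trans (nrm_heat e0 (L2B (Lu _) (Lu _))))// nrmBC ltW// ud//.
  by rewrite /ball/= opprB addrC subrK ger0_norm// ltW.
rewrite (_ : _ + _ = (ip (heat e (u (s + h - e))) eta - ip (heat h (u s)) eta + (h - e) * ip (killed s) eta) +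
  (ip (fun x => u (s + h) x - heat e (u (s + h - e)) x) eta + e * ip (killed s) eta)); last first.
  rewrite ipBl//.
  move: (ip _ _) (ip _ _) (ip _ _) (ip _ _) => i1 i2 i3 i4; ring.
rewrite (le_trans (ler_normD _ _))// lerD// (le_trans (ler_normD _ _))//.
have c1 := cauchy_schwarz (L2B (Lu (s + h)) Lhe) Le.
have c2 := cauchy_schwarz (Lk s) Le.
rewrite normrM [`|e|]gtr0_norm//.
rewrite (@le_trans _ _ ((a1 + a1) * nrm eta + a1 * (nrm (killed s) * nrm eta)))//.
  apply: lerD; first by rewrite (le_trans c1)// ler_wpM2r ?nrm_ge0.
  by apply: ler_pM => //; exact: ltW.
rewrite (_ : _ + _ = a1 * (N - 1)); last by rewrite /N; ring.
rewrite mulrBr mulr1 [a1 * N]divfK ?gt_eqF// gerBl; exact: ltW.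
Qed.

Definition damp h s y : R := expR (- (h * \1_(`]-oo, b s]) y)).

Lemma damp_le1 h s y : 0 <= h -> `|damp h s y| <= 1.
Proof. by move=> h0; rewrite ger0_norm ?expR_ge0// -expR0 ler_expR oppr_le0 mulr_ge0. Qed.

Lemma measurable_damp h s : measurable_fun setT (damp h s).
Proof.
by apply: measurableT_comp => //; apply: measurable_funN; apply: measurable_funM.
Qed.

Lemma dampE h s y : damp h s y * u s y = u s y - (1 - expR (- h)) * killed s y.
Proof.
rewrite /damp /killed indicE; case: (_ \in _); first by rewrite mulr1 mul1r; ring.
by rewrite mulr0 oppr0 expR0 mul0r; ring.
Qed.

Lemma L2_damp h s (g : R -> R) : 0 <= h -> L2 g -> L2 (fun y => damp h s y * g y).
Proof.
move=> h0 Lg; apply: L2_Mbounded Lg; first exact: measurable_damp.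
by move=> y; exact: damp_le1.
Qed.

Lemma nrm_damp h s (g : R -> R) : 0 <= h -> L2 g -> nrm (fun y => damp h s y * g y) <= nrm g.
Proof.
move=> h0 Lg; apply: nrm_le => //; first by have [] := L2_damp s h0 Lg.
by move=> y; rewrite normrM ler_piMl// damp_le1.
Qed.

(** Three errors: [2 h w] from [step_estimate], [h w] for exchanging [killed s] with its heat flow,
    and [h^2] times the norm for replacing [h] by [1 - exp (-h)]. *)
Lemma splitting_step s h w : 0 <= s -> 0 < h -> s + h <= T -> 0 <= w ->
  (forall r, s <= r <= s + h -> nrm (fun x => killed r x - killed s x) <= w) ->
  (forall tau, 0 < tau <= h -> nrm (fun x => heat tau (killed s) x - killed s x) <= w) ->
  nrm (fun x => u (s + h) x - heat h (fun y => damp h s y * u s y) x)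
    <= 3 * h * w + h ^+ 2 * nrm (killed s).
Proof.
move=> s0 h0 shT w0 kw hw; have Lhk := L2_heat h0 (Lk s).
have Lhu := L2_heat h0 (Lu s).
have hE : heat h (fun y => damp h s y * u s y) =
    (fun x => heat h (u s) x - (1 - expR (- h)) * heat h (killed s) x).
  rewrite (_ : (fun y => _) = (fun y => u s y - (1 - expR (- h)) * killed s y)); last first.
    by apply/funext => y; rewrite dampE.
  rewrite heatB//; last exact: L2Z.
  apply/funext => x; congr (_ - _); rewrite /heat ipZr//; exact: L2_hk_sub.
apply: nrm_dual.
- by rewrite hE; apply: L2B => //; apply: L2B => //; exact: L2Z.
- by rewrite addr_ge0// mulr_ge0 ?nrm_ge0 ?sqr_ge0// mulr_ge0// ltW.
move=> eta Le; rewrite hE.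
set c := 1 - expR (- h).
have -> : ip (fun x => u (s + h) x - (heat h (u s) x - c * heat h (killed s) x)) eta =
   (ip (u (s + h)) eta - ip (heat h (u s)) eta + h * ip (killed s) eta) +
   (h * ip (fun x => heat h (killed s) x - killed s x) eta - (h - c) * ip (heat h (killed s)) eta).
  have Lck := L2Z c Lhk.
  rewrite ipBl//; last exact: L2B.
  rewrite !ipBl// ipZl//.
  move: (ip _ _) (ip _ _) (ip _ _) (ip _ _) => i1 i2 i3 i4; ring.
have H1 := step_estimate s0 h0 shT w0 Le kw hw.
have H2 := cauchy_schwarz (L2B Lhk (Lk s)) Le.
have H3 := cauchy_schwarz Lhk Le.
have H4 : nrm (fun x => heat h (killed s) x - killed s x) <= w by apply: hw; rewrite h0/=.
have H5 := nrm_heat h0 (Lk s).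
have H6 := expRN_bound (ltW h0).
have n0 := nrm_ge0 eta.
rewrite (_ : (3 * h * w + _) * _ = h * (2 * w) * nrm eta +
  (h * (w * nrm eta) + h ^+ 2 * (nrm (killed s) * nrm eta))); last by ring.
rewrite (le_trans (ler_normD _ _))// lerD// (le_trans (ler_normB _ _))// lerD// normrM.
  by rewrite [`|h|]gtr0_norm// ler_wpM2l ?(ltW h0)// (le_trans H2)// ler_wpM2r.
apply: ler_pM => //; rewrite (le_trans H3)// ler_wpM2r//.
Qed.

End StepEstimate.

(** * Convergence of the splitting scheme *)

Section Splitting.
Context {R : realType}.
Local Notation mu := (@lebesgue_measure R).
Implicit Types (s t r x y z c h e : R).

(** Compactness of [[0, T]]: since the heat semigroup contracts, its modulus at [s0] passes to
    nearby [s] at the cost of twice the distance between [w s] and [w s0]. *)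
Lemma uniform_modulus (w : R -> R -> R) (T e : R) : L2_curve w -> 0 < e ->
  exists2 d : R, 0 < d & forall s, s \in `[0, T] ->
    (forall r, `|r - s| < d -> nrm (fun x => w r x - w s x) <= e) /\
    (forall tau, 0 < tau < d -> nrm (fun x => heat tau (w s) x - w s x) <= e).
Proof.
move=> cw e0; have Lw r : L2 (w r) by have [] := cw.
pose P (d s : R) := (forall r, `|r - s| < d -> nrm (fun x => w r x - w s x) <= e) /\
    (forall tau, 0 < tau < d -> nrm (fun x => heat tau (w s) x - w s x) <= e).
have e3 : 0 < e / 3 by rewrite divr_gt0.
suff H : \forall d \near (0 : R)^'+, forall s, s \in `[0, T] -> P d s.
  have H0 : \forall d \near (0 : R)^'+, 0 < d by exact: nbhs_right_gt.
  suff [d Hd] : exists d : R, 0 < d /\ forall s, s \in `[0, T] -> P d s.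
    by exists d; [exact: Hd.1|exact: Hd.2].
  by apply: (@filter_ex _ (0 : R)^'+); apply: filterI.
have /compact_near_coveringP := @segment_compact R 0 T.
move=> /(_ R (0 : R)^'+ P).
suff H s0 : \forall s \near s0 & d \near (0 : R)^'+, P d s.
  by apply => // s0 _; exact: H.
have /nbhs_ballP[d1 /= d10 H1] := L2_curve_near s0 cw e3.
have [d2 d20 H2] := heat_cvg (Lw s0) e3.
have Hs : \forall s \near s0, `|s - s0| < d1 / 2.
  apply: (near_sub s0 (Q := fun k => `|k| < d1 / 2)).
  by apply: nbhs0_lt; rewrite divr_gt0.
have Hd : \forall d \near (0 : R)^'+, d < Num.min (d1 / 2) d2.
  by apply: nbhs_right_lt; rewrite lt_min d20 divr_gt0.
near=> s d.
have ss : `|s - s0| < d1 / 2 by near: s.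
have : d < Num.min (d1 / 2) d2 by near: d.
rewrite lt_min => /andP[dd1 dd2].
have near_s0 r : `|r - s0| < d1 -> nrm (fun x => w r x - w s0 x) <= e / 3.
  by move=> rs; apply: ltW; apply: H1; rewrite /ball/= distrC.
have ws : nrm (fun x => w s x - w s0 x) <= e / 3 by apply: near_s0; lra.
split => /= [r rs|tau /andP[tau0 taud]].
  apply: (le_trans (nrm_triangle (Lw r) (Lw s0) (Lw s))).
  have : `|r - s0| < d1.
    rewrite (_ : r - s0 = (r - s) + (s - s0)); last by ring.
    by rewrite (le_lt_trans (ler_normD _ _))//; lra.
  move=> /near_s0; rewrite [X in _ <= _ -> _ + X <= _]nrmBC; lra.
have Lh := L2_heat tau0 (Lw s); have Lh0 := L2_heat tau0 (Lw s0).
apply: (le_trans (nrm_triangle Lh Lh0 (Lw s))).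
have Hb : nrm (fun x => heat tau (w s) x - heat tau (w s0) x) <= e / 3.
  by rewrite -heatB// (le_trans (nrm_heat tau0 (L2B (Lw s) (Lw s0)))).
have := nrm_triangle Lh0 (Lw s0) (Lw s).
have := H2 tau tau0 (lt_trans taud dd2).
by rewrite [X in _ -> _ <= _ + X -> _]nrmBC; lra.
Unshelve. all: by end_near. Qed.

Variables (T : R) (f b : R -> R) (u : R -> R -> R).
Hypotheses (T0 : 0 < T) (cu : L2_curve u) (cb : continuous b) (Lf : L2 f).
Hypothesis fu0 : {ae mu, forall x, u 0 x = f x}.
Hypothesis weak : weak_pde T f b u.
Local Notation killed := (killed b u).
Local Notation damp := (damp b).

Let Lu r : L2 (u r). Proof. by have [] := cu. Qed.
Let ck : L2_curve killed. Proof. exact: L2_curve_killed. Qed.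
Let Lk r : L2 (killed r). Proof. by have [] := ck. Qed.

(** Lie-Trotter splitting: step [i] damps with the boundary frozen at its initial time [i%:R * h],
    then diffuses. *)
Definition splitting h n (g : R -> R) : R -> R :=
  iteri n (fun i v => heat h (fun y => damp h (i%:R * h) y * v y)) g.

Lemma L2_splitting h n (g : R -> R) : 0 < h -> L2 g -> L2 (splitting h n g).
Proof.
move=> h0 Lg; elim: n => [//|n IH] /=; apply: L2_heat => //.
by apply: L2_damp => //; exact: ltW.
Qed.

Lemma splitting_error h n w K : 0 < h -> n%:R * h <= T -> 0 <= w ->
  (forall s r, s \in `[0, T] -> s <= r <= s + h -> nrm (fun x => killed r x - killed s x) <= w) ->
  (forall s tau, s \in `[0, T] -> 0 < tau <= h -> nrm (fun x => heat tau (killed s) x - killed s x) <= w) ->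
  (forall s, s \in `[0, T] -> nrm (killed s) <= K) ->
  nrm (fun x => u (n%:R * h) x - splitting h n (u 0) x) <= n%:R * (3 * h * w + h ^+ 2 * K).
Proof.
move=> h0 + w0 kw hw kK; elim: n => [_|n IH nT].
  rewrite !mul0r /splitting/= (_ : (fun x => _) = fun=> 0) ?nrm0//.
  by apply/funext => x; rewrite subrr.
have nh0 : 0 <= n%:R * h by rewrite mulr_ge0// ltW.
have nhT : n%:R * h + h <= T by rewrite -natr1 mulrDl mul1r in nT.
have nI : n%:R * h \in `[0, T] by rewrite in_itv/= nh0/=; lra.
have {}IH := IH (le_trans (ler_wpDr (ltW h0) (lexx _)) nhT).
have H := splitting_step T0 cu cb Lf fu0 weak nh0 h0 nhT w0 (fun r => kw _ r nI) (fun tau => hw _ tau nI).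
rewrite -natr1 [(n%:R + 1) * h]mulrDl [(n%:R + 1) * (_ + _)]mulrDl !mul1r/=.
have LD v : L2 v -> L2 (fun y => damp h (n%:R * h) y * v y) by apply: L2_damp; exact: ltW.
have Ls := L2_splitting n h0 (Lu 0).
apply: (le_trans (nrm_triangle (Lu _) (L2_heat h0 (LD _ (Lu (n%:R * h)))) (L2_heat h0 (LD _ Ls)))).
rewrite [leRHS]addrC lerD//.
  by rewrite (le_trans H)// lerD2l ler_wpM2l ?sqr_ge0// kK.
rewrite -heatB; [|exact: h0|exact: LD|exact: LD].
rewrite (le_trans (nrm_heat h0 (L2B (LD _ (Lu _)) (LD _ Ls))))//.
under [X in nrm X]eq_fun do rewrite -mulrBr.
by rewrite (le_trans (nrm_damp _ _ (ltW h0) (L2B (Lu _) Ls))).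
Qed.

Lemma splitting_cvg t : 0 < t -> t <= T ->
  nrm (fun x => u t x - splitting (t / n.+1%:R) n.+1 (u 0) x) @[n --> \oo] --> (0 : R).
Proof.
move=> t0 tT.
have [K K0 kK] : exists2 K, 0 < K & forall s, s \in `[0, T] -> nrm (killed s) <= K.
  have /compact_bounded[M [_ HM]] : compact ((fun s => nrm (killed s)) @` `[0, T]%classic).
    apply: continuous_compact; last exact: segment_compact.
    by apply: continuous_subspaceT; exact: L2_curve_nrm.
  exists (`|M| + 1); first by rewrite ltr_wpDl.
  move=> s sT; rewrite (le_trans (ler_norm _))// (HM (`|M| + 1))//.
    by rewrite (le_lt_trans (ler_norm _))// ltrDl.
  by exists s.
apply/cvgrPdist_le => e e0.
(* With [n.+1%:R * h = t] the total error is [3 t w + t h K]: this [w] makes the first term [e / 2],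
   and [h <= e / (2 t K)] bounds the second. *)
pose w := e / (6 * t).
have w0 : 0 < w by rewrite divr_gt0// mulr_gt0.
have [d d0 Hd] := uniform_modulus T ck w0.
have hn : t / n.+1%:R @[n --> \oo] --> (0 : R).
  rewrite -(mulr0 t); apply: cvgM; [exact: cvg_cst|exact: cvg_harmonic].
near=> n.
have hd : t / n.+1%:R < d by near: n; exact: (cvgr_lt 0 hn).
have hK : t / n.+1%:R <= e / (2 * t * K).
  by near: n; apply: (cvgr_le 0 hn); rewrite divr_gt0// !mulr_gt0.
move: hd hK; set h := t / n.+1%:R => hd hK.
have h0 : 0 < h by rewrite divr_gt0.
have nh : n.+1%:R * h = t by rewrite /h mulrC divfK.
rewrite sub0r normrN ger0_norm ?nrm_ge0//.
have := @splitting_error h n.+1 w K h0.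
rewrite nh => /(_ tT (ltW w0)) H.
apply: (le_trans (H _ _ kK)).
- move=> s r sT /andP[r1 r2]; apply: (Hd s sT).1; rewrite ger0_norm ?subr_ge0//; lra.
- move=> s tau sT /andP[r1 r2]; apply: (Hd s sT).2; rewrite r1/=; lra.
rewrite (_ : _ * _ = t * (3 * w) + t * h * K); last first.
  by rewrite -nh; ring.
have -> : t * (3 * w) = e / 2 by rewrite /w; field; rewrite gt_eqF.
rewrite -lerBrDl (le_trans (y := t * (e / (2 * t * K)) * K))//.
  by rewrite ler_wpM2r ?(ltW K0)// ler_wpM2l// ltW.
rewrite le_eqVlt; apply/orP; left; apply/eqP; field.
by rewrite !gt_eqF.
Unshelve. all: by end_near. Qed.

End Splitting.

(** * Weighted Gaussian random walks *)

Section Density.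
Local Open Scope ereal_scope.
Context d (T : measurableType d) (R : realType).
Variables (m n : {measure set T -> \bar R}) (W : T -> R).
Hypotheses (mW : measurable_fun setT W) (W0 : forall x, (0 <= W x)%R).
Hypothesis nE : forall E, measurable E -> n E = \int[m]_(x in E) (W x)%:E.

Import HBNNSimple.

Let integral_density_nnsfun (h : {nnsfun T >-> R}) :
  \int[n]_x (h x)%:E = \int[m]_x ((h x)%:E * (W x)%:E).
Proof.
under [LHS]eq_integral do rewrite fimfunE -fsumEFin//.
rewrite [LHS]ge0_integral_fsum//; last 2 first.
  - by move=> r; exact/measurable_EFinP/measurableT_comp.
  - by move=> r x _; rewrite EFinM nnfun_muleindic_ge0.
under [RHS]eq_integral.
  move=> x _; rewrite fimfunE -fsumEFin// muleC ge0_mule_fsumr; last first.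
    by move=> r; rewrite EFinM nnfun_muleindic_ge0.
  over.
rewrite [RHS]ge0_integral_fsum//; last 2 first.
  - by move=> r; apply: emeasurable_funM; [exact/measurable_EFinP|exact/measurable_EFinP/measurableT_comp].
  - by move=> r x _; rewrite mule_ge0 ?lee_fin// -lee_fin EFinM nnfun_muleindic_ge0.
apply: eq_fsbigr => r _.
have [r0|r0] := ltP r 0%R.
  rewrite !integral0_eq// => x _; rewrite preimage_nnfun0//= indicE in_set0 mulr0//.
  by rewrite mule0.
have mh : measurable (h @^-1` [set r]) by [].
under eq_integral do rewrite EFinM.
rewrite ge0_integralZl//; last exact/measurable_EFinP.
rewrite integral_indic// setIT nE//.
under [RHS]eq_integral do rewrite EFinM muleCA.
rewrite ge0_integralZl//; last 2 first.
  - by apply: emeasurable_funM; [exact/measurable_EFinP|exact/measurable_EFinP].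
  - by move=> x _; rewrite mule_ge0// lee_fin.
congr (_ * _); rewrite integral_mkcond; apply: eq_integral => x _.
by rewrite patchE indicE; case: ifP => _; rewrite ?mule1 ?mule0.
Qed.

(** Extends the density formula from sets to nonnegative functions by simple functions and monotone
    convergence. *)
Lemma ge0_integral_density (f : T -> \bar R) : measurable_fun setT f ->
  (forall x, 0 <= f x) -> \int[n]_x f x = \int[m]_x (f x * (W x)%:E).
Proof.
move=> mf f0; pose f_ := nnsfun_approx measurableT mf.
transitivity (limn (fun k => \int[n]_x (f_ k x)%:E)).
  rewrite -monotone_convergence//=.
  - apply: eq_integral => x _; apply/esym/cvg_lim => //=.
    exact: cvg_nnsfun_approx.
  - by move=> k; exact/measurable_EFinP.
  - by move=> k x _; rewrite lee_fin.
  - by move=> x _ a b ab; rewrite lee_fin//; exact/lefP/nd_nnsfun_approx.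
rewrite (_ : \int[m]_x _ = limn (fun k => \int[m]_x ((f_ k x)%:E * (W x)%:E))); last first.
  rewrite -monotone_convergence//=.
  - apply: eq_integral => x _; apply/esym/cvg_lim => //.
    by apply: cvgeZr => //; exact: cvg_nnsfun_approx.
  - by move=> k; apply: emeasurable_funM; exact/measurable_EFinP.
  - by move=> k x _; rewrite mule_ge0// lee_fin.
  - move=> x _ a b ab; apply: lee_wpmul2r; rewrite ?lee_fin//.
    exact/lefP/nd_nnsfun_approx.
by congr (limn _); apply/funext => k; rewrite integral_density_nnsfun.
Qed.

End Density.

(** * One step of a recursively defined process with independent increments *)

Section Independence.
Context d d' (Omega : measurableType d) (S : measurableType d') (R : realType).
Variable P : probability Omega R.
Variables (Y : nat -> Omega -> R) (n : nat).
Hypothesis mY : forall i, measurable_fun setT (Y i).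
Hypothesis indepY : forall A : nat -> set R, (forall i, measurable (A i)) ->
  P (\bigcap_(i < n) (Y i @^-1` A i)) = (\prod_(i < n) P (Y i @^-1` A i))%E.

Let mYA i (A : set R) : measurable A -> measurable (Y i @^-1` A).
Proof. by move=> mA; rewrite -[X in measurable X]setTI; exact: mY. Qed.

Variables (Z : nat -> Omega -> S) (Phi : nat -> S * R -> S) (z0 : S).
Hypothesis mPhi : forall k, measurable_fun [set: S * measurableTypeR R] (Phi k).
Hypothesis Z0 : forall w, Z 0 w = z0.
Hypothesis ZS : forall k w, Z k.+1 w = Phi k (Z k w, Y k w).

Lemma measurable_state k : measurable_fun setT (Z k).
Proof.
elim: k => [|k IH].
  by rewrite (_ : Z 0 = cst z0)//; apply/funext => w; exact: Z0.
rewrite (_ : Z k.+1 = Phi k \o (fun w => (Z k w, Y k w))); last exact/funext/ZS.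
exact: (measurableT_comp (mPhi k) (measurable_fun_pair IH (mY k))).
Qed.

Let mpair k : measurable_fun setT (fun w => (Z k w, Y k w : measurableTypeR R)).
Proof. by apply: measurable_fun_pair; [exact: measurable_state|exact: mY]. Qed.

Let event (A : nat -> set R) := \bigcap_(i < n) (Y i @^-1` A i).

Let mevent A : (forall i, measurable (A i)) -> measurable (event A).
Proof. by move=> mA; apply: bigcap_measurableType => i _; exact: mYA. Qed.

(** Adds the condition [B] on [Y k] to an event that leaves [Y k] free. *)
Let upd (A : nat -> set R) k B i := if i == k then B else A i.

Let event_upd A k B : (k < n)%N -> A k = setT ->
  event (upd A k B) = (Y k @^-1` B) `&` event A.
Proof.
move=> kn Ak; apply/seteqP; split => w /=.
  move=> H; split.
    by have := H k kn; rewrite /upd eqxx.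
  move=> i /= ni; have := H i ni; rewrite /upd; case: eqP => [->|//].
  by rewrite Ak.
move=> [wB H] i /= ni; rewrite /upd; case: eqP => [->//|_]; exact: H.
Qed.

Let prob_upd A k B : (k < n)%N -> A k = setT ->
  (\prod_(i < n) P (Y i @^-1` upd A k B i) =
   P (Y k @^-1` B) * \prod_(i < n) P (Y i @^-1` A i))%E.
Proof.
move=> kn Ak; rewrite (bigD1 (Ordinal kn))//= [in RHS](bigD1 (Ordinal kn))//=.
rewrite Ak preimage_setT probability_setT mul1e /upd eqxx; congr (_ * _)%E.
by apply: eq_bigr => i /negP ik; case: eqP => // ik'; case: ik; apply/eqP/val_inj.
Qed.

(** The state [Z k] is built from the [Y i] with [i < k], and the event constrains only the others.
    Induction on [k], for all events, replaces generated sigma-algebras: [Z k.+1] is a function of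
    [(Z k, Y k)], and rectangles determine the law of this pair. *)
Lemma past_future_indep k (E : set S) (A : nat -> set R) : (k <= n)%N ->
  measurable E -> (forall i, measurable (A i)) -> (forall i, (i < k)%N -> A i = setT) ->
  (P (Z k @^-1` E `&` event A) = P (Z k @^-1` E) * \prod_(i < n) P (Y i @^-1` A i))%E.
Proof.
elim: k E A => [|k IH] E A kn mE mA AT.
  have [z0E|z0E] := pselect (E z0).
    have -> : Z 0 @^-1` E = setT by apply/seteqP; split => // w _ /=; rewrite Z0.
    by rewrite setTI probability_setT mul1e indepY.
  have -> : Z 0 @^-1` E = set0 by apply/seteqP; split => // w /=; rewrite Z0.
  by rewrite set0I measure0 mul0e.
have mT (i : nat) : measurable ((fun=> setT) i : set R) by [].
have mupd A' B i : (forall i, measurable (A' i)) -> measurable B -> measurable (upd A' k B i).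
  by move=> mA' mB; rewrite /upd; case: ifP.
have Ak : A k = setT by exact: AT.
have AT' i : (i < k)%N -> A i = setT by move=> ik; apply: AT; rewrite ltnW.
pose p := (\prod_(i < n) P (Y i @^-1` A i))%E.
have p_fin : p \is a fin_num.
  apply: (big_ind (fun x => x \is a fin_num)) => //.
    by move=> x y; exact: fin_numM.
  by move=> i _; apply: fin_num_measure; exact: mYA.
have p0 : 0 <= fine p by apply: fine_ge0; apply: prode_ge0 => i _.
pose ZY : {mfun Omega >-> (S * measurableTypeR R)%type} :=
  HB.pack (fun w => (Z k w, Y k w : measurableTypeR R)) (isMeasurableFun.Build _ _ _ _ _ (mpair k)).
(* The law of [(Z k, Y k)] on the event, to be compared with [p] times its full law. On a rectangle
   both follow from the induction hypothesis, with the condition on [Y k] moved into the event. *)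
pose m1h : {measure set (S * measurableTypeR R) -> \bar R} := pushforward (mrestr P (mevent mA)) ZY.
pose m1 := m1h (mpair k).
pose m2 : {measure set (S * measurableTypeR R) -> \bar R} := mscale (NngNum p0) (distribution P ZY).
have m12 F : measurable F -> m1 F = m2 F.
  pose C : set (set (S * measurableTypeR R)) :=
    [set C | exists A, measurable A /\ exists B, measurable B /\ C = A `*` B].
  move=> mF; apply: (measure_unique C (fun=> setT)) => //.
  - rewrite measurable_prod_measurableType //; congr (<<s _ >>).
    rewrite predeqE; split => [[D mD [B mB <-]]|[D [mD [B [mB ->]]]]].
      by exists D; split => //; exists B.
    by exists D => //; exists B.
  - move=> /= _ _ [X1 [mX1 [X2 [mX2 ->]]]] [Y1 [mY1 [Y2 [mY2 ->]]]].
    rewrite -setXI; exists (X1 `&` Y1); split; first exact: measurableI.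
    by exists (X2 `&` Y2); split => //; exact: measurableI.
  - move=> _; exists setT; split => //; exists setT; split => //.
    by rewrite setXTT.
  - by rewrite bigcup_const.
  - move=> _ [D [mD [B [mB ->]]]].
    rewrite /m1 /m2 /= /mscale /pushforward /mrestr /distribution /pushforward /=.
    have ZYE : (fun w => (Z k w, Y k w)) @^-1` (D `*` B) = Z k @^-1` D `&` Y k @^-1` B.
      by [].
    rewrite ZYE fineK// -setIA -event_upd//.
    rewrite (IH D (upd A k B))//; [|exact: ltnW|move=> i; exact: mupd|]; last first.
      by move=> i ik; rewrite /upd ltn_eqF// AT'.
    rewrite prob_upd// -/p.
    have -> : distribution P ZY (D `*` B) = (P (Z k @^-1` D) * P (Y k @^-1` B))%E.
      have -> : distribution P ZY (D `*` B) = P (Z k @^-1` D `&` Y k @^-1` B) by [].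
      have eT : event (fun=> setT) = setT by apply/seteqP; split.
      have := IH D (upd (fun=> setT) k B) (ltnW kn) mD (fun i => mupd _ B i mT mB).
      rewrite event_upd// prob_upd// eT setIT => -> //; last first.
        by move=> i ik; rewrite /upd ltn_eqF.
      rewrite (big1 _ _ (fun i : 'I_n => P (Y i @^-1` setT))) ?mule1// => i _.
      by rewrite preimage_setT probability_setT.
    by rewrite muleA muleC.
  - move=> _; rewrite /m1 /= /pushforward /mrestr /=.
    by rewrite preimage_setT setTI (le_lt_trans (probability_le1 P (mevent mA))) ?ltry.
have mPE : measurable (Phi k @^-1` E) by rewrite -[X in measurable X]setTI; exact: mPhi.
have := m12 _ mPE; rewrite /m1 /m2 /= /mscale /pushforward /mrestr /distribution /pushforward /=.
rewrite fineK// muleC.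
have -> : (fun w => (Z k w, Y k w)) @^-1` (Phi k @^-1` E) = Z k.+1 @^-1` E.
  by apply/seteqP; split => w /=; rewrite ZS.
move=> ->; congr (_ * _)%E.
have -> : Z k.+1 @^-1` E = (fun w => (Z k w, Y k w)) @^-1` (Phi k @^-1` E).
  by apply/seteqP; split => w /=; rewrite ZS.
by [].
Qed.

(** By [past_future_indep] the law of [(Z k, Y k)] is a product measure, so Tonelli applies. *)
Lemma expectation_step k (nu : probability (measurableTypeR R) R) (psi : S * R -> \bar R) :
  (k < n)%N -> measurable_fun [set: S * measurableTypeR R] psi -> (forall z, 0 <= psi z)%E ->
  (forall A, measurable A -> P (Y k @^-1` A) = nu A) ->
  (\int[P]_w psi (Z k w, Y k w) = \int[P]_w \int[nu]_y psi (Z k w, y))%E.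
Proof.
move=> kn mpsi psi0 lawY.
pose Zk : {mfun Omega >-> S} := HB.pack (Z k) (isMeasurableFun.Build _ _ _ _ _ (measurable_state k)).
pose ZY : {mfun Omega >-> (S * measurableTypeR R)%type} :=
  HB.pack (fun w => (Z k w, Y k w : measurableTypeR R)) (isMeasurableFun.Build _ _ _ _ _ (mpair k)).
transitivity (\int[distribution P ZY]_z psi z)%E.
  by rewrite ge0_integral_distribution.
rewrite (_ : integral _ _ _ = \int[(distribution P Zk \x nu)]_z psi z)%E; last first.
  apply: eq_measure_integral => //= F mF _; apply/esym.
  apply: (product_measure_unique (m1 := distribution P Zk) (m2 := nu) (m' := distribution P ZY)) => // D B mD mB.
  rewrite /distribution /pushforward /=.
  have mupd i : measurable (upd (fun=> setT) k B i) by rewrite /upd; case: ifP.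
  have := past_future_indep (ltnW kn) mD mupd.
  have eT : event (fun=> setT) = setT by apply/seteqP; split.
  rewrite event_upd// prob_upd// eT setIT (big1 _ _ (fun i : 'I_n => P (Y i @^-1` setT))).
    rewrite mule1 lawY//; apply => i ik; rewrite /upd ltn_eqF//.
  by move=> i _; rewrite preimage_setT probability_setT.
rewrite fubini_tonelli1//.
rewrite ge0_integral_distribution//; last by move=> z; exact: integral_ge0.
by apply: measurable_fun_fubini_tonelli_F.
Qed.

End Independence.

(** * The heat semigroup on nonnegative extended functions *)

Section ExtendedHeat.
Context {R : realType}.
Local Notation mu := (@lebesgue_measure R).
Local Open Scope ereal_scope.
Implicit Types (h : R) (psi : R -> \bar R).

(** On nonnegative extended functions Tonelli and duality hold unconditionally; [eheat_EFin] returns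
    to [heat]. *)
Definition eheat h psi (x : R) : \bar R := \int[mu]_y ((hk h (x - y)%R)%:E * psi y).

Lemma measurable_eheat h psi : measurable_fun setT psi -> (forall x, 0 <= psi x) ->
  measurable_fun setT (eheat h psi).
Proof.
move=> mpsi psi0.
apply: (@measurable_fun_fubini_tonelli_F _ _ (measurableTypeR R) (measurableTypeR R) R mu
  (fun p => (hk h (p.1 - p.2)%R)%:E * psi p.2)).
  apply: emeasurable_funM; first by apply/measurable_EFinP; exact: measurable_hk_diff.
  by apply: (measurableT_comp mpsi); exact: measurable_snd.
by move=> p; rewrite mule_ge0// lee_fin hk_ge0.
Qed.

Lemma eheat_ge0 h psi x : (forall x, 0 <= psi x) -> 0 <= eheat h psi x.
Proof. by move=> psi0; apply: integral_ge0 => y _; rewrite mule_ge0// lee_fin hk_ge0. Qed.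

Lemma eheat_sym h psi phi : measurable_fun setT psi -> measurable_fun setT phi ->
  (forall x, 0 <= psi x) -> (forall x, 0 <= phi x) ->
  \int[mu]_x (eheat h psi x * phi x) = \int[mu]_x (psi x * eheat h phi x).
Proof.
move=> mpsi mphi psi0 phi0.
have mhk (z : R) : measurable_fun setT (fun y : R => (hk h (z - y)%R)%:E).
  apply/measurable_EFinP; apply: (measurableT_comp (@measurable_hk R h)).
  exact: measurable_funB.
have hk0 x y : 0 <= (hk h (x - y)%R)%:E by rewrite lee_fin hk_ge0.
pose k (p : R * R) := (hk h (p.1 - p.2)%R)%:E * (psi p.2 * phi p.1).
transitivity (\int[mu]_x \int[mu]_y k (x, y)).
  apply: eq_integral => x _; rewrite -ge0_integralZr//.
  - by apply: eq_integral => y _; rewrite /k muleA.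
  - exact: emeasurable_funM (mhk x) mpsi.
  - by move=> y _; rewrite mule_ge0.
rewrite lebesgue_tonelli; last 2 first.
- apply: emeasurable_funM; first by apply/measurable_EFinP; exact: measurable_hk_diff.
  apply: emeasurable_funM; first by apply: (measurableT_comp mpsi); exact: measurable_snd.
  by apply: (measurableT_comp mphi); exact: measurable_fst.
- by move=> p; rewrite !mule_ge0.
apply: eq_integral => y _; rewrite /eheat -ge0_integralZl//.
- by apply: eq_integral => x _; rewrite /k /= muleCA hk_subC.
- exact: emeasurable_funM (mhk y) mphi.
- by move=> x _; rewrite mule_ge0.
Qed.

Lemma eheat_normal h psi x : (0 < h)%R -> measurable_fun setT psi -> (forall x, 0 <= psi x) ->
  \int[normal_prob 0 (Num.sqrt h)]_y psi (x + y)%R = eheat h psi x.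
Proof.
move=> h0 mpsi psi0.
have mpx : measurable_fun setT (fun y => psi (x + y)%R).
  by apply: (measurableT_comp mpsi); exact: measurable_funD.
transitivity (\int[mu]_y (psi (x + y)%R * (hk h y)%:E)).
  apply: (@ge0_integral_density _ (measurableTypeR R) R mu (normal_prob 0 (Num.sqrt h)) (hk h)) => //.
  - exact: measurable_hk.
  - by move=> z; exact: hk_ge0.
  - by move=> E mE; rewrite /normal_prob hk_pdf.
rewrite /eheat -[RHS](ge0_integral_shift x).
  + apply: eq_integral => y _.
    have -> : (x - (y + x) = - y)%R by ring.
    by rewrite hkN muleC addrC.
  + have mhk : measurable_fun setT (fun y : R => (hk h (x - y)%R)%:E).
      apply/measurable_EFinP; apply: (measurableT_comp (@measurable_hk R h)).
      exact: measurable_funB.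
    exact: emeasurable_funM mhk mpsi.
  + by move=> y; rewrite mule_ge0// lee_fin hk_ge0.
Qed.

Lemma eheat_EFin h (g : R -> R) x : (0 < h)%R -> L2 g ->
  eheat h (fun y => (g y)%:E) x = (heat h g x)%:E.
Proof.
move=> h0 Lg; rewrite /eheat /heat /ip EFin_Rintegral//.
exact: L2_mul (L2_hk_sub x h0) Lg.
Qed.

End ExtendedHeat.

(** * Weighted expectations along a Gaussian walk *)

Section Chain.
Context d (Omega : measurableType d) (R : realType).
Variable P : probability Omega R.
Variables (Y X : nat -> Omega -> R) (n : nat) (h x : R) (alpha beta : nat -> R -> R).
Hypothesis h0 : 0 < h.
Hypothesis mY : forall i, measurable_fun setT (Y i).
Hypothesis indepY : forall A : nat -> set R, (forall i, measurable (A i)) ->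
  P (\bigcap_(i < n) (Y i @^-1` A i)) = (\prod_(i < n) P (Y i @^-1` A i))%E.
Hypothesis lawY : forall i (A : set R), measurable A ->
  P (Y i @^-1` A) = normal_prob 0 (Num.sqrt h) A.
Hypothesis X0 : forall w, X 0 w = x.
Hypothesis XS : forall i w, X i.+1 w = X i w + Y i w.
Hypothesis malpha : forall i, measurable_fun setT (alpha i).
Hypothesis mbeta : forall i, measurable_fun setT (beta i).
Hypothesis alpha0 : forall i z, 0 <= alpha i z.
Hypothesis beta0 : forall i z, 0 <= beta i z.

(* [chain k psi x] is the expectation of [weight k * psi (X k)]; taking
   [beta = 1] or [alpha = 1] damps before or after each step of the walk, which
   gives the forward and the time-reversed form of the functional. *)
Fixpoint chain k (psi : R -> \bar R) : R -> \bar R :=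
  if k is k'.+1 then
    chain k' (fun z => (alpha k' z)%:E * eheat h (fun y => (beta k' y)%:E * psi y) z)%E
  else psi.

Definition weight k w := \prod_(i < k) (alpha i (X i w) * beta i (X i.+1 w)).

(** The state fed to [expectation_step] is the pair of accumulated weight and position. The last
    increment is integrated out first, which changes [psi]; hence the induction over all [psi]. *)
Lemma chain_expectation k (psi : R -> \bar R) : (k <= n)%N -> measurable_fun setT psi ->
  (forall z, 0 <= psi z)%E ->
  (\int[P]_w ((weight k w)%:E * psi (X k w)) = chain k psi x)%E.
Proof.
elim: k psi => [|k IH] psi kn mpsi psi0.
  under eq_integral do rewrite /weight big_ord0 mul1e X0.
  by rewrite integral_cst// [X in (_ * X)%E](_ : _ = 1%E) ?mule1//; exact: probability_setT.
pose Phi k (p : (R * R) * R) : R * R :=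
  (p.1.1 * (alpha k p.1.2 * beta k (p.1.2 + p.2)), p.1.2 + p.2).
pose Z k w := (weight k w, X k w).
have mT1 : measurable_fun setT (fun p : (measurableTypeR R * measurableTypeR R) * measurableTypeR R => p.1.1).
  by apply: (measurableT_comp measurable_fst); exact: measurable_fst.
have mT2 : measurable_fun setT (fun p : (measurableTypeR R * measurableTypeR R) * measurableTypeR R => p.1.2).
  by apply: (measurableT_comp measurable_snd); exact: measurable_fst.
have mT3 : measurable_fun setT (fun p : (measurableTypeR R * measurableTypeR R) * measurableTypeR R => p.1.2 + p.2).
  by apply: measurable_funD => //; exact: measurable_snd.
have mw j : measurable_fun setT (fun p : (measurableTypeR R * measurableTypeR R) * measurableTypeR R =>
    p.1.1 * (alpha j p.1.2 * beta j (p.1.2 + p.2))).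
  apply: measurable_funM => //; apply: measurable_funM.
    exact: (measurableT_comp (malpha j)).
  exact: (measurableT_comp (mbeta j)).
have mPhi j : measurable_fun [set: (measurableTypeR R * measurableTypeR R) * measurableTypeR R] (Phi j).
  exact: measurable_fun_pair.
pose g z := ((alpha k z)%:E * eheat h (fun y => (beta k y)%:E * psi y) z)%E.
have mbp : measurable_fun setT (fun y => (beta k y)%:E * psi y)%E.
  by apply: emeasurable_funM => //; exact/measurable_EFinP.
have bp0 y : (0 <= (beta k y)%:E * psi y)%E by rewrite mule_ge0// lee_fin.
rewrite /= -[RHS]/(chain k g x) -IH//; last 3 first.
- exact: ltnW.
- by apply: emeasurable_funM; [exact/measurable_EFinP|exact: measurable_eheat].
- by move=> z; rewrite mule_ge0 ?lee_fin// eheat_ge0.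
(* [expectation_step] asks for nonnegativity on the whole state space, but the weight coordinate is
   nonnegative only along the process; hence the absolute value. *)
pose F (p : (R * R) * R) : \bar R :=
  (`|p.1.1 * (alpha k p.1.2 * beta k (p.1.2 + p.2))|%:E * psi (p.1.2 + p.2)%R)%E.
have mF : measurable_fun [set: (measurableTypeR R * measurableTypeR R) * measurableTypeR R] F.
  apply: emeasurable_funM; last exact: (measurableT_comp mpsi).
  by apply/measurable_EFinP; apply: (measurableT_comp (@normr_measurable R setT)).
have F0 p : (0 <= F p)%E by rewrite mule_ge0// lee_fin.
have w0 j w : 0 <= weight j w by apply: prodr_ge0 => i _; rewrite mulr_ge0.
have := @expectation_step _ _ Omega (measurableTypeR R * measurableTypeR R)%type R P Y n mY indepY
  Z Phi (1, x) mPhi _ _ k (normal_prob 0 (Num.sqrt h)) F kn mF F0 (lawY k).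
rewrite /F /Z /= => H.
transitivity (\int[P]_w (`|weight k w * (alpha k (X k w) * beta k (X k w + Y k w))|%:E *
    psi (X k w + Y k w)%R))%E.
  apply: eq_integral => w _; rewrite -XS ger0_norm ?mulr_ge0//.
  by rewrite /weight big_ord_recr.
rewrite H; last 2 first.
- by move=> w; rewrite /weight big_ord0 X0.
- by move=> j w; rewrite /weight big_ord_recr/= XS.
apply: eq_integral => w _.
have mpX : measurable_fun setT (fun y : R => ((beta k (X k w + y)%R)%:E * psi (X k w + y)%R)%E).
  by apply: (measurableT_comp mbp); exact: measurable_funD.
rewrite /g -(eheat_normal _ h0 mbp bp0) muleA -EFinM -ge0_integralZl//; last first.
  first [by rewrite lee_fin mulr_ge0|by move=> y _; exact: (bp0 (X k w + y))].
apply: eq_integral => y _.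
by rewrite ger0_norm ?mulr_ge0// muleA -EFinM mulrA.
Qed.

End Chain.

(** * Occupation times *)

Section SplittingChain.
Context {R : realType}.
Local Notation mu := (@lebesgue_measure R).
Variables (b f : R -> R) (h : R).
Hypotheses (h0 : 0 < h) (Lf : L2 f) (f0 : forall x, 0 <= f x).

Lemma damp_ge0 s y : 0 <= damp b h s y.
Proof. exact: expR_ge0. Qed.

Lemma heat_ge0 t (g : R -> R) x : (forall y, 0 <= g y) -> 0 <= heat t g x.
Proof. by move=> g0; apply: Rintegral_ge0 => y _; rewrite mulr_ge0// hk_ge0. Qed.

Lemma splitting_ge0 n x : 0 <= splitting b h n f x.
Proof.
by elim: n x => [//|n IH] x /=; apply: heat_ge0 => y; rewrite mulr_ge0// damp_ge0.
Qed.

(** The outermost step of the splitting is the first step of the walk, so walk step [j] meets the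
    boundary of index [n.-1 - j]; the damping acts inside the heat operator, at the point where the
    walk arrives. *)
Lemma splitting_chain n k x : (k <= n)%N ->
  chain h (fun _ _ => 1) (fun j => damp b h ((n.-1 - j)%:R * h)) k
    (fun y => (splitting b h (n - k) f y)%:E) x = (splitting b h n f x)%:E.
Proof.
elim: k => [|k IH] kn; first by rewrite subn0.
rewrite -IH; last exact: ltnW.
rewrite [LHS]/=; congr (chain _ _ _ _ _ _); apply/funext => z.
rewrite mul1e.
have -> : (n - k)%N = (n.-1 - k).+1 by case: n kn {IH} => [//|n] kn /=; rewrite subSn.
have -> : (n - k.+1)%N = (n.-1 - k)%N by case: n kn {IH}.
rewrite /= -eheat_EFin//; last by apply: L2_damp; [exact: ltW|exact: L2_splitting].
Qed.

(** Heat and damping are both symmetric, so they pass to [psi] in the opposite order: walk step [j]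
    now meets the boundary of index [j], before moving. *)
Lemma splitting_dual n (psi : R -> \bar R) : measurable_fun setT psi ->
  (forall x, 0 <= psi x)%E ->
  (\int[mu]_x ((splitting b h n f x)%:E * psi x) =
   \int[mu]_x ((f x)%:E *
     chain h (fun j => damp b h (j%:R * h)) (fun _ _ => 1%R) n psi x))%E.
Proof.
elim: n psi => [//|n IH] psi mpsi psi0.
have Ls : L2 (splitting b h n f) by exact: L2_splitting.
have LD := L2_damp b (n%:R * h) (ltW h0) Ls.
have md : measurable_fun setT (fun z => (damp b h (n%:R * h) z)%:E).
  by apply/measurable_EFinP; exact: measurable_damp.
have mh : measurable_fun setT (eheat h psi) by exact: measurable_eheat.
rewrite [RHS]/= (_ : (fun z => _) = (fun z => (damp b h (n%:R * h) z)%:E * eheat h psi z)%E); last first.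
  by apply/funext => z; congr (_ * _)%E; congr eheat; apply/funext => y; rewrite mul1e.
rewrite -IH; last 2 first.
- exact: emeasurable_funM.
- by move=> z; rewrite mule_ge0 ?lee_fin ?damp_ge0// eheat_ge0.
rewrite [LHS](_ : _ = \int[mu]_x (eheat h (fun y => (damp b h (n%:R * h) y * splitting b h n f y)%:E) x * psi x))%E; last first.
  by apply: eq_integral => x _; rewrite eheat_EFin.
rewrite eheat_sym//; last 2 first.
- by apply/measurable_EFinP; exact: LD.1.
- by move=> x; rewrite lee_fin mulr_ge0 ?damp_ge0 ?splitting_ge0.
by apply: eq_integral => x _; rewrite muleA -EFinM mulrC.
Qed.

Lemma nrm_splittingB n (g1 g2 : R -> R) : L2 g1 -> L2 g2 ->
  nrm (fun x => splitting b h n g1 x - splitting b h n g2 x) <= nrm (fun x => g1 x - g2 x).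
Proof.
move=> L1 L2'; elim: n => [//|n]; apply: le_trans => /=.
have Ls1 := L2_splitting b n h0 L1; have Ls2 := L2_splitting b n h0 L2'.
have D1 := L2_damp b (n%:R * h) (ltW h0) Ls1; have D2 := L2_damp b (n%:R * h) (ltW h0) Ls2.
rewrite -heatB// (le_trans (nrm_heat h0 (L2B D1 D2)))//.
under [X in nrm X]eq_fun do rewrite -mulrBr.
by rewrite nrm_damp//; [exact: ltW|exact: L2B].
Qed.

End SplittingChain.

(** * Riemann sums and continuity of the occupation time *)

Section Occupation.
Context {R : realType}.
Local Notation mu := (@lebesgue_measure R).
Implicit Types (F : R -> R) (t : R).

Definition occupation F t : R := \int[mu]_(s in `[0, t]) \1_(`]-oo, 0]) (F s).

Definition riemann_occupation F t n : R :=
  t / n.+1%:R * \sum_(i < n.+1) \1_(`]-oo, 0]) (F (i%:R * (t / n.+1%:R))).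

Lemma indic_norm_le1 (A : set R) (x : R) : `|\1_A x : R| <= 1.
Proof. by rewrite indicE; case: (_ \in _); rewrite ?normr1 ?normr0 ?ler01. Qed.

Lemma truncn_cell (h s : R) k : 0 < h -> k%:R * h <= s < k.+1%:R * h ->
  Num.truncn (s / h) = k.
Proof. by move=> h0 /andP[s1 s2]; apply: truncn_def; rewrite ler_pdivlMr// ltr_pdivrMr// s1. Qed.

Lemma measurable_truncn (phi : nat -> R) (h : R) : 0 < h ->
  measurable_fun [set: measurableTypeR R] (fun s => phi (Num.truncn (s / h))).
Proof.
move=> h0 _ A mA; rewrite setTI.
pose q (s : R) := Num.truncn (s / h).
rewrite (_ : _ @^-1` A = \bigcup_(m in phi @^-1` A) (q @^-1` [set m])); last first.
  apply/seteqP; split => [s /= As|s [m /= Am qs]]; first by exists (q s).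
  by move: Am; rewrite -qs.
apply: bigcup_measurable => -[_|m _].
  (* [Num.truncn] is 0 on negative numbers, so the first cell extends to the left without bound. *)
  rewrite (_ : _ @^-1` _ = `]-oo, h[%classic); first exact: measurable_itv.
  have qE s : (q s <= 0)%N = (s < h) by rewrite truncn_le_nat ltr_pdivrMr// mul1r.
  apply/seteqP; split => s /=; rewrite in_itv/= -qE; first by move=> ->.
  by rewrite leqn0 => /eqP.
rewrite (_ : _ @^-1` _ = `[m.+1%:R * h, m.+2%:R * h[%classic); first exact: measurable_itv.
apply/seteqP; split => s /=; rewrite in_itv/=; last exact: truncn_cell.
move=> qs; have := truncn_gt_nat (s / h) m; rewrite -/(q s) qs ltnSn => /esym s1.
have s0 : 0 <= s / h by rewrite (le_trans _ s1).
by have := truncn_itv s0; rewrite -/(q s) qs ler_pdivlMr// ltr_pdivrMr.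
Qed.

Lemma bounded_integrable (D : set (measurableTypeR R)) (g : R -> R) : measurable D ->
  (mu D < +oo)%E -> measurable_fun [set: measurableTypeR R] g -> (forall x, `|g x| <= 1) ->
  mu.-integrable D (EFin \o g).
Proof.
move=> mD muD mg g1; apply/integrableP; split.
  by apply/measurable_EFinP; exact: measurable_funTS.
apply: (@le_lt_trans _ _ (\int[mu]_(x in D) (cst 1%E x))%E).
  apply: ge0_le_integral => //.
  - apply/measurable_EFinP; apply: measurable_funTS.
    exact: (measurableT_comp (@normr_measurable R setT)).
  - by move=> x _; rewrite lee_fin.
by rewrite integral_cst// mul1e.
Qed.

Lemma integral_step_function (phi : nat -> R) (h : R) k : 0 < h -> (forall i, `|phi i| <= 1) ->
  \int[mu]_(s in `[0, k%:R * h[) phi (Num.truncn (s / h)) = h * \sum_(i < k) phi i.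
Proof.
move=> h0 phi1; pose g s := phi (Num.truncn (s / h)).
have mg : measurable_fun [set: measurableTypeR R] g.
  exact: measurable_truncn.
have ig (a b : R) : mu.-integrable `[a, b[ (EFin \o g).
  apply: bounded_integrable => //.
    by rewrite lebesgue_measure_itv/=; case: ifP => _; rewrite ?ltry.
  by move=> s; exact: phi1.
elim: k => [|k IH].
  by rewrite mul0r set_itvco0 Rintegral_set0 big_ord0 mulr0.
have kk : k%:R * h <= k.+1%:R * h by rewrite ler_wpM2r ?(ltW h0)// ler_nat.
have k0 : 0 <= k%:R * h by rewrite mulr_ge0// ltW.
have UE : `[0, k.+1%:R * h[%classic = `[0, k%:R * h[%classic `|` `[k%:R * h, k.+1%:R * h[%classic.
  apply/seteqP; split => s /=; rewrite !in_itv/=.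
    by move=> /andP[s0 s1]; have [sk|sk] := ltP s (k%:R * h); [left; rewrite s0|right].
  by move=> [|] /andP[s0 s1]; rewrite ?s0 ?s1 ?andbT ?(lt_le_trans s1)//= (le_trans k0).
rewrite UE Rintegral_setU//; last 2 first.
- by rewrite -UE; exact: ig.
- apply/disj_setPS => s /= []; rewrite !in_itv/= => /andP[_ s1] /andP[s2 _].
  by rewrite ltNge s2 in s1.
rewrite IH big_ord_recr/= mulrDr; congr (_ + _).
rewrite (_ : Rintegral _ _ _ = \int[mu]_(s in `[k%:R * h, k.+1%:R * h[) phi k); last first.
  apply: eq_Rintegral => s; rewrite inE/= in_itv/= => sk.
  by congr phi; exact: truncn_cell.
rewrite Rintegral_cst// mulrC; congr (_ * _).
have muE : mu `[k%:R * h, k.+1%:R * h[%classic = h%:E.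
  rewrite lebesgue_measure_itv/= lte_fin ltr_pM2r// ltr_nat ltnSn/= -EFinB.
  by rewrite -mulrBl -natr1 addrC addKr mul1r.
by rewrite [X in fine X](_ : _ = h%:E).
Qed.

(** The indicator is discontinuous at 0 only, so it converges off the zero set of [F]. Conditions
    are imposed inside []0, t[] since at one endpoint the path is deterministic and may sit on the
    boundary. *)
Lemma occupation_cvg F (G : nat -> R -> R) t : measurable_fun [set: measurableTypeR R] F ->
  (forall n, measurable_fun [set: measurableTypeR R] (G n)) ->
  mu (`]0, t[%classic `&` [set s | F s = 0]) = 0%E ->
  (forall s, 0 < s < t -> G n s @[n --> \oo] --> F s) ->
  occupation (G n) t @[n --> \oo] --> occupation F t.
Proof.
move=> mF mG F0 GF.
have mI : measurable (`]0, t[%classic : set (measurableTypeR R)) by exact: measurable_itv.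
have itv_int (a c : itv_bound R) (k : R -> R) : mu [set` Interval a c] != +oo%E ->
    measurable_fun [set: measurableTypeR R] k -> (forall s, `|k s| <= 1) ->
    mu.-integrable [set` Interval a c] (EFin \o k).
  by move=> ac mk k1; apply: bounded_integrable; rewrite ?ltey.
have fin (a c : R) (p q : bool) : mu [set` Interval (BSide p a) (BSide q c)] != +oo%E.
  by rewrite lebesgue_measure_itv/=; case: ifP.
have mi : measurable_fun [set: measurableTypeR R] (\1_(`]-oo, 0]) : R -> R).
  by apply: measurable_indic; exact: measurable_itv.
have mk (k : R -> R) : measurable_fun [set: measurableTypeR R] k ->
    measurable_fun [set: measurableTypeR R] (fun s => \1_(`]-oo, 0]) (k s) : R).
  by move=> ?; exact: (measurableT_comp mi).
have E k : measurable_fun [set: measurableTypeR R] k ->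
    occupation k t = \int[mu]_(s in `]0, t[) \1_(`]-oo, 0]) (k s).
  move=> mk'; have b1 s : `|\1_(`]-oo, 0]) (k s) : R| <= 1 by exact: indic_norm_le1.
  rewrite Rintegral_itv_obnd_cbnd; last by apply: itv_int => //; exact: mk.
  by rewrite Rintegral_itv_bndo_bndc//; apply: itv_int => //; exact: mk.
rewrite E//; under eq_fun do rewrite E//.
have ind_cvg s : 0 < s < t -> F s != 0 ->
    \1_(`]-oo, 0]) (G n s) @[n --> \oo] --> (\1_(`]-oo, 0]) (F s) : R).
  move=> st Fs0; have [Fneg|Fpos|F0'] := ltgtP (F s) 0; last by rewrite F0' eqxx in Fs0.
    have Fq0 := cvgr_lt _ (GF s st) _ Fneg.
    apply: cvg_near_cst; apply: filterS (Fq0 _) => n /= Fn0.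
    by rewrite !indicE !mem_set//= in_itv/= ltW.
  have Fq0 := cvgr_gt _ (GF s st) _ Fpos.
  apply: cvg_near_cst; apply: filterS (Fq0 _) => n /= Fn0.
  by rewrite !indicE !memNset//= in_itv/= leNgt ?Fn0 ?Fpos.
apply: (@Rintegral_dominated_cvg _ (measurableTypeR R) R mu _ _ _ (cst 1)) => //.
- by move=> n; apply: measurable_funTS; exact: mk.
- by apply: measurable_funTS; exact: mk.
- by apply: itv_int => // s; rewrite normr1.
- by move=> n s _; exact: indic_norm_le1.
- exists (`]0, t[%classic `&` [set s | F s = 0]); split => //.
    apply: measurableI; first exact: measurable_itv.
    by rewrite -[X in measurable X]setTI; exact: (mF measurableT [set 0]).
  move=> s /= /existsNP/= [].
  rewrite in_itv/= => st ncvg; split => //.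
  by apply: contrapT => /eqP Fs0; apply: ncvg; exact: ind_cvg.
Qed.

(** The Riemann sum is itself the occupation time of the path frozen on each cell at its left
    endpoint, and these frozen paths converge pointwise. *)
Lemma riemann_occupation_cvg F t : 0 < t -> continuous F ->
  mu (`]0, t[%classic `&` [set s | F s = 0]) = 0%E ->
  riemann_occupation F t n @[n --> \oo] --> occupation F t.
Proof.
move=> t0 cF F0.
pose h n : R := t / n.+1%:R.
have h0 n : 0 < h n by rewrite divr_gt0.
have hn : h n @[n --> \oo] --> (0 : R).
  rewrite -(mulr0 t); apply: cvgM; [exact: cvg_cst|exact: cvg_harmonic].
pose G n s : R := F ((Num.truncn (s / h n))%:R * h n).
have mG n : measurable_fun [set: measurableTypeR R] (G n).
  exact: (measurable_truncn (fun i => F (i%:R * h n))).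
have E n : riemann_occupation F t n = occupation (G n) t.
  have := @integral_step_function (fun i => \1_(`]-oo, 0]) (F (i%:R * h n))) (h n) n.+1 (h0 n).
  rewrite [n.+1%:R * h n]mulrC divfK// /riemann_occupation -/(h n) => <-; last first.
    by move=> i; exact: indic_norm_le1.
  rewrite Rintegral_itv_bndo_bndc//; apply: bounded_integrable => //.
  - by rewrite lebesgue_measure_itv/=; case: ifP => _; rewrite ?ltry.
  - exact: (measurable_truncn (fun i => \1_(`]-oo, 0]) (F (i%:R * h n)))).
  - by move=> s; exact: indic_norm_le1.
under eq_fun do rewrite E.
apply: occupation_cvg => //; first exact: continuous_measurable_fun.
move=> s /andP[s0 _].
have qs : (Num.truncn (s / h n))%:R * h n @[n --> \oo] --> s.
  apply/cvgrPdist_le => e e0; apply: filterS (cvgr_le 0 hn e e0) => n hne.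
  have sh0 : 0 <= s / h n by rewrite divr_ge0// ltW.
  have /andP[q1 q2] := truncn_itv sh0.
  rewrite (_ : s - _ = (s / h n - (Num.truncn (s / h n))%:R) * h n); last first.
    by rewrite mulrBl divfK ?gt_eqF.
  rewrite normrM [`|h n|]gtr0_norm// (le_trans _ hne)// ler_piMl ?(ltW (h0 n))//.
  by rewrite ger0_norm ?subr_ge0// lerBlDl natr1; exact: ltW.
exact: (cvg_comp _ _ qs (cF s)).
Qed.

Lemma occupation_shift_cvg F t (a : nat -> R) : continuous F ->
  mu (`]0, t[%classic `&` [set s | F s = 0]) = 0%E -> a n @[n --> \oo] --> (0 : R) ->
  occupation (fun s => a n + F s) t @[n --> \oo] --> occupation F t.
Proof.
move=> cF F0 a0; have mF : measurable_fun [set: measurableTypeR R] F by exact: continuous_measurable_fun.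
apply: occupation_cvg => // [n|s _]; first exact: measurable_funD.
by rewrite -[X in _ --> X]add0r; apply: cvgD => //; exact: cvg_cst.
Qed.

End Occupation.

(** * The Feynman-Kac representation *)

Section BrownianPaths.
Context d (Omega : measurableType d) (R : realType).
Local Notation mu := (@lebesgue_measure R).
Variables (P : probability Omega R) (W : R -> Omega -> R).
Hypothesis mW : forall t, measurable_fun setT (W t).
Hypothesis W0 : forall w, W 0 w = 0.
Hypothesis cW : forall w, continuous (W^~ w).
Hypothesis lawW : forall s t : R, 0 <= s -> s < t -> forall A : set R, measurable A ->
  P ((fun w => W t w - W s w) @^-1` A) = normal_prob 0 (Num.sqrt (t - s)) A.
Hypothesis indepW : forall (n : nat) (t : nat -> R) (A : nat -> set R),
  0 <= t 0%N -> (forall i, t i <= t i.+1) -> (forall i, measurable (A i)) ->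
  P (\bigcap_(i < n) ((fun w => W (t i.+1) w - W (t i) w) @^-1` A i)) =
  (\prod_(i < n) P ((fun w => W (t i.+1) w - W (t i) w)%R @^-1` A i))%E.
Implicit Types (s t x : R) (F : R -> Omega -> R).

Lemma no_atom t c : 0 < t -> P [set w | W t w = c] = 0%E.
Proof.
move=> t0; have := lawW (lexx 0) t0 (measurable_set1 c).
rewrite /normal_prob integral_set1 => <-; congr (P _).
by apply/seteqP; split => w /=; rewrite W0 subr0.
Qed.

Lemma measurable_path F : (forall w, continuous (F^~ w)) ->
  (forall s, measurable_fun setT (F s)) ->
  measurable_fun [set: measurableTypeR R * Omega] (fun p => F (Num.max p.1 0) p.2).
Proof.
move=> cF mF; apply: caratheodory => // w s.
have cm : {for s, continuous (id \max cst 0 : R -> R^o)}.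
  by apply: continuous_max; [exact: cvg_id|exact: cst_continuous].
exact: (@continuous_comp _ R^o _ _ (F^~ w) s cm (cF w _)).
Qed.

(** Brings in the maximum with 0, under which [measurable_path] gives joint measurability. *)
Lemma occupationE (G : R -> R) t :
  occupation G t = \int[mu]_s (\1_(`[0, t]) s * \1_(`]-oo, 0]) (G (Num.max s 0))).
Proof.
rewrite /occupation /Rintegral integral_mkcond; congr fine; apply: eq_integral => s _.
rewrite patchE [\1_(`[0, t]) s]indicE; case: ifPn => [|_]; last by rewrite mul0r.
by rewrite inE/= in_itv/= => /andP[s0 _]; rewrite mul1r max_l.
Qed.

Lemma measurable_occupation F t : (forall w, continuous (F^~ w)) ->
  (forall s, measurable_fun setT (F s)) ->
  measurable_fun setT (fun w => occupation (F^~ w) t).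
Proof.
move=> cF mF; under eq_fun do rewrite occupationE.
apply: (@measurable_Rintegral_param _ _ Omega (measurableTypeR R) R mu
  (fun p => \1_(`[0, t]) p.2 * \1_(`]-oo, 0]) (F (Num.max p.2 0) p.1))).
have mi (i : interval R) : measurable_fun [set: measurableTypeR R] (\1_[set` i] : R -> R).
  by apply: measurable_indic; exact: measurable_itv.
apply: measurable_funM; first exact: (measurableT_comp (mi _) measurable_snd).
apply: (measurableT_comp (mi `]-oo, 0])).
have msw : measurable_fun [set: Omega * measurableTypeR R] (fun p => (p.2, p.1)).
  by apply: measurable_fun_pair; [exact: measurable_snd|exact: measurable_fst].
exact: (measurableT_comp (measurable_path cF mF) msw).
Qed.

(** Tonelli on the set of pairs [(s, w)] with [F s w = 0]: its sections at fixed times are null,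
    hence so are almost all its sections at fixed paths. *)
Lemma ae_zero_set_null F t : (forall w, continuous (F^~ w)) ->
  (forall s, measurable_fun setT (F s)) ->
  (forall s, 0 < s < t -> P [set w | F s w = 0] = 0%E) ->
  {ae P, forall w, mu (`]0, t[%classic `&` [set s | F s w = 0]) = 0%E}.
Proof.
move=> cF mF F0.
pose K (p : R * Omega) : R := \1_(`]0, t[) p.1 * \1_([set 0]) (F (Num.max p.1 0) p.2).
have mK : measurable_fun [set: measurableTypeR R * Omega] (EFin \o K).
  have m1 : measurable_fun [set: measurableTypeR R] (\1_(`]0, t[) : R -> R).
    by apply: measurable_indic; exact: measurable_itv.
  have m2 : measurable_fun [set: measurableTypeR R] (\1_([set 0]) : R -> R).
    by apply: measurable_indic; exact: measurable_set1.
  apply/measurable_EFinP; apply: measurable_funM.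
    exact: (measurableT_comp m1 measurable_fst).
  exact: (measurableT_comp m2 (measurable_path cF mF)).
have K0 p : (0 <= (EFin \o K) p)%E by rewrite lee_fin mulr_ge0.
pose Z w : set R := `]0, t[%classic `&` [set s | F s w = 0].
suff: {ae P, forall w, mu (Z w) = 0%E} by [].
have swap := @fubini_tonelli _ _ (measurableTypeR R) Omega R mu P (EFin \o K) mK K0.
have inner w : (\int[mu]_s (EFin \o K) (s, w) = mu (Z w))%E.
  have mZ : measurable (Z w : set (measurableTypeR R)).
    apply: measurableI; first exact: measurable_itv.
    rewrite -[X in measurable X]setTI.
    have mFw : measurable_fun [set: measurableTypeR R] (F^~ w) by exact: continuous_measurable_fun.
    exact: (mFw measurableT [set 0] (measurable_set1 0)).
  transitivity (\int[mu]_s (\1_(Z w) s)%:E)%E; last by rewrite integral_indic// setIT.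
  apply: eq_integral => s _; congr EFin; rewrite /Z.
  rewrite /K/= !indicE in_setI.
  have [|] := boolP (s \in `]0, t[%classic); last by rewrite mul0r.
  by rewrite inE/= in_itv/= => /andP[s0 st]; rewrite mul1r max_l ?(ltW s0).
have zero : (\int[P]_w `|mu (Z w)| = 0)%E.
  under eq_integral do rewrite -inner gee0_abs ?integral_ge0//.
  rewrite -swap integral0_eq// => s _.
  have [st|st] := boolP (0 < s < t); last first.
    rewrite integral0_eq// => w _; rewrite /K/= indicE memNset ?mul0r//=.
    by rewrite in_itv/=; exact/negP.
  have mE : measurable [set w | F s w = 0].
    by rewrite -[X in measurable X]setTI; exact: (mF s measurableT [set 0] (measurable_set1 0)).
  rewrite -(F0 s st).
  transitivity (\int[P]_w (\1_([set w | F s w = 0]) w)%:E)%E; last by rewrite integral_indic// setIT.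
  apply: eq_integral => w _; congr EFin; rewrite /K/= !indicE mem_set ?mul1r//=.
  by case/andP: st => s0 _; rewrite max_l ?(ltW s0).
have mm : measurable_fun setT (fun w => mu (Z w)).
  rewrite (_ : (fun w => _) = (fun w => \int[mu]_s (EFin \o K) (s, w))%E); last first.
    by apply/funext => w; rewrite inner.
  exact: (@measurable_fun_fubini_tonelli_G _ _ (measurableTypeR R) Omega R mu (EFin \o K)).
have /(ae_eq_integral_abs P measurableT mm) := zero.
by apply: filterS => w /(_ Logic.I).
Qed.

Lemma expectation_path t x (psi : R -> \bar R) : 0 < t -> measurable_fun setT psi ->
  (forall y, 0 <= psi y)%E -> (\int[P]_w psi (x + W t w)%R = eheat t psi x)%E.
Proof.
move=> t0 mpsi psi0; rewrite -(eheat_normal x t0 mpsi psi0).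
have mpx : measurable_fun setT (fun y : measurableTypeR R => psi (x + y)%R).
  by apply: (measurableT_comp mpsi); exact: measurable_funD.
have mWt : measurable_fun [set: Omega] (W t : Omega -> measurableTypeR R) by exact: mW.
pose Wt : {mfun Omega >-> measurableTypeR R} := HB.pack (W t) (isMeasurableFun.Build _ _ _ _ _ mWt).
rewrite -[LHS](ge0_integral_distribution (P := P) Wt mpx)//.
apply: eq_measure_integral => //= A mA _.
have := lawW (lexx 0) t0 mA; rewrite subr0 => <-.
by rewrite /distribution /pushforward; congr (P _); apply/seteqP; split => w /=; rewrite W0 subr0.
Qed.

Variables (b f : R -> R).
Hypotheses (cb : continuous b) (Lf : L2 f) (f0 : forall x, 0 <= f x).

Definition forward_path x s w := x + W s w - b s.
Definition backward_path t x s w := x + W (t - s) w - b s.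

Lemma dampE_path (h s y : R) : damp b h s y = expR (- (h * \1_(`]-oo, 0]) (y - b s))).
Proof.
rewrite /damp !indicE; congr (expR (- (h * (nat_of_bool _)%:R))).
by apply/idP/idP; rewrite !inE/= !in_itv/= subr_le0.
Qed.

Section Discretization.
Variables (t x : R) (n : nat).
Hypothesis t0 : 0 < t.
Let h := t / n.+1%:R.
Let h0 : 0 < h. Proof. by rewrite divr_gt0. Qed.
Let nh : n.+1%:R * h = t. Proof. by rewrite /h mulrC divfK. Qed.
Let X i w := x + W (i%:R * h) w.
Let Y i w := W (i.+1%:R * h) w - W (i%:R * h) w.

Let mY i : measurable_fun setT (Y i). Proof. exact: measurable_funB. Qed.

Let indepY (A : nat -> set R) : (forall i, measurable (A i)) ->
  P (\bigcap_(i < n.+1) (Y i @^-1` A i)) = (\prod_(i < n.+1) P (Y i @^-1` A i))%E.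
Proof.
apply: (@indepW n.+1 (fun i => i%:R * h)); first by rewrite mul0r.
by move=> i; rewrite ler_wpM2r ?(ltW h0)// ler_nat.
Qed.

Let lawY i (A : set R) : measurable A -> P (Y i @^-1` A) = normal_prob 0 (Num.sqrt h) A.
Proof.
move=> mA; have : i%:R * h < i.+1%:R * h by rewrite ltr_pM2r// ltr_nat.
move=> /(lawW (mulr_ge0 (ler0n R i) (ltW h0)))/(_ _ mA).
by rewrite (_ : _ - _ = h) // -natr1; ring.
Qed.

Let X0 w : X 0 w = x. Proof. by rewrite /X mul0r W0 addr0. Qed.
Let XS i w : X i.+1 w = X i w + Y i w. Proof. by rewrite /X /Y; ring. Qed.

Lemma forward_expectation (psi : R -> \bar R) : measurable_fun setT psi ->
  (forall y, 0 <= psi y)%E ->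
  (\int[P]_w ((expR (- riemann_occupation (forward_path x ^~ w) t n))%:E * psi (x + W t w)%R) =
   chain h (fun j => damp b h (j%:R * h)) (fun _ _ => 1%R) n.+1 psi x)%E.
Proof.
move=> mpsi psi0.
rewrite -(chain_expectation h0 mY indepY lawY X0 XS _ _ _ _ (leqnn _) mpsi psi0)//; last 2 first.
- by move=> i; exact: measurable_damp.
- by move=> i z; exact: damp_ge0.
apply: eq_integral => w _; rewrite /X nh; congr (_%:E * _)%E.
rewrite /riemann_occupation -/h mulr_sumr -sumrN expR_sum; apply: eq_bigr => i _.
by rewrite mulr1 dampE_path.
Qed.

Lemma backward_expectation :
  (\int[P]_w (expR (- riemann_occupation (backward_path t x ^~ w) t n) * f (x + W t w))%:E =
   (splitting b h n.+1 f x)%:E)%E.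
Proof.
rewrite -(splitting_chain b h0 Lf x (leqnn n.+1)) subnn.
have mf : measurable_fun setT (fun y => (f y)%:E) by apply/measurable_EFinP; exact: Lf.1.
have f0E y : (0 <= (f y)%:E)%E by rewrite lee_fin.
have m1 (i : nat) : measurable_fun setT (fun _ : R => 1 : R) by [].
have m2 (i : nat) : measurable_fun setT (damp b h ((n.+1.-1 - i)%:R * h)) by exact: measurable_damp.
have p1 (i : nat) (z : R) : 0 <= 1 :> R by [].
have p2 (i : nat) z : 0 <= damp b h ((n.+1.-1 - i)%:R * h) z by exact: damp_ge0.
rewrite -(chain_expectation h0 mY indepY lawY X0 XS m1 m2 p1 p2 (leqnn _) mf f0E).
apply: eq_integral => w _; rewrite /X nh EFinM; congr (_%:E * _)%E.
rewrite /riemann_occupation -/h mulr_sumr -sumrN expR_sum /weight.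
(* The weight of walk step [i] is taken on arrival, at time [(i+1) h = t - (n-i) h], where the
   backward path faces the boundary at time [(n-i) h]; reversing the index matches the two
   products. *)
rewrite (reindex_inj rev_ord_inj); apply: eq_bigr => i _ /=.
rewrite mul1r dampE_path /backward_path subSS.
have -> : i.+1%:R * h = t - (n - i)%:R * h.
  rewrite -nh -mulrBl; congr (_ * h).
  by rewrite natrB; [rewrite -!natr1; ring|rewrite -ltnS].
by [].
Qed.

End Discretization.

End BrownianPaths.

(** * Identification of an L^2 limit with a pointwise limit *)

Section PointwiseLimit.
Context {R : realType}.
Local Notation mu := (@lebesgue_measure R).

(** Fatou bounds the integral of [(g - V)^2] by the limit of the squared norms, which is 0; no
    subsequence is extracted. *)
Lemma L2_pointwise_limit (g V : R -> R) (s : nat -> R -> R) : L2 g -> (forall n, L2 (s n)) ->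
  measurable_fun setT V -> nrm (fun x => g x - s n x) @[n --> \oo] --> (0 : R) ->
  (forall x, s n x @[n --> \oo] --> V x) -> {ae mu, forall x, g x = V x}.
Proof.
move=> Lg Ls mV ns sV.
pose F n x := ((g x - s n x) ^+ 2)%:E.
have mF n : measurable_fun setT (F n).
  by apply/measurable_EFinP; apply: measurable_funX; exact: (L2B Lg (Ls n)).1.
have F0 n x : setT x -> (0 <= F n x)%E by move=> _; rewrite lee_fin sqr_ge0.
have := @fatou _ _ R mu setT measurableT F mF F0.
have -> : (fun x => limn_einf (F ^~ x)) = (fun x => ((g x - V x) ^+ 2)%:E).
  apply/funext => x.
  have Fx : F n x @[n --> \oo] --> ((g x - V x) ^+ 2)%:E.
    apply: cvg_EFin; first exact: nearW.
    under eq_fun do rewrite /F/= expr2.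
    by rewrite expr2; apply: cvgM; apply: cvgB => //; exact: cvg_cst.
  by rewrite is_cvg_limn_einfE; [exact/cvg_lim|apply/cvg_ex; eexists; exact: Fx].
have -> : limn_einf (fun n => \int[mu]_x F n x)%E = 0%E.
  have Fi : (\int[mu]_x F n x)%E @[n --> \oo] --> 0%E.
    rewrite (_ : (fun n => _) = (fun n => (nrm (fun x => g x - s n x) ^+ 2)%:E)); last first.
      by apply/funext => n; rewrite EFin_nrm2//; exact: L2B.
    apply: cvg_EFin; first exact: nearW.
    rewrite [X in _ --> X](_ : _ = 0 * 0); last by rewrite mulr0.
    by under eq_fun do rewrite /= expr2; apply: cvgM.
  by rewrite is_cvg_limn_einfE; [exact/cvg_lim|apply/cvg_ex; eexists; exact: Fi].
move=> le0.
have mgV : measurable_fun setT (fun x => ((g x - V x) ^+ 2)%:E).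
  by apply/measurable_EFinP; apply: measurable_funX; apply: measurable_funB => //; have [] := Lg.
have : (\int[mu]_x `|((g x - V x) ^+ 2)%:E| = 0)%E.
  under eq_integral do rewrite gee0_abs ?lee_fin ?sqr_ge0//.
  by apply/eqP; rewrite eq_le le0/=; apply: integral_ge0 => x _; rewrite lee_fin sqr_ge0.
move/(ae_eq_integral_abs mu measurableT mgV).
apply: filterS => x H; have {H}/= [h] := H Logic.I.
by apply/eqP; rewrite -subr_eq0 -sqrf_eq0 h.
Qed.

End PointwiseLimit.

(** * Representation, duality and total mass for continuous paths *)

Section FeynmanKac.
Context d (Omega : measurableType d) (R : realType).
Local Notation mu := (@lebesgue_measure R).
Variables (P : probability Omega R) (W : R -> Omega -> R).
Hypothesis mW : forall t, measurable_fun setT (W t).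
Hypothesis W0 : forall w, W 0 w = 0.
Hypothesis cW : forall w, continuous (W^~ w).
Hypothesis lawW : forall s t : R, 0 <= s -> s < t -> forall A : set R, measurable A ->
  P ((fun w => W t w - W s w) @^-1` A) = normal_prob 0 (Num.sqrt (t - s)) A.
Hypothesis indepW : forall (n : nat) (t : nat -> R) (A : nat -> set R),
  0 <= t 0%N -> (forall i, t i <= t i.+1) -> (forall i, measurable (A i)) ->
  P (\bigcap_(i < n) ((fun w => W (t i.+1) w - W (t i) w) @^-1` A i)) =
  (\prod_(i < n) P ((fun w => W (t i.+1) w - W (t i) w)%R @^-1` A i))%E.
Variables (T : R) (f b : R -> R) (u : R -> R -> R).
Hypotheses (T0 : 0 < T) (cu : L2_curve u) (cb : continuous b) (Lf : L2 f).
Hypothesis f0 : forall x, 0 <= f x.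
Hypothesis fu0 : {ae mu, forall x, u 0 x = f x}.
Hypothesis weak : weak_pde T f b u.
Implicit Types (s t x : R).

Local Notation forward_path := (forward_path W b).
Local Notation backward_path := (backward_path W b).

Lemma continuous_forward_path x w : continuous (forward_path x ^~ w).
Proof.
move=> s; apply: cvgB; last exact: cb.
by apply: cvgD; [exact: cvg_cst|exact: cW].
Qed.

Lemma continuous_backward_path t x w : continuous (backward_path t x ^~ w).
Proof.
move=> s; apply: cvgB; last exact: cb.
apply: cvgD; first exact: cvg_cst.
apply: (@cvg_comp _ _ _ (fun s => t - s) (W^~ w) _ (nbhs (t - s))); last exact: cW.
by apply: cvgB; [exact: cvg_cst|exact: cvg_id].
Qed.

Lemma measurable_forward_path x s : measurable_fun setT (forward_path x s).
Proof. by apply: measurable_funB => //; exact: measurable_funD. Qed.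

Lemma measurable_backward_path t x s : measurable_fun setT (backward_path t x s).
Proof. by apply: measurable_funB => //; exact: measurable_funD. Qed.

Lemma forward_zero_set t x :
  {ae P, forall w, mu (`]0, t[%classic `&` [set s | forward_path x s w = 0]) = 0%E}.
Proof.
apply: (ae_zero_set_null (P := P) (fun w => @continuous_forward_path x w) (@measurable_forward_path x)).
move=> s /andP[s0 _]; rewrite -(no_atom W0 lawW (b s - x) s0); congr (P _).
by apply/seteqP; split => w /=; rewrite /forward_path => h; lra.
Qed.

Lemma backward_zero_set t x :
  {ae P, forall w, mu (`]0, t[%classic `&` [set s | backward_path t x s w = 0]) = 0%E}.
Proof.
apply: (ae_zero_set_null (P := P) (fun w => @continuous_backward_path t x w) (@measurable_backward_path t x)).
move=> s /andP[_ st]; have ts : 0 < t - s by rewrite subr_gt0.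
rewrite -(no_atom W0 lawW (b s - x) ts); congr (P _).
by apply/seteqP; split => w /=; rewrite /backward_path => h; lra.
Qed.

Lemma riemann_occupation_ge0 (F : R -> R) t n : 0 < t -> 0 <= riemann_occupation F t n.
Proof. by move=> t0; rewrite mulr_ge0 ?divr_ge0 ?(ltW t0)// sumr_ge0. Qed.

Lemma occupation_ge0 (F : R -> R) t : 0 <= occupation F t.
Proof. by apply: Rintegral_ge0 => s _. Qed.

Lemma expRN_norm_le1 (r : R) : 0 <= r -> `|expR (- r)| <= 1.
Proof. by move=> r0; rewrite ger0_norm ?expR_ge0// -expR0 ler_expR oppr_le0. Qed.

Lemma measurable_riemann (F : R -> Omega -> R) t n : (forall s, measurable_fun setT (F s)) ->
  measurable_fun setT (fun w => riemann_occupation (F^~ w) t n).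
Proof.
move=> mF; apply: measurable_funM => //; apply: measurable_sum => i.
have mi : measurable_fun [set: measurableTypeR R] (\1_(`]-oo, 0]) : R -> R).
  by apply: measurable_indic; exact: measurable_itv.
exact: (measurableT_comp mi (mF _)).
Qed.

Lemma weighted_cvg (F : R -> Omega -> R) (g : Omega -> R) t : 0 < t ->
  (forall w, continuous (F^~ w)) -> (forall s, measurable_fun setT (F s)) ->
  {ae P, forall w, mu (`]0, t[%classic `&` [set s | F s w = 0]) = 0%E} ->
  measurable_fun setT g -> (forall w, 0 <= g w) -> P.-integrable setT (EFin \o g) ->
  \int[P]_w (expR (- riemann_occupation (F^~ w) t n) * g w) @[n --> \oo] -->
  \int[P]_w (expR (- occupation (F^~ w) t) * g w).
Proof.
move=> t0 cF mF Z mg g0 ig.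
apply: (@Rintegral_dominated_cvg _ _ _ P _ _ _ g) => //.
- move=> n; apply: measurable_funM => //; apply: measurableT_comp => //.
  by apply: measurable_funN; exact: measurable_riemann.
- apply: measurable_funM => //; apply: measurableT_comp => //.
  by apply: measurable_funN; exact: measurable_occupation.
- move=> n w _; rewrite normrM [`|g w|]ger0_norm// ler_piMl//.
  by rewrite expRN_norm_le1// riemann_occupation_ge0.
- apply: filterS Z => w Zw _; apply: cvgM; last exact: cvg_cst.
  apply: (cvg_comp _ expR); last exact: continuous_expR.
  by apply: (@cvgN _ R^o); exact: riemann_occupation_cvg.
Qed.

Lemma measurable_end t x (g : R -> R) : measurable_fun setT g ->
  measurable_fun setT (fun w => g (x + W t w)).
Proof. by move=> mg; apply: (measurableT_comp mg); exact: measurable_funD. Qed.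

Lemma integrable_end t x : 0 < t -> P.-integrable setT (EFin \o (fun w => f (x + W t w))).
Proof.
move=> t0; apply/integrableP; split.
  by apply/measurable_EFinP; apply: measurable_end; exact: Lf.1.
under eq_integral do rewrite /= ger0_norm//.
rewrite (expectation_path mW W0 lawW x (psi := EFin \o f) t0).
- by rewrite eheat_EFin// ltry.
- by apply/measurable_EFinP; exact: Lf.1.
- by move=> y; rewrite lee_fin.
Qed.

Definition backward_kac t x : R :=
  \int[P]_w (expR (- occupation (backward_path t x ^~ w) t) * f (x + W t w)).

Lemma splitting_backward_cvg t x : 0 < t ->
  splitting b (t / n.+1%:R) n.+1 f x @[n --> \oo] --> backward_kac t x.
Proof.
move=> t0.
have E n : splitting b (t / n.+1%:R) n.+1 f x =
    \int[P]_w (expR (- riemann_occupation (backward_path t x ^~ w) t n) * f (x + W t w)).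
  by rewrite /Rintegral (backward_expectation mW W0 lawW indepW).
under eq_fun do rewrite E.
apply: weighted_cvg => //.
- by move=> w; exact: continuous_backward_path.
- by move=> s; exact: measurable_backward_path.
- exact: backward_zero_set.
- by apply: measurable_end; exact: Lf.1.
- exact: integrable_end.
Qed.

Lemma measurable_splitting t n : 0 < t -> measurable_fun setT (splitting b (t / n.+1%:R) n.+1 f).
Proof. by move=> t0; have [] := L2_splitting b n.+1 (divr_gt0 t0 (ltr0Sn R n)) Lf. Qed.

Lemma measurable_backward_kac t : 0 < t -> measurable_fun setT (backward_kac t).
Proof.
move=> t0; apply: (measurable_fun_cvg (h := fun n => splitting b (t / n.+1%:R) n.+1 f)).
  by move=> n; exact: measurable_splitting.
by move=> x _; exact: splitting_backward_cvg.
Qed.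

(** Passes from the initial value [u 0] to [f], equal to it almost everywhere only: the scheme is a
    contraction, so null sets are harmless. *)
Lemma splitting_initial_cvg t : 0 < t -> t <= T ->
  nrm (fun x => u t x - splitting b (t / n.+1%:R) n.+1 f x) @[n --> \oo] --> (0 : R).
Proof.
move=> t0 tT; have Lu r : L2 (u r) by have [] := cu.
have uf0 : nrm (fun x => u 0 x - f x) = 0.
  rewrite /nrm ipxx /Rintegral (_ : integral _ _ _ = 0%E) ?sqrtr0//.
  rewrite -(integral0 mu setT); apply: ae_eq_integral => //.
    by apply/measurable_EFinP; apply: measurable_funX; exact: (L2B (Lu 0) Lf).1.
  by apply: ae_sub fu0 => x -> _; rewrite subrr expr0n.
apply: squeeze_cvgr (cvg_cst 0) (splitting_cvg T0 cu cb Lf fu0 weak t0 tT).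
near=> n; rewrite nrm_ge0/=.
have h0 : 0 < t / n.+1%:R by rewrite divr_gt0.
apply: (le_trans (nrm_triangle (Lu t) (L2_splitting b n.+1 h0 (Lu 0)) (L2_splitting b n.+1 h0 Lf))).
have := nrm_splittingB b h0 n.+1 (Lu 0) Lf; rewrite uf0 => H.
rewrite -[leRHS]addr0; exact: lerD.
Unshelve. all: by end_near. Qed.

Lemma backward_representation t : 0 < t -> t <= T ->
  {ae mu, forall x, u t x = backward_kac t x}.
Proof.
move=> t0 tT; have Lu r : L2 (u r) by have [] := cu.
apply: (L2_pointwise_limit (s := fun n => splitting b (t / n.+1%:R) n.+1 f)) => //.
- by move=> n; apply: L2_splitting => //; rewrite divr_gt0.
- exact: measurable_backward_kac.
- exact: splitting_initial_cvg.
- by move=> x; exact: splitting_backward_cvg.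
Qed.

Lemma measurable_forward_weight t x :
  measurable_fun setT (fun w => expR (- occupation (forward_path x ^~ w) t)).
Proof.
apply: measurableT_comp => //; apply: measurable_funN; apply: measurable_occupation.
- by move=> w; exact: continuous_forward_path.
- by move=> s; exact: measurable_forward_path.
Qed.

Definition forward_kac t (psi : R -> R) x : R :=
  \int[P]_w (expR (- occupation (forward_path x ^~ w) t) * psi (x + W t w)).

Section Window.
Variables (t : R) (psi : R -> R).
Hypotheses (t0 : 0 < t) (tT : t <= T) (Lpsi : L2 psi).
Hypotheses (psi0 : forall x, 0 <= psi x) (psi1 : forall x, psi x <= 1).

Let E n x : R :=
  \int[P]_w (expR (- riemann_occupation (forward_path x ^~ w) t n) * psi (x + W t w)).

Let integrable1 : P.-integrable setT (EFin \o cst 1).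
Proof. by apply: finite_measure_integrable_cst. Qed.

Let integrable_psi x : P.-integrable setT (EFin \o (fun w => psi (x + W t w))).
Proof.
apply: (le_integrable _ _ _ integrable1) => //.
  by apply/measurable_EFinP; apply: measurable_end; exact: Lpsi.1.
by move=> w _; rewrite lee_fin normr1 ger0_norm.
Qed.

Lemma forward_limit x : E n x @[n --> \oo] --> forward_kac t psi x.
Proof.
apply: weighted_cvg => //.
- by move=> w; exact: continuous_forward_path.
- by move=> s; exact: measurable_forward_path.
- exact: forward_zero_set.
- by apply: measurable_end; exact: Lpsi.1.
Qed.

Let measurable_E n : measurable_fun setT (E n).
Proof.
apply: (@measurable_Rintegral_param _ _ (measurableTypeR R) Omega R P
  (fun p => expR (- riemann_occupation (forward_path p.1 ^~ p.2) t n) * psi (p.1 + W t p.2))).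
have mend s : measurable_fun [set: measurableTypeR R * Omega] (fun p => p.1 + W s p.2).
  by apply: measurable_funD; [exact: measurable_fst|exact: (measurableT_comp (mW s) measurable_snd)].
apply: measurable_funM; last exact: (measurableT_comp Lpsi.1 (mend t)).
apply: measurableT_comp => //; apply: measurable_funN.
apply: measurable_funM => //; apply: measurable_sum => i.
have mi : measurable_fun [set: measurableTypeR R] (\1_(`]-oo, 0]) : R -> R).
  by apply: measurable_indic; exact: measurable_itv.
by apply: (measurableT_comp mi); apply: measurable_funB.
Qed.

Let w01 n x w : 0 <= expR (- riemann_occupation (forward_path x ^~ w) t n) * psi (x + W t w) <= psi (x + W t w).
Proof.
have := expRN_norm_le1 (riemann_occupation_ge0 (forward_path x ^~ w) n t0).
by rewrite ger0_norm ?expR_ge0// => e1; rewrite mulr_ge0 ?expR_ge0//= ler_piMl.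
Qed.

Let integrable_E n x : P.-integrable setT (EFin \o (fun w =>
  expR (- riemann_occupation (forward_path x ^~ w) t n) * psi (x + W t w))).
Proof.
apply: (le_integrable _ _ _ (integrable_psi x)) => //.
  apply/measurable_EFinP; apply: measurable_funM; last by apply: measurable_end; exact: Lpsi.1.
  apply: measurableT_comp => //; apply: measurable_funN; apply: measurable_riemann.
  by move=> s; exact: measurable_forward_path.
by move=> w _; case/andP: (w01 n x w) => w0 w1; rewrite lee_fin !ger0_norm.
Qed.

Let E01 n x : 0 <= E n x <= 1.
Proof.
apply/andP; split; first by apply: Rintegral_ge0 => w _; case/andP: (w01 n x w).
have -> : 1 = \int[P]_w (cst 1 w) :> R.
  by rewrite Rintegral_cst// (_ : fine _ = 1) ?mulr1//; rewrite [X in fine X]probability_setT.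
apply: (le_Rintegral measurableT (integrable_E n x) integrable1).
by move=> w _ /=; case/andP: (w01 n x w) => _ /le_trans; apply.
Qed.

Lemma measurable_forward_kac : measurable_fun setT (forward_kac t psi).
Proof. by apply: (measurable_fun_cvg (h := E)) => // x _; exact: forward_limit. Qed.

(** The pairing of the scheme with [psi] has two limits: one by convergence in L^2, the other, after
    duality, by dominated convergence under [f], as the expectations [E n] lie between 0 and 1. *)
Lemma forward_duality : mu.-integrable setT (EFin \o f) ->
  ip (u t) psi = \int[mu]_x (f x * forward_kac t psi x).
Proof.
move=> intf; have Lu r : L2 (u r) by have [] := cu.
have h0 n : 0 < t / n.+1%:R by rewrite divr_gt0.
have D n : ip (splitting b (t / n.+1%:R) n.+1 f) psi = \int[mu]_x (f x * E n x).
  rewrite /ip /Rintegral; congr fine; have mpsi := Lpsi.1.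
  have mpE : measurable_fun setT (fun x => (psi x)%:E) by exact/measurable_EFinP.
  have pE0 x : (0 <= (psi x)%:E)%E by rewrite lee_fin.
  under eq_integral do rewrite EFinM.
  rewrite (splitting_dual b (h0 n) Lf f0 n.+1 mpE pE0).
  apply: eq_integral => x _; rewrite EFinM; congr (_ * _)%E.
  rewrite -(forward_expectation mW W0 lawW indepW b x n t0 mpE pE0).
  by rewrite /E /Rintegral fineK//; exact: (integrable_fin_num measurableT (integrable_E n x)).
have lim1 : ip (splitting b (t / n.+1%:R) n.+1 f) psi @[n --> \oo] --> ip (u t) psi.
  apply: ip_cvg2 => //.
  - by move=> n; exact: L2_splitting.
  - by under eq_fun do rewrite nrmBC; exact: splitting_initial_cvg.
  - rewrite (_ : (fun n => _) = fun=> 0); first exact: cvg_cst.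
    apply/funext => n; rewrite (_ : (fun x => _) = fun=> 0) ?nrm0//.
    by apply/funext => x; rewrite subrr.
have lim2 : \int[mu]_x (f x * E n x) @[n --> \oo] --> \int[mu]_x (f x * forward_kac t psi x).
  apply: (@Rintegral_dominated_cvg _ (measurableTypeR R) R mu _ _ _ f) => //.
  - by move=> n; exact: (measurable_funM Lf.1 (measurable_E n)).
  - exact: (measurable_funM Lf.1 measurable_forward_kac).
  - move=> n x _; case/andP: (E01 n x) => e0 e1.
    by rewrite ger0_norm ?mulr_ge0// ler_piMr.
  - by apply: (aeW mu) => x _; apply: cvgM; [exact: cvg_cst|exact: forward_limit].
rewrite -(cvg_lim (@Rhausdorff R) lim1) -(cvg_lim (@Rhausdorff R) lim2).
by congr (limn _); apply/funext => n; exact: D.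
Qed.

End Window.

Lemma measurable_backward_weight t x :
  measurable_fun setT (fun w => expR (- occupation (backward_path t x ^~ w) t)).
Proof.
apply: measurableT_comp => //; apply: measurable_funN; apply: measurable_occupation.
- by move=> w; exact: continuous_backward_path.
- by move=> s; exact: measurable_backward_path.
Qed.

Lemma integrable_weighted t x y : 0 < t ->
  P.-integrable setT (EFin \o (fun w => expR (- occupation (backward_path t x ^~ w) t) * f (y + W t w))).
Proof.
move=> t0; apply: (le_integrable _ _ _ (integrable_end y t0)) => //.
  apply/measurable_EFinP; apply: measurable_funM; first exact: measurable_backward_weight.
  by apply: measurable_end; exact: Lf.1.
by move=> w _; rewrite lee_fin normrM ler_piMl// expRN_norm_le1// occupation_ge0.
Qed.

(** The position [x + W t] has a density in L^2, so Cauchy-Schwarz reduces the expectation to the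
    continuity of translations in L^2. *)
Lemma expectation_increment t x y : 0 < t ->
  \int[P]_w `|f (y + W t w) - f (x + W t w)| <=
  nrm (hk t) * nrm (fun z => f (z + (y - x)) - f z).
Proof.
move=> t0; pose psi z := `|f (z + (y - x)) - f z|.
have Lpsi : L2 psi by apply: L2_abs; apply: L2B => //; exact: L2_shift.
have Lpsi' : L2 (fun z => f (z + (y - x)) - f z) by apply: L2B => //; exact: L2_shift.
have -> : \int[P]_w `|f (y + W t w) - f (x + W t w)| = heat t psi x.
  rewrite /Rintegral (_ : integral _ _ _ = (heat t psi x)%:E)//.
  rewrite -eheat_EFin// -(expectation_path mW W0 lawW).
  - apply: eq_integral => w _; rewrite /psi (_ : x + W t w + (y - x) = y + W t w)//; ring.
  - exact: t0.
  - by apply/measurable_EFinP; exact: Lpsi.1.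
  - by move=> z; rewrite lee_fin /psi normr_ge0.
rewrite (le_trans (ler_norm _))// (le_trans (cauchy_schwarz (L2_hk_sub x t0) Lpsi))//.
rewrite nrm_sub; last exact: L2_hk.
rewrite ler_wpM2l ?nrm_ge0// nrm_le//; first exact: Lpsi.1.
by move=> z; rewrite normr_id.
Qed.

(** As [f] is only in L^2, [f (y + W t)] need not be continuous in [y] along a path. The variation
    is split: that of the weight is pathwise, by [occupation_shift_cvg]; that of [f] is controlled
    in expectation. *)
Lemma continuous_backward_kac t : 0 < t -> continuous (backward_kac t).
Proof.
move=> t0 x; apply/(@cvg_nbhsP _ R^o) => y yx.
have iw := integrable_weighted.
have mend z : measurable_fun setT (fun w => f (z + W t w)) by apply: measurable_end; exact: Lf.1.
have split_diff n : backward_kac t (y n) =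
    \int[P]_w (expR (- occupation (backward_path t (y n) ^~ w) t) * f (x + W t w)) +
    \int[P]_w (expR (- occupation (backward_path t (y n) ^~ w) t) * (f (y n + W t w) - f (x + W t w))).
  rewrite -RintegralD//; first by apply: eq_Rintegral => w _; ring.
    exact: iw.
  apply: eq_integrable (integrableB measurableT (iw t (y n) (y n) t0) (iw t (y n) x t0)) => //.
  by move=> w _ /=; rewrite mulrBr EFinB.
rewrite /= (_ : (fun n => _) = (fun n =>
    \int[P]_w (expR (- occupation (backward_path t (y n) ^~ w) t) * f (x + W t w)) +
    \int[P]_w (expR (- occupation (backward_path t (y n) ^~ w) t) * (f (y n + W t w) - f (x + W t w)))));
  last exact/funext/split_diff.
rewrite -[X in _ --> X]addr0; apply: cvgD.
  apply: (@Rintegral_dominated_cvg _ _ _ P _ _ _ (fun w => f (x + W t w))) => //.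
  - by move=> n; apply: measurable_funM => //; exact: measurable_backward_weight.
  - by apply: measurable_funM => //; exact: measurable_backward_weight.
  - exact: integrable_end.
  - move=> n w _; rewrite normrM [`|f _|]ger0_norm// ler_piMl//.
    by rewrite expRN_norm_le1// occupation_ge0.
  - apply: filterS (backward_zero_set t x) => w Zw _; apply: cvgM; last exact: cvg_cst.
    apply: (cvg_comp _ expR); last exact: continuous_expR.
    apply: (@cvgN _ R^o).
    have yx0 : y n - x @[n --> \oo] --> (0 : R).
      by rewrite -[X in _ --> X](subrr x); apply: cvgB => //; exact: cvg_cst.
    have := occupation_shift_cvg (@continuous_backward_path t x w) Zw yx0.
    rewrite (_ : (fun n => _) = (fun n => occupation (backward_path t (y n) ^~ w) t))//.
    apply/funext => n; congr (occupation _ t); apply/funext => s.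
    by rewrite /backward_path; ring.
apply/cvgrPdist_le => e e0.
have N0 : 0 < nrm (hk t) + 1 by rewrite ltr_wpDl// nrm_ge0.
have e1 : 0 < e / (nrm (hk t) + 1) by rewrite divr_gt0.
have yx0 : y n - x @[n --> \oo] --> (0 : R).
  by rewrite -[X in _ --> X](subrr x); apply: cvgB => //; exact: cvg_cst.
have tn_near : \forall n \near \oo, nrm (fun z => f (z + (y n - x)) - f z) <= e / (nrm (hk t) + 1).
  exact: (yx0 _ (translation_cvg Lf e1)).
apply: filterS tn_near => n tn; rewrite sub0r normrN.
have iB : P.-integrable setT (EFin \o (fun w => f (y n + W t w) - f (x + W t w))).
  exact: (integrableB measurableT (integrable_end (y n) t0) (integrable_end x t0)).
have iBw : P.-integrable setT (EFin \o (fun w => expR (- occupation (backward_path t (y n) ^~ w) t) *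
     (f (y n + W t w) - f (x + W t w)))).
  apply: (le_integrable _ _ _ iB) => //.
    apply/measurable_EFinP; apply: measurable_funM; first exact: measurable_backward_weight.
    exact: measurable_funB.
  by move=> w _; rewrite lee_fin normrM ler_piMl// expRN_norm_le1// occupation_ge0.
rewrite (le_trans (le_normr_Rintegral measurableT iBw))//.
apply: (@le_trans _ _ (\int[P]_w `|f (y n + W t w) - f (x + W t w)|)).
  apply: le_Rintegral => //; [exact: integrable_norm|exact: integrable_norm|].
  by move=> w _; rewrite normrM ler_piMl// expRN_norm_le1// occupation_ge0.
rewrite (le_trans (expectation_increment x (y n) t0))//.
rewrite (@le_trans _ _ ((nrm (hk t) + 1) * (e / (nrm (hk t) + 1))))//.
  by apply: ler_pM; rewrite ?nrm_ge0// lerDl.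
by rewrite mulrC divfK// gt_eqF.
Qed.

Lemma backward_kac_ge0 t x : 0 <= backward_kac t x.
Proof. by apply: Rintegral_ge0 => w _; rewrite mulr_ge0// expR_ge0. Qed.

(** Duality is applied to the indicators [I m] of [[-m, m]]. On the left [backward_kac] is
    nonnegative and monotone convergence applies without assuming [u t] integrable; on the right [f]
    dominates. *)
Lemma total_mass t : 0 < t -> t <= T -> mu.-integrable setT (EFin \o f) ->
  (\int[mu]_x (u t x)%:E = \int[mu]_x (f x * forward_kac t (cst 1) x)%:E)%E.
Proof.
move=> t0 tT intf; have Lu r : L2 (u r) by have [] := cu.
have mK := measurable_backward_kac t0.
pose I m : R -> R := \1_(`[(- m%:R), m%:R]).
have mI m : measurable_fun setT (I m).
  by apply: measurable_indic; exact: measurable_itv.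
have I0 m x : 0 <= I m x by [].
have I1 m x : I m x <= 1 by rewrite (le_trans (ler_norm _))// indic_norm_le1.
have LI m : L2 (I m).
  split => //; rewrite (_ : _ \o _ = EFin \o I m).
    apply/integrableP; split; first by apply/measurable_EFinP; exact: mI.
    under eq_integral do rewrite /= ger0_norm//.
    rewrite integral_indic ?setIT//.
    have : (mu `[(- m%:R)%R, m%:R]%classic < +oo)%E.
      by rewrite lebesgue_measure_itv/=; case: ifP => _; rewrite ?ltry.
    exact.
  by apply/funext => x /=; rewrite /I indicE; case: (_ \in _); rewrite ?expr1n ?expr0n.
have I_near x : \forall m \near \oo, I m x = 1.
  apply: filterS (nbhs_infty_ger `|x|) => m; rewrite ler_norml => xm.
  by rewrite /I indicE mem_set//= in_itv.
have I_cvg x : I m x @[m --> \oo] --> (1 : R).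
  by apply: cvg_near_cst; exact: I_near.
have I_nd x : {homo (fun m => I m x) : m k / (m <= k)%N >-> m <= k}.
  move=> m k mk; rewrite /I !indicE; case: (boolP (x \in _)) => [|_] //.
  rewrite inE/= in_itv/= => /andP[x1 x2].
  have mkR : m%:R <= k%:R :> R by rewrite ler_nat.
  by rewrite mem_set//= in_itv/= (le_trans _ x1) ?lerN2//= (le_trans x2).
transitivity (\int[mu]_x (backward_kac t x)%:E)%E.
  apply: ae_eq_integral => //; [by apply/measurable_EFinP; exact: (Lu t).1|exact/measurable_EFinP|].
  by apply: ae_sub (backward_representation t0 tT) => x -> _.
have step m : (\int[mu]_x (backward_kac t x * I m x)%:E = (\int[mu]_x (f x * forward_kac t (I m) x))%:E)%E.
  rewrite -forward_duality// /ip /Rintegral fineK.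
    apply: ae_eq_integral => //.
    - by apply/measurable_EFinP; exact: (measurable_funM mK (mI m)).
    - by apply/measurable_EFinP; exact: (measurable_funM (Lu t).1 (mI m)).
    - by apply: ae_sub (backward_representation t0 tT) => x -> _.
  exact: (integrable_fin_num measurableT (L2_mul (Lu t) (LI m))).
have lim1 : (\int[mu]_x (backward_kac t x * I m x)%:E @[m --> \oo] --> \int[mu]_x (backward_kac t x)%:E)%E.
  have := @cvg_monotone_convergence _ _ R mu setT measurableT (fun m x => (backward_kac t x * I m x)%:E).
  rewrite (_ : (fun x => limn _) = (fun x => (backward_kac t x)%:E)).
    apply.
    - by move=> m; apply/measurable_EFinP; exact: (measurable_funM mK (mI m)).
    - by move=> m x _; rewrite lee_fin mulr_ge0// backward_kac_ge0.
    - by move=> x _ m k mk; rewrite lee_fin ler_wpM2l ?backward_kac_ge0// I_nd.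
  apply/funext => x; apply/cvg_lim => //; apply: cvg_EFin; first exact: nearW.
  by rewrite -[X in _ --> X]mulr1; apply: cvgM; [exact: cvg_cst|exact: I_cvg].
have FK_cvg x : forward_kac t (I m) x @[m --> \oo] --> forward_kac t (cst 1) x.
  apply: (@Rintegral_dominated_cvg _ _ _ P _ _ _ (cst 1)) => //.
  - move=> m; apply: measurable_funM; last by apply: measurable_end; exact: mI.
    exact: measurable_forward_weight.
  - by apply: measurable_funM => //; exact: measurable_forward_weight.
  - exact: finite_measure_integrable_cst.
  - move=> m w _; rewrite normrM mulr_ile1 ?normr_ge0 ?expRN_norm_le1 ?occupation_ge0//.
    by rewrite ger0_norm.
  - by apply: (aeW P) => w _; apply: cvgM; [exact: cvg_cst|exact: I_cvg].
have FK01 (psi : R -> R) x : (forall y, 0 <= psi y) -> (forall y, psi y <= 1) ->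
    measurable_fun setT psi -> `|forward_kac t psi x| <= 1.
  move=> p0 p1 mpsi; rewrite ger0_norm; last by apply: Rintegral_ge0 => w _; rewrite mulr_ge0// expR_ge0.
  have bnd w : `|expR (- occupation (forward_path x ^~ w) t) * psi (x + W t w)| <= 1.
    rewrite normrM mulr_ile1 ?normr_ge0 ?expRN_norm_le1 ?occupation_ge0//.
    by rewrite ger0_norm.
  have i1 : P.-integrable setT (EFin \o cst 1) by exact: finite_measure_integrable_cst.
  have -> : 1 = \int[P]_w (cst 1 w) :> R.
    by rewrite Rintegral_cst// (_ : fine _ = 1) ?mulr1//; rewrite [X in fine X]probability_setT.
  apply: le_Rintegral => //; last by move=> w _; rewrite (le_trans (ler_norm _)).
  apply: (le_integrable _ _ _ i1) => //; last by move=> w _; rewrite lee_fin normr1.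
  apply/measurable_EFinP; apply: measurable_funM; last exact: measurable_end.
  exact: measurable_forward_weight.
have mFK m : measurable_fun setT (forward_kac t (I m)) by exact: measurable_forward_kac.
have mFK1 : measurable_fun setT (forward_kac t (cst 1)).
  by apply: (measurable_fun_cvg (h := fun m => forward_kac t (I m))).
have ifk : mu.-integrable setT (EFin \o (fun x => f x * forward_kac t (cst 1) x)).
  apply: (le_integrable _ _ _ intf) => //.
    by apply/measurable_EFinP; exact: (measurable_funM Lf.1 mFK1).
  by move=> x _; rewrite lee_fin normrM ler_piMr// FK01.
rewrite -[RHS]EFin_Rintegral//.
have lim2 : (\int[mu]_x (f x * forward_kac t (I m) x))%:E @[m --> \oo] -->
    (\int[mu]_x (f x * forward_kac t (cst 1) x))%:E.
  apply: cvg_EFin; first exact: nearW.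
  apply: (@Rintegral_dominated_cvg _ (measurableTypeR R) R mu _ _ _ f) => //.
  - by move=> m; exact: (measurable_funM Lf.1 (mFK m)).
  - exact: (measurable_funM Lf.1 mFK1).
  - move=> m x _; rewrite normrM [`|f x|]ger0_norm// ler_piMr// FK01//.
  - by apply: (aeW mu) => x _; apply: cvgM; [exact: cvg_cst|exact: FK_cvg].
rewrite -(cvg_lim _ lim1)// -(cvg_lim _ lim2)//.
by congr (limn _); apply/funext => m; exact: step.
Qed.

End FeynmanKac.

(** * Reduction to continuous paths and continuous curves *)

Section NullModification.
Context d (T : measurableType d) (R : realType).
Variables (mu : {measure set T -> \bar R}) (N : set T).
Hypotheses (mN : measurable N) (N0 : mu N = 0%E).

Lemma measure_null_modification (A C : set T) : measurable A -> measurable C ->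
  (forall x, ~ N x -> A x <-> C x) -> mu A = mu C.
Proof.
move=> mA mC AC; rewrite -(measureU0 mA mN N0) -(measureU0 mC mN N0); congr (mu _).
apply/seteqP; split => x /= [h|h]; try by right.
  by have [Nx|/AC[AC1 _]] := pselect (N x); [right|left; exact: AC1].
by have [Nx|/AC[_ AC2]] := pselect (N x); [right|left; exact: AC2].
Qed.

Import HBNNSimple.

(* [f] need not be measurable: the integral of a nonnegative function is the
   supremum of the integrals of the simple functions below it *)
Lemma ge0_integral_null_modification (f g : T -> \bar R) : measurable_fun setT g ->
  (forall x, 0 <= f x)%E -> (forall x, 0 <= g x)%E -> (forall x, ~ N x -> f x = g x) ->
  (\int[mu]_x f x = \int[mu]_x g x)%E.
Proof.
move=> mg f0 g0 fg; apply/eqP; rewrite eq_le; apply/andP; split.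
  rewrite ge0_integralTE//; apply: ge_ereal_sup => _ /= [h hf <-].
  rewrite -integralT_nnsfun; apply: ae_ge0_le_integral => //.
  - by move=> x _; rewrite lee_fin.
  - exact/measurable_EFinP.
  - exists N; split => // x /= H; apply: contrapT => Nx; apply: H => _.
    by rewrite -fg.
(* [g'] is measurable, has the integral of [g] and lies below [f] everywhere, so each simple
   function below [g'] is below [f]. *)
pose g' := (g \_ (~` N))%E.
rewrite [leLHS](_ : _ = \int[mu]_x g' x)%E.
  have g'0 x : (0 <= g' x)%E by rewrite /g' patchE; case: ifP.
  rewrite ge0_integralTE// [leRHS]ge0_integralTE//; apply: ereal_sup_le => _ /= [h hg' <-].
  exists h => // x; rewrite (le_trans (hg' x))// /g' patchE; case: ifPn => [|_]; last exact: f0.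
  by rewrite inE /= => Nx; rewrite fg.
apply: ge0_ae_eq_integral => //.
- exact: (iffLR (measurable_restrictT g (measurableC mN)) (measurable_funTS mg)).
- by move=> x _; rewrite /g' patchE; case: ifP.
- exists N; split => // x /= H; apply: contrapT => Nx; apply: H => _.
  by rewrite /g' patchE mem_set.
Qed.

End NullModification.

(** * A version of the Brownian motion with all paths continuous *)

Section ContinuousVersion.
Context d (Omega : measurableType d) (R : realType) (P : probability Omega R).
Variable B : R -> {RV P >-> R}.
Hypothesis BM : standard_brownian_motion B.

Lemma continuous_max0_comp (g : R -> R) : {within `[0, +oo[, continuous g} ->
  continuous (fun t : R => g (Num.max t 0)).
Proof.
move=> /subspace_continuousP cg t.
have t0 : `[0, +oo[%classic (Num.max t 0) by rewrite /= in_itv/= andbT le_max lexx orbT.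
have cm : {for t, continuous (id \max cst 0 : R -> R^o)}.
  by apply: continuous_max; [exact: cvg_id|exact: cst_continuous].
apply: (@cvg_comp _ _ _ (fun t => Num.max t 0) g _ (within `[0, +oo[%classic (nbhs (Num.max t 0)))); last exact: cg.
move=> A HA; have {HA} : \forall s \near t, `[0, +oo[%classic (Num.max s 0) -> A (Num.max s 0).
  exact: (cm (fun s => `[0, +oo[%classic s -> A s) HA).
apply: filterS => s; apply.
by rewrite /= in_itv/= andbT le_max lexx orbT.
Qed.

Lemma brownian_continuous_version : exists (W : R -> Omega -> R) (N : set Omega),
  [/\ measurable N, P N = 0%E & forall w, ~ N w -> forall t, 0 <= t -> W t w = B t w] /\
  [/\ forall t, measurable_fun setT (W t), forall w, W 0 w = 0, forall w, continuous (W^~ w),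
    forall s t : R, 0 <= s -> s < t -> forall A : set R, measurable A ->
      P ((fun w => W t w - W s w) @^-1` A) = normal_prob 0 (Num.sqrt (t - s)) A &
    forall (n : nat) (t : nat -> R) (A : nat -> set R),
      0 <= t 0%N -> (forall i, t i <= t i.+1) -> (forall i, measurable (A i)) ->
      P (\bigcap_(i < n) ((fun w => W (t i.+1) w - W (t i) w) @^-1` A i)) =
      (\prod_(i < n) P ((fun w => W (t i.+1) w - W (t i) w)%R @^-1` A i))%E].
Proof.
have [[N1 [mN1 PN1 sN1]] [N2 [mN2 PN2 sN2]] law indep] := BM.
pose N := N1 `|` N2.
have mN : measurable N by exact: measurableU.
have PN : P N = 0%E by rewrite measureU0.
have B0 w : ~ N w -> B 0 w = 0.
  by move=> Nw; apply: contrapT => h; apply: Nw; left; exact: sN1.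
have cB w : ~ N w -> {within `[0, +oo[, continuous (fun t => B t w)}.
  by move=> Nw; apply: contrapT => h; apply: Nw; right; exact: sN2.
(* Zero on the exceptional set and constant for negative times, so that every path is continuous on
   the whole line. *)
pose W t w : R := \1_(~` N) w * B (Num.max t 0) w.
have WN w t : ~ N w -> 0 <= t -> W t w = B t w.
  by move=> Nw t0; rewrite /W indicE mem_set// mul1r max_l.
have mW t : measurable_fun setT (W t).
  by apply: measurable_funM => //; apply: measurable_indic; exact: measurableC.
have mpre (k : Omega -> R) (A : set R) : measurable_fun setT k -> measurable A -> measurable (k @^-1` A).
  by move=> mk mA; rewrite -[X in measurable X]setTI; exact: mk.
have incr (s t : R) (A : set R) : 0 <= s -> 0 <= t -> measurable A ->
    P ((fun w => W t w - W s w) @^-1` A) = P [set w | A (B t w - B s w)].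
  move=> s0 t0 mA; apply: (measure_null_modification mN PN).
  - by apply: mpre => //; exact: measurable_funB.
  - by apply: (mpre (fun w => B t w - B s w)) => //; exact: measurable_funB.
  - by move=> w Nw /=; rewrite !WN.
exists W, N; split; first by split => // w Nw t; exact: WN.
split => //.
- move=> w; have [Nw|Nw] := pselect (N w).
    by rewrite /W indicE memNset ?mul0r//; exact.
  by rewrite WN// B0.
- move=> w; have [Nw|Nw] := pselect (N w).
    rewrite (_ : W^~ w = cst 0); first exact: cst_continuous.
    by apply/funext => t; rewrite /W indicE memNset ?mul0r//; exact.
  rewrite (_ : W^~ w = fun t => B (Num.max t 0) w); last first.
    by apply/funext => t; rewrite /W indicE mem_set// mul1r.
  exact: continuous_max0_comp (cB w Nw).
- move=> s t s0 st A mA; rewrite incr//; first exact: law.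
  by rewrite (le_trans s0)// ltW.
- move=> n t A t0 tS mA.
  have ti i : 0 <= t i by elim: i => [//|i IH]; exact: le_trans (tS i).
  rewrite [LHS](_ : _ = P (\bigcap_(i < n) [set w | A i (B (t i.+1) w - B (t i) w)])).
    by rewrite indep//; apply: eq_bigr => i _; rewrite incr.
  apply: (measure_null_modification mN PN).
  + by apply: bigcap_measurableType => i _; apply: mpre => //; exact: measurable_funB.
  + apply: bigcap_measurableType => i _.
    by apply: (mpre (fun w => B (t i.+1) w - B (t i) w)) => //; exact: measurable_funB.
  + by move=> w Nw; split => H i ni; have := H i ni; rewrite /= !WN.
Qed.

End ContinuousVersion.

(** * From Sobolev curves on an interval to L^2 curves on the line *)

Section SobolevCurve.
Context {R : realType}.
Local Notation mu := (@lebesgue_measure R).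

(** The L^2 norm is the term of order 0 of [H_norm]; the other terms are squares. *)
Lemma nrm_le_H_norm k (v : R -> R) : L2 v -> nrm v <= H_norm k v.
Proof.
move=> Lv; apply: ler_wsqrtr.
have N2 : fine 'N[mu]_2%:E[EFin \o v] ^+ 2 = ip v v.
  have := @poweR_Lnorm _ _ R mu (EFin \o v) 2 _.
  rewrite (_ : (\int[mu]_x _)%E = (ip v v)%:E); last first.
    rewrite -nrm2 EFin_nrm2//; apply: eq_integral => x _.
    rewrite -[(EFin \o v) x]/((v x)%:E) abse_EFin poweR_EFin powR_mulrn//.
    by rewrite real_normK// num_real.
  move=> /(_ (lt0r_neq0 (ltr0Sn R 1))).
  have := Lnorm_ge0 mu 2%:E (EFin \o v).
  case: ('N[mu]_2%:E[EFin \o v])%E => [r| |]//.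
    by rewrite lee_fin => r0; rewrite poweR_EFin powR_mulrn// => -[].
  by rewrite poweRyr// pnatr_eq0.
by rewrite -N2 big_ord_recl/= lerDl sumr_ge0// => i _; exact: sqr_ge0.
Qed.

Definition clamp (T t : R) : R := Num.max (Num.min t T) 0.

Lemma clamp_itv T t : 0 <= T -> clamp T t \in `[0, T].
Proof. by move=> T0; rewrite in_itv/= /clamp le_max lexx orbT/= ge_max ge_min lexx orbT T0. Qed.

Lemma clamp_id T t : t \in `[0, T] -> clamp T t = t.
Proof. by rewrite in_itv/= => /andP[t0 tT]; rewrite /clamp min_l// max_l. Qed.

Lemma clamp_within T t : 0 <= T ->
  clamp T s @[s --> t] --> within `[0, T] (nbhs (clamp T t)).
Proof.
move=> T0.
have cm : {for t, continuous ((id \min cst T) \max cst 0 : R -> R^o)}.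
  apply: continuous_max; last exact: cst_continuous.
  by apply: continuous_min; [exact: cvg_id|exact: cst_continuous].
move=> A HA; have {HA} : \forall s \near t, clamp T s \in `[0, T] -> A (clamp T s).
  exact: (cm (fun s => s \in `[0, T] -> A s) HA).
by apply: filterS => s; apply; exact: clamp_itv.
Qed.

Lemma continuous_clamp (g : R -> R) T : 0 <= T -> {within `[0, T], continuous g} ->
  continuous (fun t => g (clamp T t)).
Proof.
move=> T0 /subspace_continuousP cg t.
apply: (@cvg_comp _ _ _ (clamp T) g _ (within `[0, T]%classic (nbhs (clamp T t)))).
  exact: clamp_within.
by apply: cg; exact: clamp_itv.
Qed.

Lemma L2_curve_clamp k T (u : R -> R -> R) : 0 <= T -> C_H k T u ->
  L2_curve (fun t => u (clamp T t)).
Proof.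
move=> T0 [inH cH].
have Lu t : t \in `[0, T] -> L2 (u t).
  by move=> /inH; case: k {cH inH} => [|k] [/Lfun_L2].
split=> [t|s]; first by apply: Lu; exact: clamp_itv.
have := cvg_comp _ _ (clamp_within (t := s) T0) (cH _ (clamp_itv s T0)).
apply: squeeze_cvgr; last exact: cvg_cst.
near=> t; rewrite nrm_ge0/=; apply: nrm_le_H_norm.
by apply: L2B; apply: Lu; exact: clamp_itv.
Unshelve. all: by end_near. Qed.

Lemma weak_pde_clamp T (f b : R -> R) (u : R -> R -> R) : 0 <= T -> weak_pde T f b u ->
  weak_pde T f (fun t => b (clamp T t)) (fun t => u (clamp T t)).
Proof.
move=> T0 weak phi tphi.
have TT : clamp T T = T by rewrite clamp_id// in_itv/= T0 lexx.
have E (h k : R -> R) : (forall t, t \in `[0, T] -> h t = k t) ->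
    \int[mu]_(t in `[0, T]) h t = \int[mu]_(t in `[0, T]) k t.
  by move=> hk; apply: eq_Rintegral => t; rewrite inE/=; exact: hk.
have Eu (h : R * R -> R) :
    \int[mu]_(t in `[0, T]) \int[mu]_x (u (clamp T t) x * h (t, x)) =
    \int[mu]_(t in `[0, T]) \int[mu]_x (u t x * h (t, x)).
  by apply: E => t /clamp_id ->.
have Eb : \int[mu]_(t in `[0, T]) \int[mu]_x (\1_(`]-oo, b (clamp T t)]) x * u (clamp T t) x * phi (t, x)) =
    \int[mu]_(t in `[0, T]) \int[mu]_x (\1_(`]-oo, b t]) x * u t x * phi (t, x)).
  by apply: E => t /clamp_id ->.
apply: (etrans (Eu ('D_((1 : R^o), (0 : R^o)) phi))); apply: (etrans (weak _ tphi)).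
have congr4 (p p' q r r' s s' : R) : p = p' -> r = r' -> s = s' ->
    p - q - 2^-1 * r + s = p' - q - 2^-1 * r' + s' by move=> -> -> ->.
apply: congr4; last exact: (esym Eb).
  exact: (congr1 (fun t => \int[mu]_x (u t x * phi (T, x))) (esym TT)).
exact: (esym (Eu ('D_((0 : R^o), (1 : R^o)) ('D_((0 : R^o), (1 : R^o)) phi)))).
Qed.

(** The set where two continuous functions differ is open, and a ball is never null. *)
Lemma continuous_ae_eq (g k : R -> R) : continuous g -> continuous k ->
  {ae mu, forall x, g x = k x} -> forall x, g x = k x.
Proof.
move=> cg ck [N [mN N0 sN]] x; apply: contrapT => /eqP; rewrite -subr_eq0 => gk.
have cgk : (fun y => g y - k y) y @[y --> x] --> g x - k x by apply: cvgB; [exact: cg|exact: ck].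
have /nbhs_ballP[e /= e0 He] : \forall y \near x, g y - k y != 0 by exact: (@cvgr_neq0 _ R^o _ _ _ _ _ cgk gk).
have ballN : ball x e `<=` N.
  by move=> y /He /= gky; apply: sN => /= gkE; rewrite gkE subrr eqxx in gky.
have : mu (ball x e) = 0%E.
  by apply: (subset_measure0 _ mN ballN N0); exact: measurable_ball.
rewrite lebesgue_measure_ball ?ltW// => -[] /eqP.
by rewrite mulrn_eq0/= gt_eqF.
Qed.

End SobolevCurve.

Theorem theorem4p1 (R : realType) (d : measure_display)
    (Omega : measurableType d) (P : probability Omega R)
    (B : R -> {RV P >-> R}) (T : R) (f G b : R -> R) (u : R -> R -> R) :
  standard_brownian_motion B ->
  0 < T ->
  C1_on 0 T G ->
  C_H 1 T u ->
  L2_H 2 T u ->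
  {within `[0, T], continuous b} ->
  weak_solution T f G b u ->
  f \in Lfun (@lebesgue_measure R) 2%:E ->
  (\int[@lebesgue_measure R]_x (f x)%:E = 1)%E ->
  let representation t x :=
    ((u t x)%:E =
     'E_P[fun w => (f (x + B t w) *
            expR (- \int[@lebesgue_measure R]_(s in `[0, t])
                      \1_(`]-oo, 0]) (x + B (t - s) w - b s)))%R])%E in
  [/\ (* u t is only given up to a null set, which may depend on t *)
      forall t, t \in `[0, T] ->
        {ae @lebesgue_measure R, forall x, representation t x},
      (* one null set for all t, for the continuous representatives of u t *)
      (forall t, t \in `[0, T] -> continuous (u t)) ->
        {ae @lebesgue_measure R, forall x, forall t, t \in `[0, T] ->
          representation t x} &
      forall t, t \in `[0, T] ->
        ((G t)%:E = \int[@lebesgue_measure R]_x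
          ('E_P[fun w => expR (- \int[@lebesgue_measure R]_(s in `[0, t])
                   \1_(`]-oo, 0]) (x + B s w - b s))%R] * (f x)%:E))%E].
Proof.
move=> BM T0 _ cu _ cb weak Lf f1 representation.
have T0' := ltW T0.
have {}Lf := Lfun_L2 Lf.
case: weak => weak fu0 fpos uG.
have f0 x : 0 <= f x by exact: ltW.
have int_f : lebesgue_measure.-integrable setT (EFin \o f).
  apply/integrableP; split; first by apply/measurable_EFinP; exact: Lf.1.
  rewrite [X in (X < _)%E](_ : _ = 1%E) ?ltry// -f1.
  by apply: eq_integral => x _ /=; rewrite ger0_norm.
have [W [N [[mN PN WN] [mW W0 cW lawW indepW]]]] := brownian_continuous_version BM.
pose uc t := u (clamp T t); pose bc t := b (clamp T t).
have cuc : L2_curve uc by exact: (L2_curve_clamp T0' cu).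
have cbc : continuous bc by exact: continuous_clamp.
have clamp0 : clamp T 0 = 0 by rewrite clamp_id// in_itv/= lexx.
have fuc0 : {ae lebesgue_measure, forall x, uc 0 x = f x} by rewrite /uc clamp0.
have weakc := weak_pde_clamp T0' weak.
have bcE s t : t <= T -> s \in `[0, t] -> bc s = b s.
  rewrite in_itv/= /bc => tT /andP[s0 st]; rewrite clamp_id// in_itv/= s0/=.
  exact: le_trans tT.
have backwardE t x : 0 < t -> t <= T ->
    ('E_P[fun w => (f (x + B t w) * expR (- \int[lebesgue_measure]_(s in `[0, t])
       \1_(`]-oo, 0]) (x + B (t - s) w - b s)))%R] = (backward_kac P W f bc t x)%:E)%E.
  move=> t0 tT; rewrite unlock.
  rewrite (ge0_integral_null_modification mN PN (g := EFin \o (fun w =>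
    expR (- occupation ((backward_path W bc t x)^~ w) t) * f (x + W t w)))).
  - rewrite /backward_kac /Rintegral fineK//; apply: integrable_fin_num => //.
    exact: (integrable_weighted mW W0 cW lawW cbc Lf f0 x x t0).
  - by have /integrableP[] := integrable_weighted mW W0 cW lawW cbc Lf f0 x x t0.
  - by move=> w; rewrite lee_fin mulr_ge0// expR_ge0.
  - by move=> w; rewrite lee_fin mulr_ge0// expR_ge0.
  - move=> w Nw.
    suff E : \int[lebesgue_measure]_(s in `[0, t]) \1_(`]-oo, 0]) (x + B (t - s) w - b s) =
        occupation (backward_path W bc t x ^~ w) t.
      by congr EFin; rewrite E (WN w Nw t (ltW t0)) mulrC.
    apply: eq_Rintegral => s; rewrite inE/= => st.
    rewrite /backward_path (bcE s t)// WN// subr_ge0.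
    by move: st; rewrite in_itv/= => /andP[].
(* Heat kernels require [0 < t]. At time 0 the functionals are constant off [N], which settles that
   case for both formulas. *)
have expectation0 (h : Omega -> R) c : (forall x, 0 <= h x) ->
    (forall w, ~ N w -> h w = c) -> ('E_P[h] = c%:E)%E.
  move=> h0 hc.
  have c0 : 0 <= c.
    have [w Nw] : exists w, ~ N w.
      apply: contrapT => /forallNP H; have : P setT = 0%E.
        rewrite (_ : setT = N)//; apply/seteqP; split => // w _.
        by apply: contrapT; exact: H.
      by rewrite probability_setT => /eqP; rewrite onee_eq0.
    by rewrite -(hc w Nw).
  rewrite unlock (ge0_integral_null_modification mN PN (g := cst c%:E))//.
  - by rewrite integral_cst// [X in (_ * X)%E]probability_setT mule1.
  - by move=> w Nw; rewrite hc.
have backward0 x : ('E_P[fun w => (f (x + B 0 w) * expR (- \int[lebesgue_measure]_(s in `[0, 0])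
       \1_(`]-oo, 0]) (x + B (0 - s) w - b s)))%R] = (f x)%:E)%E.
  apply: expectation0 => [w|w Nw]; first by rewrite mulr_ge0// expR_ge0.
  by rewrite set_itv1 Rintegral_set1 oppr0 expR0 mulr1 -WN// W0 addr0.
have itvP t : t \in `[0, T] -> t = 0 \/ 0 < t <= T.
  rewrite in_itv/= le_eqVlt => /andP[/orP[/eqP <-|t0] tT]; [by left|by right; rewrite t0].
have back t : 0 < t -> t <= T -> {ae lebesgue_measure, forall x, u t x = backward_kac P W f bc t x}.
  move=> t0 tT.
  have := backward_representation mW W0 cW lawW indepW T0 cuc cbc Lf f0 fuc0 weakc t0 tT.
  by rewrite /uc clamp_id// in_itv/= tT (ltW t0).
split.
- move=> t /itvP[->|/andP[t0 tT]].
    by apply: ae_sub fu0 => x; rewrite /representation backward0 => ->.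
  by apply: ae_sub (back t t0 tT) => x; rewrite /representation backwardE// => ->.
(* The only exceptional set is that of the initial condition: for [0 < t] both sides are continuous
   in [x], so almost everywhere equality is equality. *)
- move=> cut; apply: ae_sub fu0 => x ux0 t tI.
  have [->|/andP[t0 tT]] := itvP t tI; first by rewrite /representation backward0 ux0.
  rewrite /representation backwardE//; congr EFin.
  apply: (continuous_ae_eq _ _ (back t t0 tT)); first exact: cut.
  exact: (continuous_backward_kac mW W0 cW lawW cbc Lf f0 t0).
- move=> t tI; rewrite -uG//; have [t00|/andP[t0 tT]] := itvP t tI.
    rewrite t00; transitivity (\int[lebesgue_measure]_x (f x)%:E)%E.
      apply: ae_eq_integral => //.
      + by apply/measurable_EFinP; have := (cuc.1 0).1; rewrite /uc clamp0.
      + by apply/measurable_EFinP; exact: Lf.1.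
      + by apply: ae_sub fu0 => x /= ->.
    apply: eq_integral => x _; rewrite (expectation0 _ 1) ?mul1e//.
      by move=> w; rewrite set_itv1 Rintegral_set1 oppr0 expR0.
  have := total_mass mW W0 cW lawW indepW T0 cuc cbc Lf f0 fuc0 weakc t0 tT int_f.
  rewrite /uc clamp_id// => ->; apply: eq_integral => x _.
  rewrite muleC EFinM; congr (_ * _)%E; rewrite unlock.
  have mw := measurable_forward_weight mW cW cbc t x.
  rewrite (ge0_integral_null_modification mN PN (g := EFin \o (fun w =>
    expR (- occupation ((forward_path W bc x)^~ w) t)))).
  - rewrite /forward_kac /Rintegral fineK; last first.
      apply: integrable_fin_num => //; apply/integrableP; split.
        by apply/measurable_EFinP; apply: measurable_funM mw _; exact: measurable_cst.
      apply: (@le_lt_trans _ _ (\int[P]_w 1)%E); last first.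
        by rewrite integral_cst// [X in (_ * X)%E]probability_setT mule1 ltry.
      apply: ge0_le_integral => //.
      + apply/measurable_EFinP/measurableT_comp => //.
        by apply: measurable_funM mw _; exact: measurable_cst.
      + move=> w _ /=; rewrite mulr1 lee_fin ger0_norm ?expR_ge0// expR_le1 oppr_le0.
        by apply: Rintegral_ge0 => s _; rewrite indicE.
    by apply: eq_integral => w _ /=; rewrite mulr1.
  - exact/measurable_EFinP.
  - by move=> w; rewrite lee_fin expR_ge0.
  - by move=> w; rewrite lee_fin expR_ge0.
  - move=> w Nw /=; congr (expR (- _))%:E.
    apply: eq_Rintegral => s; rewrite inE/= => st.
    rewrite /forward_path (bcE s t)// WN//.
    by move: st; rewrite in_itv/= => /andP[].
Qed.
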